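(* The real $C^*$-algebra $A_i$ is semiprojective for each $i\in\{-1,1,3,5\}$.
   Context: Here $\mathbb H$ denotes the quaternions, $\begin{pmatrix}a&b\\c&d\end{pmatrix}^\sharp=\begin{pmatrix}d&-b\\-c&a\end{pmatrix}$ on $M_2(\mathbb C)$, and $A_{-1}=\{f\in C(S^1,\mathbb R):f(1)=0\}$; $A_1=\{f\in C(S^1,\mathbb C):f(1)=0,\ f(\overline z)=\overline{f(z)}\}$; $A_3=\{f\in C(S^1,\mathbb H):f(1)=0\}$; $A_5=\{f\in C(S^1,M_2(\mathbb C)):f(1)=0,\ f(\overline z)^\sharp=f(z)^*\}$. A real $C^*$-algebra is a real Banach $*$-algebra $D$ with $\|a^*a\|=\|a\|^2$ and with $1+a^*a$ invertible in the unitization for all $a\in D$; homomorphisms are real $*$-homomorphisms. A real $C^*$-algebra $A$ is semiprojective if for every real $C^*$-algebra $B$, every increasing sequence $J_1\subseteq J_2\subseteq\cdots$ of closed two-sided ideals of $B$ with $J=\overline{\bigcup_nJ_n}$, and every homomorphism $\varphi:A\to B/J$, there are an $n$ and a homomorphism $\psi:A\to B/J_n$ whose composition with the quotient map $B/J_n\to B/J$ is $\varphi$. *)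

(* Defs.v *)
From HB Require Import structures.
From mathcomp Require Import all_boot all_order all_algebra.
From mathcomp Require Import generic_quotient ring_quotient ring lra.
From mathcomp Require Import complex.
From mathcomp Require Import all_classical all_reals all_analysis.

Set Implicit Arguments.
Unset Strict Implicit.
Unset Printing Implicit Defensive.

Import Order.TTheory GRing.Theory Num.Theory.
Import numFieldNormedType.Exports.

Local Open Scope classical_set_scope.
Local Open Scope ring_scope.

Local Notation Re := complex.Re.
Local Notation Im := complex.Im.

Reserved Notation "x ** y" (at level 40, left associativity).

(* Associative, not necessarily unital, real algebras. *)
HB.mixin Record isNUAlgebra (R : realType) A of GRing.Lmodule R A := {
  amul : A -> A -> A;
  amulA : associative amul;
  amulDl : left_distributive amul +%R;
  amulDr : right_distributive amul +%R;
  amulZl : forall (k : R) x y, amul (k *: x) y = k *: amul x y;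
  amulZr : forall (k : R) x y, amul x (k *: y) = k *: amul x y }.

#[short(type="nuAlgType")]
HB.structure Definition NUAlgebra (R : realType) :=
  {A of GRing.Lmodule R A & isNUAlgebra R A}.

Notation "x ** y" := (amul x y) : ring_scope.

(* The bare operation; its axioms are part of isRealCstar.  This lets the
   quotient B/J carry its induced adjoint for any closed ideal J. *)
HB.mixin Record hasStar (A : Type) := { star : A -> A }.

#[short(type="preStarAlgType")]
HB.structure Definition PreStarAlgebra (R : realType) :=
  {A of NUAlgebra R A & hasStar A}.

Section Unitization.
Context (R : realType) (A : nuAlgType R).

(* (t, a) stands for t + a. *)
Definition unitization := (R * A)%type.

Definition unit_mul (u v : unitization) : unitization :=
  (u.1 * v.1, u.1 *: v.2 + v.1 *: u.2 + u.2 ** v.2).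

Definition unit_one : unitization := (1, 0).

Definition unit_invertible (u : unitization) : Prop :=
  exists v, unit_mul u v = unit_one /\ unit_mul v u = unit_one.

(* 1 + b is the inverse of 1 + a in the unitization. *)
Definition quasi_inverse (a b : A) : Prop := a + b + a ** b = 0 /\ a + b + b ** a = 0.

Lemma unit_invertibleP (a : A) :
  unit_invertible ((1, a) : unitization) <-> exists b, quasi_inverse a b.
Proof.
split=> [[[t b] [[]]]|[b [ab ba]]].
  rewrite /= mul1r => -> ab [_ ba]; exists b; split.
    by rewrite addrC -[RHS]ab !scale1r [b + a]addrC addrC.
  by rewrite -[RHS]ba /= !scale1r.
exists (1, b); rewrite /unit_mul /unit_one /= !mul1r !scale1r.
by rewrite [b + a]addrC; split; congr pair.
Qed.

End Unitization.

HB.mixin Record isRealCstar (R : realType) A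
    of CompleteNormedModule R A & PreStarAlgebra R A := {
  normr_amul : forall x y : A, `|x ** y| <= `|x| * `|y|;
  starD : {morph (star : A -> A) : x y / x + y};
  starZ : forall (k : R) (x : A), star (k *: x) = k *: star x;
  starM : forall x y : A, star (x ** y) = star y ** star x;
  starK : involutive (star : A -> A);
  cstar_identity : forall x : A, `|star x ** x| = `|x| ^+ 2;
  cstar_invertible : forall x : A, unit_invertible ((1, star x ** x) : unitization A) }.

#[short(type="realCstarType")]
HB.structure Definition RealCstar (R : realType) :=
  {A of CompleteNormedModule R A & PreStarAlgebra R A & isRealCstar R A}.

Definition star_hom (R : realType) (A D : preStarAlgType R) (f : A -> D) : Prop :=
  [/\ linear f, {morph f : x y / x ** y} & {morph f : x / star x}].

Record closed_ideal (R : realType) (B : realCstarType R) := ClosedIdeal {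
  ideal_set :> set B;
  ideal_closed : closed ideal_set;
  ideal0 : ideal_set 0;
  idealD : forall x y, ideal_set x -> ideal_set y -> ideal_set (x + y);
  idealZ : forall (k : R) x, ideal_set x -> ideal_set (k *: x);
  idealMl : forall b x, ideal_set x -> ideal_set (b ** x);
  idealMr : forall x b, ideal_set x -> ideal_set (x ** b) }.

Section AlgebraTheory.
Context (R : realType) (A : nuAlgType R).
Implicit Types x y : A.

Lemma amulNl x y : - x ** y = - (x ** y).
Proof. by rewrite -scaleN1r amulZl scaleN1r. Qed.

Lemma amulNr x y : x ** - y = - (x ** y).
Proof. by rewrite -scaleN1r amulZr scaleN1r. Qed.

Lemma amul0l y : 0 ** y = 0.
Proof. by have := amulZl 0 0 y; rewrite !scale0r. Qed.

Lemma amul0r x : x ** 0 = 0.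
Proof. by have := amulZr 0 x 0; rewrite !scale0r. Qed.

Lemma amulBl x y z : (x - y) ** z = x ** z - y ** z.
Proof. by rewrite amulDl amulNl. Qed.

Lemma amulBr x y z : x ** (y - z) = x ** y - x ** z.
Proof. by rewrite amulDr amulNr. Qed.

End AlgebraTheory.

Section QuotientAlgebra.
Context (R : realType) (B : realCstarType R) (J : closed_ideal B).

Definition ideal_pred : {pred B} := fun x => `[< ideal_set J x >].

Lemma idealP x : reflect (ideal_set J x) (x \in ideal_pred).
Proof. exact: asboolP. Qed.

Lemma ideal_pred_zmod_closed : zmod_closed ideal_pred.
Proof.
split; first by apply/idealP; exact: ideal0.
move=> x y /idealP Jx /idealP Jy; apply/idealP; apply: idealD => //.
by rewrite -scaleN1r; exact: idealZ.
Qed.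

HB.instance Definition _ :=
  GRing.isZmodClosed.Build B ideal_pred ideal_pred_zmod_closed.

Definition quot := Quotient.quot ideal_pred.

HB.instance Definition _ := GRing.Zmodule.on quot.

Definition quot_pi (x : B) : quot := (\pi_(Quotient.quot ideal_pred) x)%qT.

Lemma quot_piP x y : reflect (quot_pi x = quot_pi y) ((x - y) \in ideal_pred).
Proof. by rewrite Quotient.idealrBE; exact: eqP. Qed.

Definition quot_repr (q : quot) : B := repr q.

Lemma quot_reprK : cancel quot_repr quot_pi.
Proof. exact: reprK. Qed.

Lemma quot_repr_pi x : ideal_set J (quot_repr (quot_pi x) - x).
Proof. by apply/idealP/quot_piP; rewrite quot_reprK. Qed.

Lemma quot_piB x y : quot_pi (x - y) = quot_pi x - quot_pi y.
Proof. exact: raddfB. Qed.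

Lemma quot_piD x y : quot_pi (x + y) = quot_pi x + quot_pi y.
Proof. exact: raddfD. Qed.

Definition quot_scale (k : R) (q : quot) := quot_pi (k *: quot_repr q).

Lemma quot_scale_pi k x : quot_scale k (quot_pi x) = quot_pi (k *: x).
Proof.
apply/quot_piP; rewrite -scalerBr; apply/idealP/idealZ; exact: quot_repr_pi.
Qed.

Lemma quot_scaleA a b (q : quot) :
  quot_scale a (quot_scale b q) = quot_scale (a * b) q.
Proof. by rewrite -[q]quot_reprK !quot_scale_pi scalerA. Qed.

Lemma quot_scale1 : left_id 1 quot_scale.
Proof. by move=> q; rewrite -[q]quot_reprK quot_scale_pi scale1r. Qed.

Lemma quot_scaleDr : right_distributive quot_scale +%R.
Proof.
move=> k p q; rewrite -[p]quot_reprK -[q]quot_reprK -quot_piD !quot_scale_pi.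
by rewrite scalerDr quot_piD.
Qed.

Lemma quot_scaleDl (q : quot) : {morph quot_scale^~ q : a b / a + b}.
Proof.
by move=> a b; rewrite -[q]quot_reprK !quot_scale_pi scalerDl quot_piD.
Qed.

HB.instance Definition _ := GRing.Zmodule_isLmodule.Build R quot
  quot_scaleA quot_scale1 quot_scaleDr quot_scaleDl.

Lemma quot_piZ k x : quot_pi (k *: x) = k *: quot_pi x.
Proof. by rewrite -quot_scale_pi. Qed.

Definition quot_mul (p q : quot) := quot_pi (quot_repr p ** quot_repr q).

Lemma quot_mul_pi x y : quot_mul (quot_pi x) (quot_pi y) = quot_pi (x ** y).
Proof.
apply/quot_piP.
set u := quot_repr _; set v := quot_repr _.
have -> : u ** v - x ** y = (u - x) ** v + x ** (v - y).
  by rewrite amulBl amulBr addrA subrK.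
apply/idealP/idealD; [apply: idealMr|apply: idealMl]; exact: quot_repr_pi.
Qed.

Lemma quot_mulA : associative quot_mul.
Proof.
move=> p q r; rewrite -[p]quot_reprK -[q]quot_reprK -[r]quot_reprK.
by rewrite !quot_mul_pi amulA.
Qed.

Lemma quot_mulDl : left_distributive quot_mul +%R.
Proof.
move=> p q r; rewrite -[p]quot_reprK -[q]quot_reprK -[r]quot_reprK.
by rewrite -quot_piD !quot_mul_pi amulDl quot_piD.
Qed.

Lemma quot_mulDr : right_distributive quot_mul +%R.
Proof.
move=> p q r; rewrite -[p]quot_reprK -[q]quot_reprK -[r]quot_reprK.
by rewrite -quot_piD !quot_mul_pi amulDr quot_piD.
Qed.

Lemma quot_mulZl (k : R) p q : quot_mul (k *: p) q = k *: quot_mul p q.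
Proof.
rewrite -[p]quot_reprK -[q]quot_reprK.
by rewrite -quot_piZ !quot_mul_pi amulZl quot_piZ.
Qed.

Lemma quot_mulZr (k : R) p q : quot_mul p (k *: q) = k *: quot_mul p q.
Proof.
rewrite -[p]quot_reprK -[q]quot_reprK.
by rewrite -quot_piZ !quot_mul_pi amulZr quot_piZ.
Qed.

HB.instance Definition _ := isNUAlgebra.Build R quot
  quot_mulA quot_mulDl quot_mulDr quot_mulZl quot_mulZr.

(* The adjoint of a coset.  Closed two-sided ideals of real C*-algebras are
   self-adjoint, so the value does not depend on the representative. *)
Definition quot_star (q : quot) : quot := quot_pi (star (quot_repr q)).

HB.instance Definition _ := hasStar.Build quot quot_star.

Lemma quot_star_pi x : (forall y, ideal_set J y -> ideal_set J (star y)) ->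
  star (quot_pi x) = quot_pi (star x).
Proof.
move=> Jstar; apply/quot_piP/idealP.
rewrite -scaleN1r -starZ scaleN1r -starD.
exact/Jstar/quot_repr_pi.
Qed.

End QuotientAlgebra.

(* The map B/I -> B/J induced by an inclusion of ideals (see quot_map_pi). *)
Definition quot_map (R : realType) (B : realCstarType R) (I J : closed_ideal B)
  (q : quot I) : quot J := quot_pi J (quot_repr q).

Lemma quot_map_pi (R : realType) (B : realCstarType R) (I J : closed_ideal B) x :
  I `<=` J -> quot_map J (quot_pi I x) = quot_pi J x.
Proof. by move=> IJ; apply/quot_piP/idealP/IJ/quot_repr_pi. Qed.

Definition semiprojective (R : realType) (A : realCstarType R) : Prop :=
  forall (B : realCstarType R) (J : nat -> closed_ideal B) (Joo : closed_ideal B),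
    (forall n, J n `<=` J n.+1) ->
    Joo = closure (\bigcup_n J n) :> set B ->
  forall phi : A -> quot Joo, star_hom phi ->
  exists (n : nat) (psi : A -> quot (J n)),
    star_hom psi /\ (forall a, quot_map Joo (psi a) = phi a).

Section Coordinates.
Context (R : realType) (V : normedModType R) (I : finType).
Variables (c : I -> V -> R) (M : R).
Hypothesis cB : forall i x y, c i (x - y) = c i x - c i y.
Hypothesis c_le : forall i x, `|c i x| <= `|x|.
Hypothesis le_c : forall x, `|x| <= M * \sum_i `|c i x|.
Hypothesis c_surj : forall a : I -> R, exists x, forall i, c i x = a i.

Lemma coordinates_complete (F : set_system V) :
  ProperFilter F -> cauchy F -> cvg F.
Proof.
move=> FF /cauchy_ballP Fc.
have ci_cvg i : exists l : R, c i @ F --> l.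
  suff : cvg (c i @ F) by move=> /cvg_ex.
  apply: R_complete; apply/cauchy_ballP => e e0.
  have [[A B] [FA FB] AB] := Fc e e0.
  exists (c i @` A, c i @` B).
    by split; [apply: filterS FA|apply: filterS FB] => x Px; exists x.
  move=> [_ _] [[x Ax <-] [y By <-]].
  have := AB (x, y) (conj Ax By).
  rewrite -!ball_normE /= -cB; exact: le_lt_trans (c_le _ _).
have [l lP] := choice ci_cvg.
have [x xP] := c_surj l.
apply/cvg_ex; exists x; apply/cvgrPdist_lt => e e0.
have M1 : 0 < `|M| + 1 by rewrite ltr_wpDl.
have d0 : 0 < e / (`|M| + 1) / (#|I|%:R + 1).
  by rewrite !divr_gt0 // ltr_wpDl.
have H : \forall y \near F, forall i, `|l i - c i y| < e / (`|M| + 1) / (#|I|%:R + 1).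
  apply: filter_forall => i.
  by have /cvgrPdist_lt/(_ _ d0) := lP i.
apply: filterS H => y Hy.
apply: le_lt_trans (le_c _) _.
set d := e / _ / _ in d0 Hy.
have S : \sum_i `|c i (x - y)| <= #|I|%:R * d.
  have S' i : true -> `|c i (x - y)| <= d by rewrite cB xP => _; exact/ltW.
  by apply: le_trans (ler_sum _ S') _; rewrite sumr_const mulr_natl.
apply: le_lt_trans (ler_wpM2r _ (ler_norm M)) _; first by rewrite sumr_ge0.
apply: le_lt_trans (ler_wpM2l _ S) _ => //.
have N0 : (0 : R) <= #|I|%:R by [].
have -> : e = (`|M| + 1) * (#|I|%:R + 1) * d.
  by rewrite /d; field; apply/andP; split; rewrite lt0r_neq0 // ltr_wpDl.
have := normr_ge0 M; move: (`|M|) (#|I|%:R : R) N0 (d) d0 => m N N0 dd d0 m0.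
have h1 := mulr_ge0 m0 (ltW d0); have h2 := mulr_ge0 N0 (ltW d0).
have -> : (m + 1) * (N + 1) * dd = m * (N * dd) + (m * dd + N * dd + dd) by ring.
lra.
Qed.

End Coordinates.

(* Rcomplex R is the library's R[i] seen as a real vector space, with the
   modulus as real-valued norm. *)
Section Complex.
Variable R : realType.

HB.instance Definition _ :=
  PseudoMetric.copy (Rcomplex R) (pseudoMetric_normed (Rcomplex R)).
HB.instance Definition _ := isPointed.Build (Rcomplex R) 0.
HB.instance Definition _ := NormedZmod_PseudoMetric_eq.Build R (Rcomplex R) erefl.

Lemma normcE (z : Rcomplex R) : `|z| = Num.sqrt (Re z ^+ 2 + Im z ^+ 2).
Proof. by case: z. Qed.

Lemma Rcomplex_normrZ (k : R) (z : Rcomplex R) : `|k *: z| = `|k| * `|z|.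
Proof.
rewrite !normcE; case: z => a b /=.
by rewrite !exprMn -mulrDr sqrtrM ?sqr_ge0 // sqrtr_sqr.
Qed.

HB.instance Definition _ :=
  PseudoMetricNormedZmod_Lmodule_isNormedModule.Build R (Rcomplex R)
    Rcomplex_normrZ.

Lemma Re_le_norm (z : Rcomplex R) : `|Re z| <= `|z|.
Proof.
by rewrite normcE -sqrtr_sqr ler_wsqrtr // lerDl sqr_ge0.
Qed.

Lemma Im_le_norm (z : Rcomplex R) : `|Im z| <= `|z|.
Proof.
by rewrite normcE -sqrtr_sqr ler_wsqrtr // lerDr sqr_ge0.
Qed.

Lemma norm_le_ReIm (z : Rcomplex R) : `|z| <= `|Re z| + `|Im z|.
Proof.
rewrite normcE -[leRHS]ger0_norm ?addr_ge0 // -sqrtr_sqr ler_wsqrtr //.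
rewrite -(real_normK (num_real (Re z))) -(real_normK (num_real (Im z))).
have := mulr_ge0 (normr_ge0 (Re z)) (normr_ge0 (Im z)); lra.
Qed.

Lemma Rcomplex_complete (F : set_system (Rcomplex R)) :
  ProperFilter F -> cauchy F -> cvg F.
Proof.
apply: (@coordinates_complete R (Rcomplex R) bool (fun b z => if b then Re z else Im z) 1).
- by move=> [] [a b] [c d].
- by move=> []; [exact: Re_le_norm|exact: Im_le_norm].
- by move=> z; rewrite mul1r big_bool norm_le_ReIm.
- by move=> a; exists (Complex (a true) (a false)) => -[].
Qed.

HB.instance Definition _ := Uniform_isComplete.Build (Rcomplex R) Rcomplex_complete.

End Complex.

Section Circle.
Variable R : realType.

Definition circle_set : set (Rcomplex R) := [set z | `|z| = 1].

(* S^1 with the topology induced from the complex plane. *)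
Definition circle : Type := circle_set.

HB.instance Definition _ := Topological.copy circle (set_type circle_set).

Definition circle_val (z : circle) : Rcomplex R := set_val z.

Lemma circle_valP (z : circle) : `|circle_val z| = 1.
Proof. exact: (set_valP z). Qed.

Lemma circle_val_inj : injective circle_val.
Proof. exact: val_inj. Qed.

Definition mk_circle (z : Rcomplex R) (z1 : `|z| = 1) : circle :=
  SigSub (mem_set z1 : z \in circle_set).

Lemma circle1_subproof : `|1 : Rcomplex R| = 1.
Proof. exact: Normc.normc1. Qed.

Definition circle1 : circle := mk_circle circle1_subproof.

Lemma circle_conj_subproof (z : circle) : `|conjc (circle_val z) : Rcomplex R| = 1.
Proof.
rewrite -[RHS](circle_valP z) !normcE.
by case: (circle_val z) => a b /=; rewrite sqrrN.
Qed.

Definition circle_conj (z : circle) : circle := mk_circle (circle_conj_subproof z).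

Lemma circle_conjE (z : circle) : circle_val (circle_conj z) = conjc (circle_val z).
Proof. by []. Qed.

Lemma circle_conjK : involutive circle_conj.
Proof. by move=> z; apply: circle_val_inj; rewrite !circle_conjE conjcK. Qed.

Lemma circle_conj1 : circle_conj circle1 = circle1.
Proof. by apply: circle_val_inj; rewrite circle_conjE; exact: conjc1. Qed.

Let pt (p : R * R) : Rcomplex R := Complex p.1 p.2.

Let pt_continuous : continuous pt.
Proof.
move=> p; apply/cvgrPdist_le => e e0.
have e20 : 0 < e / 2 by lra.
have h1 : \forall q \near p, `|p.1 - q.1| <= e / 2.
  have : (fun q : R * R => q.1) @ p --> p.1 by exact: cvg_fst.
  by move=> /cvgrPdist_le/(_ _ e20).
have h2 : \forall q \near p, `|p.2 - q.2| <= e / 2.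
  have : (fun q : R * R => q.2) @ p --> p.2 by exact: cvg_snd.
  by move=> /cvgrPdist_le/(_ _ e20).
near=> q.
have q1 : `|p.1 - q.1| <= e / 2 by near: q.
have q2 : `|p.2 - q.2| <= e / 2 by near: q.
apply: le_trans (norm_le_ReIm _) _.
rewrite /pt /=; lra.
Unshelve. all: by end_near. Qed.

Let Q : set (R * R) := [set p | p.1 ^+ 2 + p.2 ^+ 2 = 1].

Let Q_compact : compact Q.
Proof.
apply: (subclosed_compact _ (compact_setX (@segment_compact R (-1) 1)
  (@segment_compact R (-1) 1))).
- apply: (@closed_comp _ _ (fun p : R * R => p.1 ^+ 2 + p.2 ^+ 2) [set x | x = 1]).
    move=> p _; apply: cvgD; rewrite !expr2; apply: cvgM;
      by [exact: cvg_fst|exact: cvg_snd].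
  exact: closed_eq.
- move=> [a b]; rewrite /Q /= => ab; split => /=; rewrite in_itv /= -ler_norml;
    rewrite -sqrtr_sqr -sqrtr1 ler_wsqrtr //.
    by have := sqr_ge0 b; lra.
  by have := sqr_ge0 a; lra.
Qed.

Let Q_norm p : Q p -> `|pt p| = 1.
Proof. by rewrite normcE => /= ->; rewrite sqrtr1. Qed.

Let h (p : R * R) : circle :=
  if pselect (Q p) is left Qp then mk_circle (Q_norm Qp) else circle1.

Let hE p : Q p -> circle_val (h p) = pt p.
Proof. by rewrite /h; case: pselect. Qed.

Lemma circle_compact : compact [set: circle].
Proof.
have -> : [set: circle] = h @` Q.
  apply/seteqP; split => // z _ /=.
  have Qz : Q (Re (circle_val z), Im (circle_val z)).
    have := circle_valP z; rewrite normcE => /(congr1 (fun x => x ^+ 2)).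
    by rewrite expr1n sqr_sqrtr // addr_ge0 // sqr_ge0.
  exists (Re (circle_val z), Im (circle_val z)) => //.
  by apply: circle_val_inj; rewrite hE //; case: (circle_val z).
apply: continuous_compact Q_compact.
apply: (@continuous_comp_initial circle (subspace Q) (Rcomplex R) (@set_val _ circle_set) h).
apply: (@subspace_eq_continuous _ Q _ pt).
  by move=> p /set_mem Qp; exact/esym/hE.
exact: continuous_subspaceT.
Qed.

End Circle.

Section CstarTheory.
Context (R : realType) (F : realCstarType R).
Implicit Types x y a b : F.

Lemma norm_star x : `|star x| = `|x|.
Proof.
have le y : `|y| <= `|star y|.
  have [->|y0] := eqVneq `|y| 0; first by [].
  rewrite -(@ler_pM2r _ `|y|) ?lt0r ?y0 //= -expr2 -cstar_identity.
  exact: normr_amul.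
by apply/le_anti; rewrite le andbT -[X in _ <= `|X|]starK le.
Qed.

Lemma starN x : star (- x) = - star x.
Proof. by rewrite -scaleN1r starZ scaleN1r. Qed.

Lemma star0 : star 0 = 0 :> F.
Proof. by have := starZ 0 (0 : F); rewrite !scale0r. Qed.

Lemma starB x y : star (x - y) = star x - star y.
Proof. by rewrite starD starN. Qed.

Lemma quasi_inverse_uniq a b b' : quasi_inverse a b -> quasi_inverse a b' -> b = b'.
Proof.
move=> [ab _] [_ b'a].
have e1 : b = - (a + a ** b).
  by apply/eqP; rewrite -addr_eq0 addrCA addrA ab.
have e2 : b' = - (a + b' ** a).
  by apply/eqP; rewrite -addr_eq0 addrCA addrA b'a.
have : b' ** (a + b + a ** b) = (a + b' + b' ** a) ** b.
  by rewrite ab b'a amul0l amul0r.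
rewrite !amulDr !amulDl amulA => /eqP; rewrite (inj_eq (addIr _)).
rewrite (inj_eq (addIr _)) => /eqP e3.
by rewrite e1 e2 e3.
Qed.

(* (1 + b) - (1 + b') = (1 + b) (a' - a) (1 + b'). *)
Lemma quasi_inverseB a b a' b' : quasi_inverse a b -> quasi_inverse a' b' ->
  let d := a' - a in b - b' = d + b ** d + d ** b' + b ** d ** b'.
Proof.
move=> [_ ba] [a'b' _] d.
have e2 : a' ** b' = - (a' + b') by apply/eqP; rewrite -addr_eq0 addrC a'b'.
pose w := a' + b ** a'.
have eu : d + b ** d = w + b.
  rewrite /d /w amulBr addrACA; congr (_ + _).
  by apply/eqP; rewrite -subr_eq0 -!opprD oppr_eq0 addrAC ba.
have ew : w ** b' = - w - (b' + b ** b').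
  rewrite /w amulDl -amulA e2 amulNr amulDr -!opprD; congr (- _).
  by rewrite addrACA.
rewrite -addrA -amulDl eu amulDl.
have -> : w ** b' + b ** b' = - w - b' by rewrite ew [- (b' + _)]opprD addrA subrK.
by rewrite addrACA subrr add0r.
Qed.

Lemma cvg_bound (T : topologicalType) (f : T -> F) t (h : T -> R) :
  h @ t --> (0 : R) -> (\forall s \near t, `|f t - f s| <= h s) -> f @ t --> f t.
Proof.
move=> h0 fh; apply/cvgrPdist_le => e e0.
have h0' : \forall s \near t, `|0 - h s| <= e by move/cvgrPdist_le: h0; apply.
apply: filterS2 fh h0' => s le; rewrite sub0r normrN => le'.
by rewrite (le_trans le) // (le_trans _ le') // ler_norm.
Qed.

Lemma dist_cvg0 (T : topologicalType) (f : T -> F) t :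
  f @ t --> f t -> (fun s => `|f t - f s|) @ t --> (0 : R).
Proof.
move=> ft; have -> : (0 : R) = `|f t - f t| by rewrite subrr normr0.
by apply: cvg_norm; apply: cvgB; [exact: cvg_cst|exact: ft].
Qed.

Lemma continuous_norm (T : topologicalType) (f : T -> F) :
  continuous f -> continuous (fun t => `|f t|).
Proof. by move=> cf t; apply: cvg_norm; exact: cf. Qed.

Lemma continuous_uniform_limit (T : topologicalType) (l : T -> F) :
  (forall e : R, 0 < e ->
    exists2 f : T -> F, continuous f & forall t, `|l t - f t| <= e) ->
  continuous l.
Proof.
move=> lf t; apply/cvgrPdist_le => e e0; have e30 : 0 < e / 3 by lra.
have [f fc {}lf] := lf _ e30.
have /cvgrPdist_le/(_ _ e30) := fc t.
apply: filterS => s fts.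
have h1 := ler_normD (l t - f t + (f t - f s)) (f s - l s).
have h2 := ler_normD (l t - f t) (f t - f s).
have h3 : l t - f t + (f t - f s) + (f s - l s) = l t - l s.
  by rewrite !addrA !subrK.
move: h1; rewrite h3 [`|f s - _|]distrC => h1.
have := lf t; have := lf s; lra.
Qed.

Lemma continuous_funD (T : topologicalType) (f g : T -> F) :
  continuous f -> continuous g -> continuous (fun t => f t + g t).
Proof. by move=> cf cg t; apply: cvgD; [exact: cf|exact: cg]. Qed.

Lemma continuous_funZ (T : topologicalType) (k : R) (f : T -> F) :
  continuous f -> continuous (fun t => k *: f t).
Proof. by move=> cf t; apply: cvgZr; exact: cf. Qed.

Lemma continuous_amul (T : topologicalType) (f g : T -> F) :
  continuous f -> continuous g -> continuous (fun t => f t ** g t).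
Proof.
move=> cf cg t.
pose h s := `|f t - f s| * `|g s| + `|f t| * `|g t - g s|.
apply: (@cvg_bound _ _ _ h).
  have -> : (0 : R) = 0 * `|g t| + `|f t| * 0 by rewrite mul0r mulr0 addr0.
  apply: cvgD; apply: cvgM.
  - by apply: dist_cvg0; exact: cf.
  - by apply: cvg_norm; exact: cg.
  - exact: cvg_cst.
  - by apply: dist_cvg0; exact: cg.
apply: nearW => s.
have -> : f t ** g t - f s ** g s = (f t - f s) ** g s + f t ** (g t - g s).
  by rewrite amulBl amulBr [RHS]addrC addrA subrK.
by rewrite (le_trans (ler_normD _ _)) // lerD // normr_amul.
Qed.

Lemma continuous_star (T : topologicalType) (f : T -> F) :
  continuous f -> continuous (fun t => star (f t)).
Proof.
move=> cf t; apply: (@cvg_bound _ _ _ (fun s => `|f t - f s|)).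
  by apply: dist_cvg0; exact: cf.
by apply: nearW => s; rewrite -starB norm_star.
Qed.

Lemma continuous_quasi_inverse (T : topologicalType) (f g : T -> F) :
  (forall t, quasi_inverse (f t) (g t)) -> continuous f -> continuous g.
Proof.
move=> fg cf t.
pose c := 1 + `|g t|; pose h s := `|f t - f s| * (2 * c ^+ 2).
have c1 : 1 <= c by rewrite lerDl.
apply: (@cvg_bound _ _ _ h).
  have -> : (0 : R) = 0 * (2 * c ^+ 2) by rewrite mul0r.
  by apply: cvgM; [apply: dist_cvg0; exact: cf|exact: cvg_cst].
have small : \forall s \near t, `|f t - f s| <= (2 * c)^-1.
  have /cvgrPdist_le := cf t; apply; rewrite invr_gt0; lra.
apply: filterS small => s le.
have := quasi_inverseB (fg t) (fg s); rewrite /= => e.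
set b := `|g t - g s|.
have dd : `|f s - f t| = `|f t - f s| by rewrite distrC.
have gs : `|g s| <= `|g t| + b.
  by rewrite -[X in `|X| <= _](subKr (g t)) (le_trans (ler_normB _ _)).
have b_le : b <= `|f t - f s| * (c * (c + b)).
  rewrite {1}/b e.
  apply: (@le_trans _ _ (`|f t - f s| * ((1 + `|g t|) * (1 + `|g s|)))).
    apply: (@le_trans _ _ (`|f t - f s| + `|g t| * `|f t - f s| +
        `|f t - f s| * `|g s| + `|g t| * `|f t - f s| * `|g s|)).
      rewrite -dd; apply: le_trans (ler_normD _ _) (lerD _ _); last first.
        by apply: le_trans (normr_amul _ _) _; rewrite ler_wpM2r // normr_amul.
      apply: le_trans (ler_normD _ _) (lerD _ _); last exact: normr_amul.
      by apply: le_trans (ler_normD _ _) (lerD _ _) => //; exact: normr_amul.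
    by rewrite le_eqVlt; apply/orP; left; apply/eqP; ring.
  rewrite ler_wpM2l // /c ler_wpM2l ?addr_ge0 //.
  by rewrite -addrA lerD2l.
have c0 : 0 < c by lra.
have half : `|f t - f s| * c <= 2^-1.
  by apply: le_trans (ler_wpM2r (ltW c0) le) _; rewrite invfM mulfVK // lt0r_neq0.
have b0 : 0 <= b by rewrite /b normr_ge0.
have := ler_wpM2r b0 half.
rewrite /h; move: b_le; move: (`|f t - f s|) => d; rewrite expr2.
have -> : d * (c * (c + b)) = d * (c * c) + d * c * b by ring.
have -> : d * (2 * (c * c)) = 2 * (d * (c * c)) by ring.
lra.
Qed.

End CstarTheory.


(* A closed real *-subalgebra of C(S^1, F), given as a set of functions; by
   fun_set_inverse it also contains the quasi-inverses of its elements, which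
   gives the invertibility axiom of a real C*-algebra. *)
Record fun_algebra (R : realType) (F : realCstarType R) := FunAlgebra {
  fun_set :> set (circle R -> F);
  fun_continuous : forall f, fun_set f -> continuous f;
  fun_set0 : fun_set (fun=> 0);
  fun_setD : forall f g, fun_set f -> fun_set g -> fun_set (fun z => f z + g z);
  fun_setZ : forall (k : R) f, fun_set f -> fun_set (fun z => k *: f z);
  fun_setM : forall f g, fun_set f -> fun_set g -> fun_set (fun z => f z ** g z);
  fun_set_star : forall f, fun_set f -> fun_set (fun z => star (f z));
  fun_set_inverse : forall f g, fun_set f ->
    (forall z, quasi_inverse (f z) (g z)) -> fun_set g;
  fun_set_closed : forall f, continuous f ->
    (forall e : R, 0 < e -> exists2 g, fun_set g & forall z, `|f z - g z| <= e) ->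
    fun_set f }.

Record fun_alg (R : realType) (F : realCstarType R) (S : fun_algebra F) := FunAlg {
  fun_val :> circle R -> F;
  fun_valP : fun_set S fun_val }.

Section FunAlg.
Context (R : realType) (F : realCstarType R) (S : fun_algebra F).
Local Notation A := (fun_alg S).
Implicit Types f g h : A.

Lemma fun_algP f g : (forall z, f z = g z) -> f = g.
Proof.
case: f g => [f fS] [g gS] /= fg.
have e : f = g by apply/funext.
by case: g / e fg gS => _ gS; congr FunAlg; exact: Prop_irrelevance.
Qed.

HB.instance Definition _ := gen_eqMixin A.
HB.instance Definition _ := gen_choiceMixin A.

Definition fun_zero : A := FunAlg (fun_set0 S).
Definition fun_add f g : A := FunAlg (fun_setD (fun_valP f) (fun_valP g)).
Definition fun_scale (k : R) f : A := FunAlg (fun_setZ k (fun_valP f)).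
Definition fun_opp f : A := fun_scale (-1) f.
Definition fun_mul f g : A := FunAlg (fun_setM (fun_valP f) (fun_valP g)).
Definition fun_star f : A := FunAlg (fun_set_star (fun_valP f)).

Lemma fun_addA : associative fun_add.
Proof. by move=> f g h; apply: fun_algP => z /=; rewrite addrA. Qed.

Lemma fun_addC : commutative fun_add.
Proof. by move=> f g; apply: fun_algP => z /=; rewrite addrC. Qed.

Lemma fun_add0 : left_id fun_zero fun_add.
Proof. by move=> f; apply: fun_algP => z /=; rewrite add0r. Qed.

Lemma fun_addN : left_inverse fun_zero fun_opp fun_add.
Proof. by move=> f; apply: fun_algP => z /=; rewrite scaleN1r addNr. Qed.

HB.instance Definition _ :=
  GRing.isZmodule.Build A fun_addA fun_addC fun_add0 fun_addN.

Lemma fun_scaleA a b f : fun_scale a (fun_scale b f) = fun_scale (a * b) f.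
Proof. by apply: fun_algP => z /=; rewrite scalerA. Qed.

Lemma fun_scale1 : left_id 1 fun_scale.
Proof. by move=> f; apply: fun_algP => z /=; rewrite scale1r. Qed.

Lemma fun_scaleDr : right_distributive fun_scale +%R.
Proof. by move=> k f g; apply: fun_algP => z /=; rewrite scalerDr. Qed.

Lemma fun_scaleDl f : {morph fun_scale^~ f : a b / a + b}.
Proof. by move=> a b; apply: fun_algP => z /=; rewrite scalerDl. Qed.

HB.instance Definition _ := GRing.Zmodule_isLmodule.Build R A
  fun_scaleA fun_scale1 fun_scaleDr fun_scaleDl.

Lemma fun_mulA : associative fun_mul.
Proof. by move=> f g h; apply: fun_algP => z /=; rewrite amulA. Qed.

Lemma fun_mulDl : left_distributive fun_mul +%R.
Proof. by move=> f g h; apply: fun_algP => z /=; rewrite amulDl. Qed.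

Lemma fun_mulDr : right_distributive fun_mul +%R.
Proof. by move=> f g h; apply: fun_algP => z /=; rewrite amulDr. Qed.

Lemma fun_mulZl (k : R) f g : fun_mul (k *: f) g = k *: fun_mul f g.
Proof. by apply: fun_algP => z /=; rewrite amulZl. Qed.

Lemma fun_mulZr (k : R) f g : fun_mul f (k *: g) = k *: fun_mul f g.
Proof. by apply: fun_algP => z /=; rewrite amulZr. Qed.

HB.instance Definition _ := isNUAlgebra.Build R A
  fun_mulA fun_mulDl fun_mulDr fun_mulZl fun_mulZr.
HB.instance Definition _ := hasStar.Build A fun_star.

Lemma fun_valD f g z : (f + g) z = f z + g z. Proof. by []. Qed.
Lemma fun_valZ (k : R) f z : (k *: f) z = k *: f z. Proof. by []. Qed.
Lemma fun_valN f z : (- f) z = - f z. Proof. exact: scaleN1r. Qed.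
Lemma fun_valB f g z : (f - g) z = f z - g z.
Proof. by rewrite fun_valD fun_valN. Qed.
Lemma fun_valM f g z : (f ** g) z = f z ** g z. Proof. by []. Qed.
Lemma fun_val_star f z : (star f) z = star (f z). Proof. by []. Qed.

(* The sup norm. *)
Definition fun_norm f : R := sup (range (fun z => `|f z|)).

Lemma fun_norm_has_sup f : has_sup (range (fun z => `|f z|)).
Proof.
apply: compact_has_sup; first by exists `|f (circle1 R)|; exists (circle1 R).
apply: continuous_compact; last exact: circle_compact.
apply: continuous_subspaceT.
exact: continuous_norm (fun_continuous (fun_valP f)).
Qed.

Lemma fun_norm_ub f z : `|f z| <= fun_norm f.
Proof.
by apply: sup_upper_bound; [exact: fun_norm_has_sup|exists z].
Qed.

Lemma fun_norm_le f (M : R) : (forall z, `|f z| <= M) -> fun_norm f <= M.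
Proof.
move=> fM; apply: ge_sup; first by have [] := fun_norm_has_sup f.
by move=> _ [z _ <-].
Qed.

Lemma fun_norm_ge0 f : 0 <= fun_norm f.
Proof. exact: le_trans (normr_ge0 _) (fun_norm_ub f (circle1 R)). Qed.

Lemma fun_normD f g : fun_norm (f + g) <= fun_norm f + fun_norm g.
Proof.
apply: fun_norm_le => z; rewrite fun_valD.
by apply: le_trans (ler_normD _ _) (lerD _ _); exact: fun_norm_ub.
Qed.

Lemma fun_normZ (k : R) f : fun_norm (k *: f) = `|k| * fun_norm f.
Proof.
have le l g : fun_norm (l *: g) <= `|l| * fun_norm g.
  by apply: fun_norm_le => z; rewrite fun_valZ normrZ ler_wpM2l // fun_norm_ub.
apply/le_anti; rewrite le /=.
have [->|k0] := eqVneq k 0; first by rewrite normr0 mul0r fun_norm_ge0.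
rewrite -ler_pdivlMl ?normr_gt0 // -normfV.
by rewrite -[X in fun_norm X <= _]scale1r -(mulVf k0) -scalerA le.
Qed.

Lemma fun_norm0_eq0 f : fun_norm f = 0 -> f = 0.
Proof.
move=> f0; apply: fun_algP => z; apply/eqP; rewrite -normr_le0 -f0.
exact: fun_norm_ub.
Qed.

HB.instance Definition _ :=
  Lmodule_isNormed.Build R A fun_normD fun_normZ fun_norm0_eq0.

Lemma fun_alg_normE f : `|f| = fun_norm f. Proof. by []. Qed.

Lemma fun_alg_complete (G : set_system A) : ProperFilter G -> cauchy G -> cvg G.
Proof.
move=> GG /cauchy_ballP Gc.
have near_le (e : R) : 0 < e -> exists2 f0 : A, True &
    \forall f \near G, forall z, `|fun_val f0 z - fun_val f z| <= e.
  move=> e0; have [[P Q] [GP GQ] PQ] := Gc e e0.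
  have [f0 Pf0] := filter_ex GP.
  exists f0 => //; apply: filterS GQ => f Qf z.
  have := PQ (f0, f) (conj Pf0 Qf); rewrite -ball_normE /= => /ltW.
  by apply: le_trans; rewrite -fun_valB; exact: fun_norm_ub.
have ev_cvg z : exists l : F, (fun f : A => f z) @ G --> l.
  suff : cvg ((fun f : A => f z) @ G) by move=> /cvg_ex.
  apply: cauchy_cvg; apply/cauchy_ballP => e e0.
  have [[P Q] [GP GQ] PQ] := Gc e e0.
  exists ((fun f : A => f z) @` P, (fun f : A => f z) @` Q).
    by split; [apply: filterS GP|apply: filterS GQ] => f Pf; exists f.
  move=> [_ _] [[f Pf <-] [g Qg <-]].
  have := PQ (f, g) (conj Pf Qg); rewrite -!ball_normE /=.
  by apply: le_lt_trans; rewrite -fun_valB; exact: fun_norm_ub.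
have [l lP] := choice ev_cvg.
have near_l (e : R) : 0 < e -> \forall f \near G, forall z, `|l z - fun_val f z| <= e.
  move=> e0; have e20 : 0 < e / 2 by lra.
  have [f0 _ Gf0] := near_le _ e20.
  have lf0 z : `|l z - f0 z| <= e / 2.
    apply/ler_addgt0Pr => d d0.
    have /cvgrPdist_le/(_ _ d0) ld := lP z.
    have [f [fl f0f]] := filter_ex (filterI ld Gf0).
    have := ler_normD (l z - f z) (f z - f0 z); rewrite addrA subrK.
    have := f0f z; rewrite distrC; move: fl => /=; lra.
  apply: filterS Gf0 => f ff0 z.
  have := ler_normD (l z - f0 z) (f0 z - f z); rewrite addrA subrK.
  have := lf0 z; have := ff0 z; lra.
have lc : continuous l.
  apply: continuous_uniform_limit => e e0.
  have [f lf] := filter_ex (near_l _ e0).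
  by exists f => //; exact: fun_continuous (fun_valP f).
have lS : fun_set S l.
  apply: fun_set_closed lc _ => e e0.
  have [f lf] := filter_ex (near_l _ e0).
  by exists f => //; exact: fun_valP.
apply/cvg_ex; exists (FunAlg lS); apply/cvgrPdist_le => e e0.
apply: filterS (near_l _ e0) => f lf.
by rewrite fun_alg_normE; apply: fun_norm_le => z; rewrite fun_valB; exact: lf.
Qed.

HB.instance Definition _ := Uniform_isComplete.Build A fun_alg_complete.

Lemma fun_normM f g : `|f ** g| <= `|f| * `|g|.
Proof.
rewrite !fun_alg_normE; apply: fun_norm_le => z; rewrite fun_valM.
apply: le_trans (normr_amul _ _) _.
by apply: ler_pM => //; exact: fun_norm_ub.
Qed.

Lemma fun_starD : {morph (star : A -> A) : f g / f + g}.
Proof. by move=> f g; apply: fun_algP => z /=; rewrite starD. Qed.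

Lemma fun_starZ (k : R) f : star (k *: f) = k *: star f.
Proof. by apply: fun_algP => z /=; rewrite starZ. Qed.

Lemma fun_starM f g : star (f ** g) = star g ** star f.
Proof. by apply: fun_algP => z /=; rewrite starM. Qed.

Lemma fun_starK : involutive (star : A -> A).
Proof. by move=> f; apply: fun_algP => z /=; rewrite starK. Qed.

Lemma fun_cstar_identity f : `|star f ** f| = `|f| ^+ 2.
Proof.
rewrite !fun_alg_normE; apply/le_anti/andP; split.
  apply: fun_norm_le => z; rewrite fun_valM fun_val_star cstar_identity.
  by rewrite lerXn2r ?nnegrE ?fun_norm_ge0 ?fun_norm_ub.
rewrite -[leRHS]sqr_sqrtr ?fun_norm_ge0 // lerXn2r ?nnegrE ?fun_norm_ge0 //.
apply: fun_norm_le => z; rewrite -(@ger0_norm _ `|f z|) // -sqrtr_sqr.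
rewrite ler_wsqrtr // -cstar_identity -fun_val_star -fun_valM.
exact: fun_norm_ub.
Qed.

Lemma fun_cstar_invertible f :
  unit_invertible ((1, star f ** f) : unitization A).
Proof.
have ptw z : exists b : F, quasi_inverse (star (f z) ** f z) b.
  exact/unit_invertibleP/cstar_invertible.
have [g gP] := choice ptw.
have gS : fun_set S g.
  exact: fun_set_inverse (fun_valP (star f ** f)) gP.
exists (1, FunAlg gS); rewrite /unit_mul /unit_one /= !mul1r !scale1r.
split; congr pair; apply: fun_algP => z /=; have [e1 e2] := gP z => //.
  by rewrite [_ + star _ ** _]addrC.
Qed.

HB.instance Definition _ := isRealCstar.Build R A
  fun_normM fun_starD fun_starZ fun_starM fun_starK
  fun_cstar_identity fun_cstar_invertible.

End FunAlg.

Section RealFiber.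
Variable R : realType.
Implicit Types x y : R^o.

Definition real_mul x y : R^o := (x : R) * y.
Definition real_star x : R^o := x.

Lemma real_mulA : associative real_mul.
Proof. exact: mulrA. Qed.
Lemma real_mulDl : left_distributive real_mul +%R.
Proof. exact: mulrDl. Qed.
Lemma real_mulDr : right_distributive real_mul +%R.
Proof. exact: mulrDr. Qed.
Lemma real_mulZl (k : R) x y : real_mul (k *: x) y = k *: real_mul x y.
Proof. exact/esym/mulrA. Qed.
Lemma real_mulZr (k : R) x y : real_mul x (k *: y) = k *: real_mul x y.
Proof. exact: mulrCA. Qed.

HB.instance Definition _ := isNUAlgebra.Build R R^o
  real_mulA real_mulDl real_mulDr real_mulZl real_mulZr.
HB.instance Definition _ := hasStar.Build R^o real_star.

Lemma real_normM x y : `|x ** y| <= `|x| * `|y|.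
Proof. by rewrite [leLHS]normrM. Qed.
Lemma real_starD : {morph (star : R^o -> R^o) : x y / x + y}.
Proof. by []. Qed.
Lemma real_starZ (k : R) x : star (k *: x) = k *: star x.
Proof. by []. Qed.
Lemma real_starM x y : star (x ** y) = star y ** star x.
Proof. exact: mulrC. Qed.
Lemma real_starK : involutive (star : R^o -> R^o).
Proof. by []. Qed.
Lemma real_cstar_identity x : `|star x ** x| = `|x| ^+ 2.
Proof. by rewrite [LHS]normrM expr2. Qed.
Lemma real_cstar_invertible x :
  unit_invertible ((1, star x ** x) : unitization R^o).
Proof.
apply/unit_invertibleP.
have x1 : 1 + x * x != 0 by rewrite lt0r_neq0 // ltr_pwDl // -expr2 sqr_ge0.
exists (- (x * x) / (1 + x * x)); split; rewrite /amul /star /= /real_mul /real_star;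
  by field.
Qed.

HB.instance Definition _ := isRealCstar.Build R R^o
  real_normM real_starD real_starZ real_starM real_starK
  real_cstar_identity real_cstar_invertible.

End RealFiber.

Section ComplexFiber.
Variable R : realType.
Local Notation C := (Rcomplex R).
Implicit Types x y : C.

Definition complex_mul x y : C := x * y.
Definition complex_star x : C := conjc x.

Lemma complex_mulA : associative complex_mul.
Proof. exact: mulrA. Qed.
Lemma complex_mulDl : left_distributive complex_mul +%R.
Proof. exact: mulrDl. Qed.
Lemma complex_mulDr : right_distributive complex_mul +%R.
Proof. exact: mulrDr. Qed.
Lemma complex_mulZl (k : R) x y : complex_mul (k *: x) y = k *: complex_mul x y.
Proof. by apply/esym; exact: scalerAl. Qed.
Lemma complex_mulZr (k : R) x y : complex_mul x (k *: y) = k *: complex_mul x y.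
Proof.
rewrite /complex_mul [LHS]mulrC [LHS](complex_mulZl k y x).
by rewrite /complex_mul [y * x]mulrC.
Qed.

HB.instance Definition _ := isNUAlgebra.Build R C
  complex_mulA complex_mulDl complex_mulDr complex_mulZl complex_mulZr.
HB.instance Definition _ := hasStar.Build C complex_star.

Lemma complex_normME x y : `|x ** y| = `|x| * `|y|.
Proof. exact: Normc.normcM. Qed.
Lemma complex_norm_star x : `|star x| = `|x|.
Proof. by rewrite !normcE; case: x => a b /=; rewrite sqrrN. Qed.
Lemma complex_normM x y : `|x ** y| <= `|x| * `|y|.
Proof. by rewrite complex_normME. Qed.
Lemma complex_starD : {morph (star : C -> C) : x y / x + y}.
Proof. by move=> x y; exact: (rmorphD (@conjc R)). Qed.
Lemma complex_starZ (k : R) x : star (k *: x) = k *: star x.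
Proof. exact: conjc_is_scalable. Qed.
Lemma complex_starM x y : star (x ** y) = star y ** star x.
Proof. by rewrite [RHS]mulrC; exact: (rmorphM (@conjc R)). Qed.
Lemma complex_starK : involutive (star : C -> C).
Proof. exact: conjcK. Qed.
Lemma complex_cstar_identity x : `|star x ** x| = `|x| ^+ 2.
Proof. by rewrite complex_normME complex_norm_star expr2. Qed.
Lemma complex_cstar_invertible x :
  unit_invertible ((1, star x ** x) : unitization C).
Proof.
apply/unit_invertibleP; case: x => a b.
have n0 : 1 + (a * a + b * b) != 0.
  by rewrite lt0r_neq0 // ltr_pwDl // -!expr2 addr_ge0 // sqr_ge0.
exists (Complex (- (a * a + b * b) / (1 + (a * a + b * b))) 0).
split; rewrite /amul /star /= /complex_mul /complex_star /=;
  by apply/eqP; rewrite eq_complex /=; apply/andP; split; apply/eqP; field.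
Qed.

HB.instance Definition _ := isRealCstar.Build R C
  complex_normM complex_starD complex_starZ complex_starM complex_starK
  complex_cstar_identity complex_cstar_invertible.

End ComplexFiber.

Section R4.
Variable R : realType.
Implicit Types a b c d : R.

Lemma cauchy_schwarz4 a b c d a' b' c' d' :
  a * a' + b * b' + c * c' + d * d' <=
  Num.sqrt (a ^+ 2 + b ^+ 2 + c ^+ 2 + d ^+ 2) *
  Num.sqrt (a' ^+ 2 + b' ^+ 2 + c' ^+ 2 + d' ^+ 2).
Proof.
rewrite -sqrtrM ?addr_ge0 ?sqr_ge0 //.
apply: le_trans (ler_norm _) _; rewrite -sqrtr_sqr ler_wsqrtr //.
rewrite -subr_ge0.
have -> : (a ^+ 2 + b ^+ 2 + c ^+ 2 + d ^+ 2) *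
    (a' ^+ 2 + b' ^+ 2 + c' ^+ 2 + d' ^+ 2) -
    (a * a' + b * b' + c * c' + d * d') ^+ 2 =
  (a * b' - b * a') ^+ 2 + (a * c' - c * a') ^+ 2 + (a * d' - d * a') ^+ 2 +
  (b * c' - c * b') ^+ 2 + (b * d' - d * b') ^+ 2 + (c * d' - d * c') ^+ 2.
  by ring.
by rewrite !addr_ge0 ?sqr_ge0.
Qed.

Lemma minkowski4 a b c d a' b' c' d' :
  Num.sqrt ((a + a') ^+ 2 + (b + b') ^+ 2 + (c + c') ^+ 2 + (d + d') ^+ 2) <=
  Num.sqrt (a ^+ 2 + b ^+ 2 + c ^+ 2 + d ^+ 2) +
  Num.sqrt (a' ^+ 2 + b' ^+ 2 + c' ^+ 2 + d' ^+ 2).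
Proof.
rewrite -[leRHS]ger0_norm ?addr_ge0 ?sqrtr_ge0 // -sqrtr_sqr ler_wsqrtr //.
rewrite [leRHS]sqrrD !sqr_sqrtr ?addr_ge0 ?sqr_ge0 // -[leRHS]addrA.
have := cauchy_schwarz4 a b c d a' b' c' d'.
move: (Num.sqrt _ * Num.sqrt _) => s h; rewrite mulr2n; lra.
Qed.

Lemma sqrt4_le_sum a b c d :
  Num.sqrt (a ^+ 2 + b ^+ 2 + c ^+ 2 + d ^+ 2) <= `|a| + `|b| + `|c| + `|d|.
Proof.
rewrite -[leRHS]ger0_norm ?addr_ge0 // -sqrtr_sqr ler_wsqrtr //.
rewrite -[a ^+ 2]real_normK ?num_real // -[b ^+ 2]real_normK ?num_real //.
rewrite -[c ^+ 2]real_normK ?num_real // -[d ^+ 2]real_normK ?num_real //.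
move: (normr_ge0 a) (normr_ge0 b) (normr_ge0 c) (normr_ge0 d).
move: `|a| `|b| `|c| `|d| => {a b c d} a b c d a0 b0 c0 d0.
rewrite -subr_ge0.
have -> : (a + b + c + d) ^+ 2 - (a ^+ 2 + b ^+ 2 + c ^+ 2 + d ^+ 2) =
  2 * (a * b + a * c + a * d + b * c + b * d + c * d) by ring.
by rewrite mulr_ge0 // !addr_ge0 // mulr_ge0.
Qed.

Lemma sqrt4_eq0 a b c d :
  Num.sqrt (a ^+ 2 + b ^+ 2 + c ^+ 2 + d ^+ 2) = 0 ->
  [/\ a = 0, b = 0, c = 0 & d = 0].
Proof.
move=> /eqP; rewrite sqrtr_eq0 => h.
have := sqr_ge0 a; have := sqr_ge0 b; have := sqr_ge0 c; have := sqr_ge0 d.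
move=> d0 c0 b0 a0.
by split; apply/eqP; rewrite -sqrf_eq0; apply/eqP; lra.
Qed.

End R4.

Record quaternion (R : Type) := Quat { qre : R; qi : R; qj : R; qk : R }.

Section QuaternionFiber.
Variable R : realType.
Local Notation H := (quaternion R).
Implicit Types x y z : H.

HB.instance Definition _ := gen_eqMixin H.
HB.instance Definition _ := gen_choiceMixin H.

Lemma quatP x y :
  qre x = qre y -> qi x = qi y -> qj x = qj y -> qk x = qk y -> x = y.
Proof. by case: x => a b c d; case: y => ? ? ? ? /= -> -> -> ->. Qed.

Definition quat_zero : H := Quat 0 0 0 0.
Definition quat_opp x : H := Quat (- qre x) (- qi x) (- qj x) (- qk x).
Definition quat_add x y : H :=
  Quat (qre x + qre y) (qi x + qi y) (qj x + qj y) (qk x + qk y).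
Definition quat_scale (k : R) x : H :=
  Quat (k * qre x) (k * qi x) (k * qj x) (k * qk x).
Definition quat_mul x y : H := Quat
  (qre x * qre y - qi x * qi y - qj x * qj y - qk x * qk y)
  (qre x * qi y + qi x * qre y + qj x * qk y - qk x * qj y)
  (qre x * qj y - qi x * qk y + qj x * qre y + qk x * qi y)
  (qre x * qk y + qi x * qj y - qj x * qi y + qk x * qre y).
Definition quat_star x : H := Quat (qre x) (- qi x) (- qj x) (- qk x).
Definition quat_norm x : R :=
  Num.sqrt (qre x ^+ 2 + qi x ^+ 2 + qj x ^+ 2 + qk x ^+ 2).

Lemma quat_addA : associative quat_add.
Proof. by move=> x y z; apply: quatP => /=; ring. Qed.
Lemma quat_addC : commutative quat_add.
Proof. by move=> x y; apply: quatP => /=; ring. Qed.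
Lemma quat_add0 : left_id quat_zero quat_add.
Proof. by move=> x; apply: quatP => /=; ring. Qed.
Lemma quat_addN : left_inverse quat_zero quat_opp quat_add.
Proof. by move=> x; apply: quatP => /=; ring. Qed.

HB.instance Definition _ :=
  GRing.isZmodule.Build H quat_addA quat_addC quat_add0 quat_addN.

Lemma quat_scaleA a b x : quat_scale a (quat_scale b x) = quat_scale (a * b) x.
Proof. by apply: quatP => /=; ring. Qed.
Lemma quat_scale1 : left_id 1 quat_scale.
Proof. by move=> x; apply: quatP => /=; ring. Qed.
Lemma quat_scaleDr : right_distributive quat_scale +%R.
Proof. by move=> k x y; apply: quatP => /=; ring. Qed.
Lemma quat_scaleDl x : {morph quat_scale^~ x : a b / a + b}.
Proof. by move=> a b; apply: quatP => /=; ring. Qed.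

HB.instance Definition _ := GRing.Zmodule_isLmodule.Build R H
  quat_scaleA quat_scale1 quat_scaleDr quat_scaleDl.

Lemma quat_mulA : associative quat_mul.
Proof. by move=> x y z; apply: quatP => /=; ring. Qed.
Lemma quat_mulDl : left_distributive quat_mul +%R.
Proof. by move=> x y z; apply: quatP => /=; ring. Qed.
Lemma quat_mulDr : right_distributive quat_mul +%R.
Proof. by move=> x y z; apply: quatP => /=; ring. Qed.
Lemma quat_mulZl (k : R) x y : quat_mul (k *: x) y = k *: quat_mul x y.
Proof. by apply: quatP => /=; ring. Qed.
Lemma quat_mulZr (k : R) x y : quat_mul x (k *: y) = k *: quat_mul x y.
Proof. by apply: quatP => /=; ring. Qed.

HB.instance Definition _ := isNUAlgebra.Build R H
  quat_mulA quat_mulDl quat_mulDr quat_mulZl quat_mulZr.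
HB.instance Definition _ := hasStar.Build H quat_star.

Lemma quat_normD x y : quat_norm (x + y) <= quat_norm x + quat_norm y.
Proof. exact: minkowski4. Qed.
Lemma quat_normZ (k : R) x : quat_norm (k *: x) = `|k| * quat_norm x.
Proof.
rewrite /quat_norm -sqrtr_sqr -sqrtrM ?sqr_ge0 //; congr Num.sqrt => /=; ring.
Qed.
Lemma quat_norm0 x : quat_norm x = 0 -> x = 0.
Proof. by move=> /sqrt4_eq0[? ? ? ?]; apply: quatP. Qed.

HB.instance Definition _ :=
  Lmodule_isNormed.Build R H quat_normD quat_normZ quat_norm0.

Lemma quat_complete (F : set_system H) : ProperFilter F -> cauchy F -> cvg F.
Proof.
apply: (@coordinates_complete R H 'I_4
  (fun i x => tnth [tuple qre x; qi x; qj x; qk x] i) 1).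
- by move=> i x y; case: i => [[|[|[|[|]]]]].
- move=> i x; rewrite -sqrtr_sqr [leRHS]/(quat_norm x) ler_wsqrtr //.
  have := sqr_ge0 (qre x); have := sqr_ge0 (qi x); have := sqr_ge0 (qj x).
  have := sqr_ge0 (qk x).
  by case: i => [[|[|[|[|]]]]] //= ?; rewrite (tnth_nth 0) /=; lra.
- move=> x; rewrite mul1r !big_ord_recl big_ord0 !(tnth_nth 0) /= addr0 !addrA.
  exact: sqrt4_le_sum.
- move=> a; exists (Quat (a (inord 0)) (a (inord 1)) (a (inord 2)) (a (inord 3))).
  move=> i; rewrite (tnth_nth 0) -[in RHS](inord_val i).
  by case: i => [[|[|[|[|]]]]].
Qed.

HB.instance Definition _ := Uniform_isComplete.Build H quat_complete.

Lemma quat_normE x : `|x| = quat_norm x. Proof. by []. Qed.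
Lemma quat_normME x y : `|x ** y| = `|x| * `|y|.
Proof.
rewrite !quat_normE /quat_norm -sqrtrM ?addr_ge0 ?sqr_ge0 //.
congr Num.sqrt => /=; ring.
Qed.
Lemma quat_norm_star x : `|star x| = `|x|.
Proof. by rewrite !quat_normE /quat_norm /= !sqrrN. Qed.
Lemma quat_normM x y : `|x ** y| <= `|x| * `|y|.
Proof. by rewrite quat_normME. Qed.
Lemma quat_starD : {morph (star : H -> H) : x y / x + y}.
Proof. by move=> x y; apply: quatP => /=; ring. Qed.
Lemma quat_starZ (k : R) x : star (k *: x) = k *: star x.
Proof. by apply: quatP => /=; ring. Qed.
Lemma quat_starM x y : star (x ** y) = star y ** star x.
Proof. by apply: quatP => /=; ring. Qed.
Lemma quat_starK : involutive (star : H -> H).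
Proof. by move=> x; apply: quatP => /=; ring. Qed.
Lemma quat_cstar_identity x : `|star x ** x| = `|x| ^+ 2.
Proof. by rewrite quat_normME quat_norm_star expr2. Qed.
Lemma quat_cstar_invertible x :
  unit_invertible ((1, star x ** x) : unitization H).
Proof.
apply/unit_invertibleP; case: x => a b c d.
pose n := a ^+ 2 + b ^+ 2 + c ^+ 2 + d ^+ 2.
have n0 : 1 + n != 0.
  by rewrite lt0r_neq0 // ltr_pwDl // !addr_ge0 // sqr_ge0.
have -> : star (Quat a b c d) ** Quat a b c d = Quat n 0 0 0.
  by apply: quatP => /=; rewrite /n; ring.
by exists (Quat (- n / (1 + n)) 0 0 0); split; apply: quatP => /=; field.
Qed.

HB.instance Definition _ := isRealCstar.Build R H
  quat_normM quat_starD quat_starZ quat_starM quat_starK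
  quat_cstar_identity quat_cstar_invertible.

End QuaternionFiber.

Section MatrixFiber.
Variable R : realType.
Local Notation C := (R[i])%C.
Implicit Types (v w : 'cV[C]_2) (z : C).

(* M_2(C) as a real algebra; the alias keeps this structure apart from the
   library's structure of 'M[R[i]]_2 over R[i]. *)
Definition M2C : Type := 'M[C]_2.
Implicit Types A B D : M2C.

HB.instance Definition _ := GRing.Zmodule.copy M2C 'M[C]_2.

Definition m2_scale (k : R) A : M2C := (k%:C)%C *: (A : 'M[C]_2).
Definition m2_mul A B : M2C := (A : 'M[C]_2) *m B.
Definition m2_star A : M2C := (map_mx (@conjc R) (A : 'M[C]_2))^T.

Lemma m2_scaleA a b A : m2_scale a (m2_scale b A) = m2_scale (a * b) A.
Proof. by rewrite /m2_scale scalerA -rmorphM. Qed.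
Lemma m2_scale1 : left_id 1 m2_scale.
Proof. by move=> A; rewrite /m2_scale rmorph1 scale1r. Qed.
Lemma m2_scaleDr : right_distributive m2_scale +%R.
Proof. by move=> k A B; exact: scalerDr. Qed.
Lemma m2_scaleDl A : {morph m2_scale^~ A : a b / a + b}.
Proof. by move=> a b; rewrite /m2_scale rmorphD; exact: scalerDl. Qed.

HB.instance Definition _ := GRing.Zmodule_isLmodule.Build R M2C
  m2_scaleA m2_scale1 m2_scaleDr m2_scaleDl.

Lemma m2_mulA : associative m2_mul.
Proof. exact: mulmxA. Qed.
Lemma m2_mulDl : left_distributive m2_mul +%R.
Proof. by move=> A B D; exact: mulmxDl. Qed.
Lemma m2_mulDr : right_distributive m2_mul +%R.
Proof. by move=> A B D; exact: mulmxDr. Qed.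
Lemma m2_mulZl (k : R) A B : m2_mul (k *: A) B = k *: m2_mul A B.
Proof. exact/esym/scalemxAl. Qed.
Lemma m2_mulZr (k : R) A B : m2_mul A (k *: B) = k *: m2_mul A B.
Proof. exact/esym/scalemxAr. Qed.

HB.instance Definition _ := isNUAlgebra.Build R M2C
  m2_mulA m2_mulDl m2_mulDr m2_mulZl m2_mulZr.
HB.instance Definition _ := hasStar.Build M2C m2_star.

(* The Euclidean norm of C^2 and the operator norm it induces. *)
Definition cv_norm v : R := Num.sqrt (\sum_i (Re (v i 0) ^+ 2 + Im (v i 0) ^+ 2)).
Definition m2_norm A : R := sup [set cv_norm ((A : 'M[C]_2) *m v) | v in [set v | cv_norm v <= 1]].

Lemma sum2E (V : nmodType) (f : 'I_2 -> V) : \sum_i f i = f 0 + f 1.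
Proof.
by rewrite big_ord_recl big_ord1; congr (_ + f _); apply: val_inj.
Qed.

Lemma cv_normE v : cv_norm v =
  Num.sqrt (Re (v 0 0) ^+ 2 + Im (v 0 0) ^+ 2 + Re (v 1 0) ^+ 2 + Im (v 1 0) ^+ 2).
Proof. by rewrite /cv_norm sum2E addrA. Qed.

Lemma cvP v w : v 0 0 = w 0 0 -> v 1 0 = w 1 0 -> v = w.
Proof.
move=> e0 e1; apply/colP => -[[|[|//]] i2].
- by rewrite (_ : Ordinal _ = 0) //; apply: val_inj.
- by rewrite (_ : Ordinal _ = 1) //; apply: val_inj.
Qed.

Lemma cv_normD v w : cv_norm (v + w) <= cv_norm v + cv_norm w.
Proof.
rewrite !cv_normE !mxE.
by case: (v 0 0) (v 1 0) (w 0 0) (w 1 0) => [a b] [c d] [a' b'] [c' d']; exact: minkowski4.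
Qed.

Lemma cv_normZ z v : cv_norm (z *: v) = Normc.normc z * cv_norm v.
Proof.
rewrite !cv_normE !mxE.
case: (v 0 0) (v 1 0) z => [a b] [c d] [x y] /=.
rewrite -sqrtrM ?addr_ge0 ?sqr_ge0 //; congr Num.sqrt; ring.
Qed.

Lemma cv_norm_ge0 v : 0 <= cv_norm v. Proof. exact: sqrtr_ge0. Qed.

Lemma cv_norm0 : cv_norm 0 = 0.
Proof. by rewrite cv_normE !mxE /= expr0n !addr0 sqrtr0. Qed.

Lemma cv_norm_eq0 v : cv_norm v = 0 -> v = 0.
Proof.
rewrite cv_normE => /sqrt4_eq0; case e0: (v 0 0) => [a b]; case e1: (v 1 0) => [c d] /=.
by case=> a0 b0 c0 d0; apply: cvP; rewrite ?e0 ?e1 ?a0 ?b0 ?c0 ?d0 mxE.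
Qed.

Lemma normc_le_cv_norm v i : Normc.normc (v i 0) <= cv_norm v.
Proof.
rewrite cv_normE.
have [->|->] : i = 0 \/ i = 1.
  by case: i => -[|[|//]] ?; [left|right]; apply: val_inj.
- case: (v 0 0) (v 1 0) => [a b] [c d] /=; rewrite ler_wsqrtr //.
  by have := sqr_ge0 c; have := sqr_ge0 d; lra.
- case: (v 0 0) (v 1 0) => [a b] [c d] /=; rewrite ler_wsqrtr //.
  by have := sqr_ge0 a; have := sqr_ge0 b; lra.
Qed.

Let colsum A : R := cv_norm (col 0 (A : 'M[C]_2)) + cv_norm (col 1 (A : 'M[C]_2)).

Let mulmx_col2 A v : (A : 'M[C]_2) *m v =
  v 0 0 *: col 0 (A : 'M[C]_2) + v 1 0 *: col 1 (A : 'M[C]_2).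
Proof.
by apply/colP => i; rewrite !mxE sum2E mulrC [A i 1 * _]mulrC.
Qed.

Let cv_norm_mul A v : cv_norm ((A : 'M[C]_2) *m v) <= colsum A * cv_norm v.
Proof.
rewrite mulmx_col2; apply: le_trans (cv_normD _ _) _.
rewrite !cv_normZ mulrDl !(mulrC (cv_norm (col _ _))).
by rewrite lerD // ler_wpM2r ?cv_norm_ge0 ?normc_le_cv_norm.
Qed.

Let m2_norm_has_sup A :
  has_sup [set cv_norm ((A : 'M[C]_2) *m v) | v in [set v | cv_norm v <= 1]].
Proof.
split; first by exists (cv_norm ((A : 'M[C]_2) *m 0)); exists 0 => //=; rewrite cv_norm0.
exists (colsum A) => _ [v /= v1 <-]; apply: le_trans (cv_norm_mul _ _) _.
by rewrite -[leRHS]mulr1 ler_wpM2l ?addr_ge0 ?cv_norm_ge0.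
Qed.

Lemma m2_norm_ge0 A : 0 <= m2_norm A.
Proof.
rewrite -cv_norm0 -(mulmx0 1 (A : 'M[C]_2)); apply: sup_upper_bound => //.
by exists 0 => //=; rewrite cv_norm0.
Qed.

Lemma m2_norm_ub A v : cv_norm ((A : 'M[C]_2) *m v) <= m2_norm A * cv_norm v.
Proof.
have [v0|v0] := eqVneq (cv_norm v) 0.
  by rewrite (cv_norm_eq0 v0) mulmx0 cv_norm0 mulr0.
have vp : 0 < cv_norm v by rewrite lt0r v0 cv_norm_ge0.
rewrite -ler_pdivrMr // mulrC.
have nk : Normc.normc ((cv_norm v)^-1%:C)%C = (cv_norm v)^-1.
  by rewrite /= expr0n addr0 sqrtr_sqr ger0_norm // invr_ge0 ltW.
rewrite -[X in X * _ <= _]nk -cv_normZ scalemxAr.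
apply: sup_upper_bound => //; exists (((cv_norm v)^-1%:C)%C *: v) => //=.
by rewrite cv_normZ nk mulVf.
Qed.

Lemma m2_norm_le A (M : R) : 0 <= M ->
  (forall v, cv_norm ((A : 'M[C]_2) *m v) <= M * cv_norm v) -> m2_norm A <= M.
Proof.
move=> M0 AM; apply: ge_sup; first by have [] := m2_norm_has_sup A.
move=> _ [v /= v1 <-]; apply: le_trans (AM v) _.
by rewrite -[leRHS]mulr1 ler_wpM2l.
Qed.

Let cv_norm_le_normc v : cv_norm v <= Normc.normc (v 0 0) + Normc.normc (v 1 0).
Proof.
rewrite cv_normE; case: (v 0 0) (v 1 0) => [a b] [c d] /=.
rewrite -[leRHS]ger0_norm ?addr_ge0 ?sqrtr_ge0 // -sqrtr_sqr ler_wsqrtr //.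
rewrite [leRHS]sqrrD !sqr_sqrtr ?addr_ge0 ?sqr_ge0 //.
have := mulr_ge0 (sqrtr_ge0 (a ^+ 2 + b ^+ 2)) (sqrtr_ge0 (c ^+ 2 + d ^+ 2)).
by rewrite mulr2n; lra.
Qed.

Lemma m2_norm_le_entry A (M : R) :
  (forall i j, Normc.normc ((A : 'M[C]_2) i j) <= M) -> m2_norm A <= 4 * M.
Proof.
move=> AM; apply: (@le_trans _ _ (colsum A)).
  by apply: m2_norm_le => [|v]; [rewrite addr_ge0 ?cv_norm_ge0|exact: cv_norm_mul].
have h j : cv_norm (col j (A : 'M[C]_2)) <= M + M.
  by apply: le_trans (cv_norm_le_normc _) _; rewrite !mxE lerD.
by have := h 0; have := h 1; rewrite /colsum; lra.
Qed.

Lemma m2_normD A B : m2_norm (A + B) <= m2_norm A + m2_norm B.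
Proof.
apply: m2_norm_le => [|v]; first by rewrite addr_ge0 ?m2_norm_ge0.
by rewrite mulmxDl mulrDl (le_trans (cv_normD _ _)) // lerD // m2_norm_ub.
Qed.

Lemma m2_normZ (k : R) A : m2_norm (k *: A) = `|k| * m2_norm A.
Proof.
have nk (l : R) : Normc.normc (l%:C)%C = `|l| by rewrite /= expr0n addr0 sqrtr_sqr.
have le l B : m2_norm (l *: B) <= `|l| * m2_norm B.
  apply: m2_norm_le => [|v]; first by rewrite mulr_ge0 ?m2_norm_ge0.
  by rewrite -scalemxAl cv_normZ nk -mulrA ler_wpM2l // m2_norm_ub.
apply/le_anti; rewrite le /=.
have [->|k0] := eqVneq k 0; first by rewrite normr0 mul0r m2_norm_ge0.
rewrite -ler_pdivlMl ?normr_gt0 // -normfV.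
by rewrite -[X in m2_norm X <= _]scale1r -(mulVf k0) -scalerA le.
Qed.

Lemma normc_entry_le A i j : Normc.normc ((A : 'M[C]_2) i j) <= m2_norm A.
Proof.
have d1 : cv_norm (delta_mx j 0) <= 1.
  rewrite cv_normE !mxE.
  have [->|->] : j = 0 \/ j = 1.
    by case: j => -[|[|//]] ?; [left|right]; apply: val_inj.
  - by rewrite /= expr0n expr1n !addr0 sqrtr1.
  - by rewrite /= expr0n expr1n !addr0 add0r sqrtr1.
apply: (@le_trans _ _ (cv_norm ((A : 'M[C]_2) *m delta_mx j 0))).
  by apply: le_trans (normc_le_cv_norm _ i); rewrite -colE mxE.
by apply: le_trans (m2_norm_ub _ _) _; rewrite -[leRHS]mulr1 ler_wpM2l ?m2_norm_ge0.
Qed.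

Lemma m2_norm0 A : m2_norm A = 0 -> A = 0.
Proof.
move=> A0; apply/matrixP => i j; rewrite mxE; apply: (@Normc.eq0_normc R).
by apply/le_anti; rewrite -A0 normc_entry_le A0; exact: (@normr_ge0 _ (Rcomplex R)).
Qed.

HB.instance Definition _ :=
  Lmodule_isNormed.Build R M2C m2_normD m2_normZ m2_norm0.

Lemma m2_normE A : `|A| = m2_norm A. Proof. by []. Qed.

Lemma m2_complete (F : set_system M2C) : ProperFilter F -> cauchy F -> cvg F.
Proof.
apply: (@coordinates_complete R M2C ('I_2 * 'I_2 * bool)%type
  (fun i A => let z := (A : 'M[C]_2) i.1.1 i.1.2 in if i.2 then Re z else Im z) 1).
- move=> [[i j] b] A B /=; rewrite !mxE.
  by case: b; case: (A i j) (B i j) => [? ?] [? ?].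
- move=> [[i j] b] A /=; apply: le_trans (normc_entry_le A i j).
  by case: b; [exact: (@Re_le_norm R)|exact: (@Im_le_norm R)].
- move=> A; rewrite mul1r m2_normE.
  have -> : \sum_i `|let z := (A : 'M[C]_2) i.1.1 i.1.2 in if i.2 then Re z else Im z| =
     \sum_(j : 'I_2) \sum_(i : 'I_2)
        (`|Re ((A : 'M[C]_2) i j)| + `|Im ((A : 'M[C]_2) i j)|).
    rewrite -(pair_big xpredT xpredT (fun ij b =>
      `|if b then Re ((A : 'M[C]_2) ij.1 ij.2) else Im ((A : 'M[C]_2) ij.1 ij.2)|)) /=.
    under eq_bigr do rewrite big_bool /=.
    rewrite -(pair_big xpredT xpredT (fun i j =>
      `|Re ((A : 'M[C]_2) i j)| + `|Im ((A : 'M[C]_2) i j)|)) /=.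
    by rewrite exchange_big.
  have col_le j : cv_norm (col j (A : 'M[C]_2)) <=
      \sum_i (`|Re ((A : 'M[C]_2) i j)| + `|Im ((A : 'M[C]_2) i j)|).
    by rewrite sum2E addrA cv_normE !mxE; exact: sqrt4_le_sum.
  apply: (@le_trans _ _ (colsum A)); last by rewrite sum2E /colsum lerD.
  by apply: m2_norm_le => [|v]; [rewrite addr_ge0 ?cv_norm_ge0|exact: cv_norm_mul].
- move=> a; exists (\matrix_(i, j) Complex (a (i, j, true)) (a (i, j, false))).
  by move=> [[i j] []]; rewrite /= mxE.
Qed.

HB.instance Definition _ := Uniform_isComplete.Build M2C m2_complete.

Lemma m2_normM A B : `|A ** B| <= `|A| * `|B|.
Proof.
rewrite !m2_normE; apply: m2_norm_le => [|v].
  by rewrite mulr_ge0 ?m2_norm_ge0.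
rewrite -mulmxA -mulrA; apply: le_trans (m2_norm_ub _ _) _.
by rewrite ler_wpM2l ?m2_norm_ge0 // m2_norm_ub.
Qed.

Lemma m2_starD : {morph (star : M2C -> M2C) : A B / A + B}.
Proof. by move=> A B; apply/matrixP => i j; rewrite !mxE rmorphD. Qed.

Lemma m2_starZ (k : R) A : star (k *: A) = k *: star A.
Proof. apply/matrixP => i j; rewrite !mxE rmorphM; congr (_ * _).
by apply/eqP; rewrite eq_complex /= oppr0 !eqxx. Qed.

Lemma m2_starM A B : star (A ** B) = star B ** star A.
Proof.
by rewrite /star /= /m2_star /amul /= /m2_mul map_mxM trmx_mul.
Qed.

Lemma m2_starK : involutive (star : M2C -> M2C).
Proof. by move=> A; apply/matrixP => i j; rewrite !mxE conjcK. Qed.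

Let rdot v w : R := \sum_i (Re (v i 0) * Re (w i 0) + Im (v i 0) * Im (w i 0)).

Let rdot_le v w : rdot v w <= cv_norm v * cv_norm w.
Proof. by rewrite /rdot sum2E !cv_normE addrA; exact: cauchy_schwarz4. Qed.

Let rdot_norm v : rdot v v = cv_norm v ^+ 2.
Proof.
rewrite /rdot sum2E cv_normE sqr_sqrtr ?addr_ge0 ?sqr_ge0 //.
by rewrite !expr2 !addrA.
Qed.

Let rdot_star A v w :
  rdot ((A : 'M[C]_2) *m v) w = rdot v ((star A : 'M[C]_2) *m w).
Proof.
rewrite /rdot !sum2E !mxE !sum2E !mxE.
case: (A 0 0) (A 0 1) (A 1 0) (A 1 1) (v 0 0) (v 1 0) (w 0 0) (w 1 0)
  => [? ?] [? ?] [? ?] [? ?] [? ?] [? ?] [? ?] [? ?] /=; ring.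
Qed.

Lemma m2_cstar_identity A : `|star A ** A| = `|A| ^+ 2.
Proof.
have le1 B : `|B| ^+ 2 <= `|star B ** B|.
  rewrite !m2_normE -[leRHS]sqr_sqrtr ?m2_norm_ge0 //.
  rewrite lerXn2r ?nnegrE ?m2_norm_ge0 //.
  apply: m2_norm_le => [|v]; first exact: sqrtr_ge0.
  rewrite -(@ger0_norm _ (cv_norm v)) ?cv_norm_ge0 // -sqrtr_sqr.
  rewrite -sqrtrM ?m2_norm_ge0 //.
  rewrite -(@ger0_norm _ (cv_norm (_ *m _))) ?cv_norm_ge0 // -sqrtr_sqr.
  rewrite ler_wsqrtr // -rdot_norm rdot_star mulmxA.
  apply: le_trans (rdot_le _ _) _.
  by rewrite expr2 mulrCA ler_wpM2l ?cv_norm_ge0 // m2_norm_ub.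
have le2 B : `|B| <= `|star B|.
  have [->|B0] := eqVneq `|B| 0; first by [].
  rewrite -(@ler_pM2r _ `|B|) ?lt0r ?B0 //= -expr2.
  exact: le_trans (le1 _) (m2_normM _ _).
apply/le_anti; rewrite le1 andbT; apply: le_trans (m2_normM _ _) _.
by rewrite expr2 ler_wpM2r // -[X in _ <= `|X|]m2_starK le2.
Qed.

Lemma det2E (A : 'M[C]_2) : \det A = A 0 0 * A 1 1 - A 0 1 * A 1 0.
Proof.
rewrite (expand_det_row A 0) sum2E /cofactor !det_mx11 !mxE /= expr0 expr1.
have e01 : lift 0 0 = 1 :> 'I_2 by apply: val_inj.
have e10 : lift 1 0 = 0 :> 'I_2 by apply: val_inj.
by rewrite e01 e10; ring.
Qed.

Lemma m2_cstar_invertible A :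
  unit_invertible ((1, star A ** A) : unitization M2C).
Proof.
apply/unit_invertibleP.
pose N : 'M[C]_2 := 1%:M + (star A : 'M[C]_2) *m A.
have Nu : N \in unitmx.
  rewrite unitmxE unitfE.
  suff : 0 < Re (\det N) by apply: contraTneq => ->; rewrite ltxx.
  rewrite det2E /N !mxE !sum2E !mxE.
  case: (A 0 0) (A 0 1) (A 1 0) (A 1 1) => [a a'] [b b'] [c c'] [d d'].
  set X := (X in 0 < X).
  have -> : X = 1 + a ^+ 2 + a' ^+ 2 + b ^+ 2 + b' ^+ 2 + c ^+ 2 + c' ^+ 2
    + d ^+ 2 + d' ^+ 2 + (a * d - a' * d' - (b * c - b' * c')) ^+ 2
    + (a * d' + a' * d - (b * c' + b' * c)) ^+ 2.
    by rewrite /X /=; ring.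
  rewrite -!addrA ltr_pwDl // !addr_ge0 ?sqr_ge0 //.
have aE : star A ** A = N - 1%:M by rewrite /N addrC addKr.
exists (invmx N - 1%:M : 'M[C]_2); split; rewrite aE.
- rewrite [_ ** _](_ : _ = (N - 1%:M) *m (invmx N - 1%:M)) //.
  rewrite mulmxBl !mulmxBr mulmxV // !mul1mx mulmx1.
  by rewrite -[1%:M - N]opprB -opprD addrN.
- rewrite [_ ** _](_ : _ = (invmx N - 1%:M) *m (N - 1%:M)) //.
  rewrite mulmxBl !mulmxBr mulVmx // !mul1mx mulmx1.
  by rewrite -[1%:M - invmx N]opprB -opprD [X in _ - X]addrC addrN.
Qed.

HB.instance Definition _ := isRealCstar.Build R M2C
  m2_normM m2_starD m2_starZ m2_starM m2_starK
  m2_cstar_identity m2_cstar_invertible.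

End MatrixFiber.

Section BasedLoops.
Context (R : realType) (F : realCstarType R).
Implicit Types f g : circle R -> F.

Definition based_loop f : Prop := continuous f /\ f (circle1 R) = 0.

Lemma based_loop0 : based_loop (fun=> 0).
Proof. by split=> //; exact: cst_continuous. Qed.

Lemma based_loopD f g :
  based_loop f -> based_loop g -> based_loop (fun z => f z + g z).
Proof.
move=> [fc f1] [gc g1]; split; last by rewrite f1 g1 addr0.
exact: continuous_funD.
Qed.

Lemma based_loopZ (k : R) f : based_loop f -> based_loop (fun z => k *: f z).
Proof.
move=> [fc f1]; split; last by rewrite f1 scaler0.
exact: continuous_funZ.
Qed.

Lemma based_loopM f g :
  based_loop f -> based_loop g -> based_loop (fun z => f z ** g z).
Proof.
move=> [fc f1] [gc g1]; split; last by rewrite f1 amul0l.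
exact: continuous_amul.
Qed.

Lemma based_loop_star f : based_loop f -> based_loop (fun z => star (f z)).
Proof.
move=> [fc f1]; split; last by rewrite f1 star0.
exact: continuous_star.
Qed.

Lemma based_loop_inverse f g : based_loop f ->
  (forall z, quasi_inverse (f z) (g z)) -> based_loop g.
Proof.
move=> [fc f1] fg; split; first exact: continuous_quasi_inverse fg fc.
by have [] := fg (circle1 R); rewrite f1 amul0l addr0 add0r.
Qed.

Lemma based_loop_closed f : continuous f ->
  (forall e : R, 0 < e ->
    exists2 g, based_loop g & forall z, `|f z - g z| <= e) ->
  based_loop f.
Proof.
move=> fc fg; split=> //; apply/eqP; rewrite -normr_le0.
apply/ler_addgt0Pr => e e0; rewrite add0r.
by have [g [_ g1] /(_ (circle1 R))] := fg e e0; rewrite g1 subr0.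
Qed.

Section Twisted.
Variables (tau : F -> F) (M : R).
Hypothesis tauB : {morph tau : x y / x - y}.
Hypothesis tauZ : forall (k : R) x, tau (k *: x) = k *: tau x.
Hypothesis tauM : forall x y, tau (x ** y) = tau y ** tau x.
Hypothesis tau_star : forall x, tau (star x) = star (tau x).
Hypothesis tau_le : forall x, `|tau x| <= M * `|x|.

(* With tau the identity and F commutative this is f(conj z) = (f z)^*. *)
Definition twisted_loop f : Prop :=
  forall z, tau (f (circle_conj z)) = star (f z).

Let tau0 : tau 0 = 0.
Proof. by have := tauB 0 0; rewrite !subr0 subrr. Qed.

Let tauD x y : tau (x + y) = tau x + tau y.
Proof.
have tauN u : tau (- u) = - tau u by have := tauB 0 u; rewrite !sub0r tau0 sub0r.
by rewrite -{1}[y]opprK tauB tauN opprK.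
Qed.

Lemma twisted_loop0 : twisted_loop (fun=> 0).
Proof. by move=> z; rewrite tau0 star0. Qed.

Lemma twisted_loopD f g :
  twisted_loop f -> twisted_loop g -> twisted_loop (fun z => f z + g z).
Proof. by move=> ft gt z; rewrite tauD ft gt starD. Qed.

Lemma twisted_loopZ (k : R) f : twisted_loop f -> twisted_loop (fun z => k *: f z).
Proof. by move=> ft z; rewrite tauZ ft starZ. Qed.

Lemma twisted_loopM f g :
  twisted_loop f -> twisted_loop g -> twisted_loop (fun z => f z ** g z).
Proof. by move=> ft gt z; rewrite tauM ft gt starM. Qed.

Lemma twisted_loop_star f : twisted_loop f -> twisted_loop (fun z => star (f z)).
Proof. by move=> ft z; rewrite tau_star ft. Qed.

Lemma twisted_loop_inverse f g : twisted_loop f ->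
  (forall z, quasi_inverse (f z) (g z)) -> twisted_loop g.
Proof.
move=> ft fg z; apply: (@quasi_inverse_uniq _ _ (star (f z))).
  have [h1 h2] := fg (circle_conj z).
  by split; rewrite -ft -tauM -!tauD ?h1 ?h2.
have [h1 h2] := fg z.
by split; rewrite -starM -!starD ?h1 ?h2 star0.
Qed.

Lemma twisted_loop_closed f :
  (forall e : R, 0 < e ->
    exists2 g, twisted_loop g & forall z, `|f z - g z| <= e) ->
  twisted_loop f.
Proof.
move=> fg z; apply/eqP; rewrite -subr_eq0 -normr_le0.
apply/ler_addgt0Pr => e e0; rewrite add0r.
have M1 : 0 < `|M| + 1 by rewrite ltr_wpDl.
have d0 : 0 < e / (`|M| + 1) by rewrite divr_gt0.
have [g gt fgd] := fg _ d0.
have -> : tau (f (circle_conj z)) - star (f z) =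
    tau (f (circle_conj z) - g (circle_conj z)) - star (f z - g z).
  by rewrite tauB starB gt opprB addrA subrK.
apply: le_trans (ler_normB _ _) _; rewrite norm_star.
have -> : e = `|M| * (e / (`|M| + 1)) + e / (`|M| + 1).
  by field; rewrite lt0r_neq0.
apply: lerD => //; apply: le_trans (tau_le _) _.
apply: le_trans (ler_wpM2r (normr_ge0 _) (ler_norm M)) _.
by rewrite ler_wpM2l.
Qed.

End Twisted.
End BasedLoops.

Section LoopAlgebras.
Variable R : realType.

Definition Am1_set : set (circle R -> R^o) :=
  [set f : circle R -> R^o | continuous f /\ f (circle1 R) = 0].

Definition Am1_algebra : fun_algebra R^o := @FunAlgebra R R^o Am1_set
  (fun _ => @proj1 _ _)
  (@based_loop0 R R^o) (@based_loopD R R^o) (@based_loopZ R R^o)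
  (@based_loopM R R^o) (@based_loop_star R R^o) (@based_loop_inverse R R^o)
  (@based_loop_closed R R^o).

Definition Am1 : realCstarType R := fun_alg Am1_algebra.

Definition A3_set : set (circle R -> quaternion R) :=
  [set f : circle R -> quaternion R | continuous f /\ f (circle1 R) = 0].

Definition A3_algebra : fun_algebra (quaternion R) :=
  @FunAlgebra R (quaternion R) A3_set
  (fun _ => @proj1 _ _)
  (@based_loop0 R _) (@based_loopD R _) (@based_loopZ R _)
  (@based_loopM R _) (@based_loop_star R _) (@based_loop_inverse R _)
  (@based_loop_closed R _).

Definition A3 : realCstarType R := fun_alg A3_algebra.

Definition A1_set : set (circle R -> Rcomplex R) :=
  [set f : circle R -> Rcomplex R | [/\ continuous f, f (circle1 R) = 0 &
    forall z, f (circle_conj z) = conjc (f z)]].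

Let A1_setP (f : circle R -> Rcomplex R) :
  A1_set f <-> based_loop f /\ twisted_loop id f.
Proof. by split=> [[]|[[]]]. Qed.

Let complex_mulC (x y : Rcomplex R) : id (x ** y) = id y ** id x.
Proof. exact: mulrC. Qed.

Let complex_id_le (x : Rcomplex R) : `|id x| <= 1 * `|x|.
Proof. by rewrite mul1r. Qed.

Lemma A1_continuous f : A1_set f -> continuous f. Proof. by case. Qed.

Lemma A1_set0 : A1_set (fun=> 0).
Proof. by apply/A1_setP; split; [exact: based_loop0|exact: twisted_loop0]. Qed.

Lemma A1_setD f g : A1_set f -> A1_set g -> A1_set (fun z => f z + g z).
Proof.
move=> /A1_setP[f1 f2] /A1_setP[g1 g2]; apply/A1_setP.
by split; [exact: based_loopD|exact: twisted_loopD].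
Qed.

Lemma A1_setZ (k : R) f : A1_set f -> A1_set (fun z => k *: f z).
Proof.
move=> /A1_setP[f1 f2]; apply/A1_setP.
by split; [exact: based_loopZ|exact: twisted_loopZ].
Qed.

Lemma A1_setM f g : A1_set f -> A1_set g -> A1_set (fun z => f z ** g z).
Proof.
move=> /A1_setP[f1 f2] /A1_setP[g1 g2]; apply/A1_setP.
by split; [exact: based_loopM|exact: twisted_loopM].
Qed.

Lemma A1_set_star f : A1_set f -> A1_set (fun z => star (f z)).
Proof.
move=> /A1_setP[f1 f2]; apply/A1_setP.
by split; [exact: based_loop_star|exact: twisted_loop_star].
Qed.

Lemma A1_set_inverse f g : A1_set f ->
  (forall z, quasi_inverse (f z) (g z)) -> A1_set g.
Proof.
move=> /A1_setP[f1 f2] fg; apply/A1_setP.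
by split; [exact: based_loop_inverse f1 fg|exact: twisted_loop_inverse f2 fg].
Qed.

Lemma A1_set_closed f : continuous f ->
  (forall e : R, 0 < e -> exists2 g, A1_set g & forall z, `|f z - g z| <= e) ->
  A1_set f.
Proof.
move=> fc fg; apply/A1_setP; split.
  apply: based_loop_closed => // e /fg[g gA fge].
  by exists g => //; have /A1_setP[] := gA.
apply: (twisted_loop_closed _ complex_id_le) => // e /fg[g gA fge].
by exists g => //; have /A1_setP[] := gA.
Qed.

Definition A1_algebra : fun_algebra (Rcomplex R) := FunAlgebra A1_continuous
  A1_set0 A1_setD A1_setZ A1_setM A1_set_star A1_set_inverse A1_set_closed.

Definition A1 : realCstarType R := fun_alg A1_algebra.

(* (a b; c d) is sent to (d -b; -c a). *)
Definition m2_sharp (A : M2C R) : M2C R :=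
  \matrix_(i < 2, j < 2)
    if i == 0 then (if j == 0 then (A : 'M[(R[i])%C]_2) 1 1 else - (A : 'M[(R[i])%C]_2) 0 1)
    else (if j == 0 then - (A : 'M[(R[i])%C]_2) 1 0 else (A : 'M[(R[i])%C]_2) 0 0).

Definition A5_set : set (circle R -> M2C R) :=
  [set f : circle R -> M2C R | [/\ continuous f, f (circle1 R) = 0 &
    forall z, m2_sharp (f (circle_conj z)) = star (f z)]].

Let A5_setP f : A5_set f <-> based_loop f /\ twisted_loop m2_sharp f.
Proof. by split=> [[]|[[]]]. Qed.

Let m2P (A B : 'M[(R[i])%C]_2) :
  A 0 0 = B 0 0 -> A 0 1 = B 0 1 -> A 1 0 = B 1 0 -> A 1 1 = B 1 1 -> A = B.
Proof.
have o (i : 'I_2) : i = 0 \/ i = 1.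
  by case: i => -[|[|//]] ?; [left|right]; apply: val_inj.
by move=> ? ? ? ?; apply/matrixP => i j; case: (o i) => ->; case: (o j) => ->.
Qed.

Lemma m2_sharpB : {morph m2_sharp : x y / x - y}.
Proof. by move=> x y; apply: m2P; rewrite !mxE //= opprB opprK addrC. Qed.

Lemma m2_sharpZ (k : R) x : m2_sharp (k *: x) = k *: m2_sharp x.
Proof. by apply: m2P; rewrite !mxE //= mulrN. Qed.

Lemma m2_sharpM x y : m2_sharp (x ** y) = m2_sharp y ** m2_sharp x.
Proof. by apply: m2P; rewrite !mxE !sum2E !mxE /=; ring. Qed.

Lemma m2_sharp_star x : m2_sharp (star x) = star (m2_sharp x).
Proof. by apply: m2P; rewrite !mxE //= rmorphN. Qed.

Lemma m2_sharp_le x : `|m2_sharp x| <= 4 * `|x|.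
Proof.
rewrite !m2_normE; apply: m2_norm_le_entry => i j; rewrite mxE.
have nN (z : R[i]%C) : Normc.normc (- z) = Normc.normc z.
  by case: z => a b /=; rewrite !sqrrN.
by case: ifP => _; case: ifP => _; rewrite ?nN; exact: normc_entry_le.
Qed.

Lemma m2_sharpK : involutive m2_sharp.
Proof. by move=> x; apply: m2P; rewrite !mxE //= opprK. Qed.

Lemma A5_continuous f : A5_set f -> continuous f. Proof. by case. Qed.

Lemma A5_set0 : A5_set (fun=> 0).
Proof.
apply/A5_setP; split; first exact: based_loop0.
exact: (twisted_loop0 m2_sharpB).
Qed.

Lemma A5_setD f g : A5_set f -> A5_set g -> A5_set (fun z => f z + g z).
Proof.
move=> /A5_setP[f1 f2] /A5_setP[g1 g2]; apply/A5_setP.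
by split; [exact: based_loopD|exact: (twisted_loopD m2_sharpB)].
Qed.

Lemma A5_setZ (k : R) f : A5_set f -> A5_set (fun z => k *: f z).
Proof.
move=> /A5_setP[f1 f2]; apply/A5_setP.
by split; [exact: based_loopZ|exact: (twisted_loopZ m2_sharpZ)].
Qed.

Lemma A5_setM f g : A5_set f -> A5_set g -> A5_set (fun z => f z ** g z).
Proof.
move=> /A5_setP[f1 f2] /A5_setP[g1 g2]; apply/A5_setP.
by split; [exact: based_loopM|exact: (twisted_loopM m2_sharpM)].
Qed.

Lemma A5_set_star f : A5_set f -> A5_set (fun z => star (f z)).
Proof.
move=> /A5_setP[f1 f2]; apply/A5_setP.
by split; [exact: based_loop_star|exact: (twisted_loop_star m2_sharp_star)].
Qed.

Lemma A5_set_inverse f g : A5_set f ->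
  (forall z, quasi_inverse (f z) (g z)) -> A5_set g.
Proof.
move=> /A5_setP[f1 f2] fg; apply/A5_setP.
split; first exact: based_loop_inverse f1 fg.
exact: (twisted_loop_inverse m2_sharpB m2_sharpM f2 fg).
Qed.

Lemma A5_set_closed f : continuous f ->
  (forall e : R, 0 < e -> exists2 g, A5_set g & forall z, `|f z - g z| <= e) ->
  A5_set f.
Proof.
move=> fc fg; apply/A5_setP; split.
  apply: based_loop_closed => // e /fg[g gA fge].
  by exists g => //; have /A5_setP[] := gA.
apply: (twisted_loop_closed m2_sharpB m2_sharp_le) => // e /fg[g gA fge].
by exists g => //; have /A5_setP[] := gA.
Qed.

Definition A5_algebra : fun_algebra (M2C R) := FunAlgebra A5_continuous
  A5_set0 A5_setD A5_setZ A5_setM A5_set_star A5_set_inverse A5_set_closed.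

Definition A5 : realCstarType R := fun_alg A5_algebra.

End LoopAlgebras.

(* Main.v *)
(* A_{-1} and A_1 are generated by h = Re z - 1 and y = Im z, respectively y = i Im z,
   subject only to h^* = h, y^* = s y, h y = y h and 2h + h^2 + s y^2 = 0, where s = 1,
   respectively s = -1.  These relations say that 1 + h + j y, with j central and
   j^2 = -s, is a unitary fixed by an involution.  The polar decomposition, computed by
   Newton's iteration, respects the involution and moves an approximate solution to an
   exact one; hence both algebras are semiprojective.

   A_3 and A_5 are H (x) A_{-1} and H (x) A_1.  Given H (x) A -> B/J, lift i (x) t and
   j (x) t for a root t of 1 - Re z.  Two polar decompositions turn the lifts into a copy
   in B of the cone C_0((0,1]) (x) H.  The elements of its corner that commute with the
   quaternions form a real C*-algebra for every quotient B/J_n, and the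
   averages sum_q (t^6 q) b (t^6 q)^* over q = 1, i, j, k, with b a lift of h / t^12 or
   y / t^12, lie in it.  The generators of A thus lift there, and multiplying by the
   quaternions extends that lift to H (x) A. *)
From HB Require Import structures.
From mathcomp Require Import all_boot all_order all_algebra.
From mathcomp Require Import ring lra complex.
From mathcomp Require Import all_classical all_reals all_analysis.
Require Import Defs.

Set Implicit Arguments.
Unset Strict Implicit.
Unset Printing Implicit Defensive.

Import Order.TTheory GRing.Theory Num.Theory.
Import numFieldNormedType.Exports.

Local Open Scope classical_set_scope.
Local Open Scope ring_scope.

(** The axioms offer only the invertibility of $1+a^*a$ and $\|a^*a\|=\|a\|^2$. Spectral theory is
    therefore rebuilt over the real line, without complexifying the algebra: everything rests on
    $1-a^2$ being non-invertible for selfadjoint $a$ of norm 1. The same estimates make each $B/J_n$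
    a real C*-algebra, and Newton's iteration converges there by completeness.

    The relations of $h$ and $y$ lift only approximately, so $n$ must be found for them. The cone
    $C_0((0,1])\otimes\mathbb H$ lifts exactly, so its copy is at hand in every quotient before $n$
    is known. A unit for the quaternions need not lift; only multiples by powers of $t$ do, and a
    quaternion acts on the commutant as a limit of such multiples divided by approximations of the
    power.

    The exponents come from degrees: the polar decompositions produce elements of degree 3 in $t$,
    products of two of them have degree 6, and an average has such a product on either side, whence
    $t^{12}$. As $\mathrm{Im}\,z$ vanishes only like $\sqrt{1-\mathrm{Re}\,z}$, $t$ must be a high
    root for $y/t^{12}$ to be continuous. *)

(** * The unitization as a ring, and its invertible elements *)

Section UnitizationRing.
Context (R : realType) (A : nuAlgType R).

(** A copy of [unitization] that carries a ring structure, so that polynomials in an element,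
    constant terms included, are available through [horner_alg]. *)
Definition unital : Type := (R^o * A)%type.

HB.instance Definition _ := GRing.Lmodule.copy unital (R^o * A)%type.

Definition unital_one : unital := (1, 0).
Definition unital_mul (u v : unital) : unital :=
  ((u.1 : R) * v.1, (u.1 : R) *: v.2 + (v.1 : R) *: u.2 + u.2 ** v.2).

Lemma unital_mulA : associative unital_mul.
Proof.
move=> [r a] [s b] [t c]; rewrite /unital_mul /=; congr pair; first exact: mulrA.
rewrite !scalerDr !amulDl !amulDr !amulZl !amulZr !scalerA amulA.
rewrite [t * r]mulrC [t * s]mulrC !addrA.
by rewrite [LHS](ACl (1*2*4*6*3*5*7)).
Qed.

Lemma unital_mul1 : left_id unital_one unital_mul.
Proof.
by move=> [r a]; rewrite /unital_mul /= mul1r scale1r scaler0 amul0l !addr0.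
Qed.

Lemma unital_mulr1 : right_id unital_one unital_mul.
Proof.
by move=> [r a]; rewrite /unital_mul /= mulr1 scale1r scaler0 amul0r add0r addr0.
Qed.

Lemma unital_mulDl : left_distributive unital_mul +%R.
Proof.
move=> [r a] [s b] [t c]; rewrite /unital_mul /=; congr pair; first exact: mulrDl.
by rewrite scalerDl scalerDr amulDl !addrA [LHS](ACl (1*3*5*2*4*6)).
Qed.

Lemma unital_mulDr : right_distributive unital_mul +%R.
Proof.
move=> [r a] [s b] [t c]; rewrite /unital_mul /=; congr pair; first exact: mulrDr.
by rewrite scalerDl scalerDr amulDr !addrA [LHS](ACl (1*3*5*2*4*6)).
Qed.

Lemma unital_oner_neq0 : unital_one != 0.
Proof. by apply/eqP => -[] /eqP; rewrite oner_eq0. Qed.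

HB.instance Definition _ := GRing.Zmodule_isNzRing.Build unital
  unital_mulA unital_mul1 unital_mulr1 unital_mulDl unital_mulDr unital_oner_neq0.

Lemma unital_scalerAl (k : R) (u v : unital) : k *: (u * v) = (k *: u) * v.
Proof.
case: u v => [r a] [s b]; congr pair; first exact: mulrA.
by rewrite /= amulZl !scalerDr !scalerA [s * k]mulrC.
Qed.

HB.instance Definition _ := GRing.Lmodule_isLalgebra.Build R unital unital_scalerAl.

Lemma unital_scalerAr (k : R) (u v : unital) : k *: (u * v) = u * (k *: v).
Proof.
case: u v => [r a] [s b]; congr pair; first exact: mulrCA.
by rewrite /= amulZr !scalerDr !scalerA [r * k]mulrC.
Qed.

HB.instance Definition _ := GRing.Lalgebra_isAlgebra.Build R unital unital_scalerAr.

Definition emb (a : A) : unital := (0, a).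

Lemma emb_is_linear : linear emb.
Proof. by move=> k a b; apply: injective_projections => //=; rewrite (@scaler0 R R^o) addr0. Qed.
HB.instance Definition _ := GRing.isLinear.Build R A unital _ emb emb_is_linear.

Lemma embD : {morph emb : a b / a + b}. Proof. exact: linearD. Qed.
Lemma embN : {morph emb : a / - a}. Proof. exact: linearN. Qed.
Lemma embB : {morph emb : a b / a - b}. Proof. exact: linearB. Qed.
Lemma embZ k a : emb (k *: a) = k *: emb a. Proof. exact: linearZ. Qed.
Lemma emb0 : emb 0 = 0. Proof. exact: linear0. Qed.

Lemma embM a b : emb (a ** b) = emb a * emb b.
Proof. by apply: injective_projections; rewrite /= ?mul0r // !scale0r !add0r. Qed.

Lemma emb_inj : injective emb.
Proof. by move=> a b []. Qed.

Lemma unital_fst_mul (u v : unital) : (u * v).1 = (u.1 : R) * v.1. Proof. by []. Qed.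

Lemma emb_snd (u : unital) : u.1 = 0 -> emb u.2 = u.
Proof. by case: u => r a /= ->. Qed.

Lemma emb_mulr_snd a (u : unital) : emb ((emb a * u).2) = emb a * u.
Proof. by apply: emb_snd; rewrite unital_fst_mul mul0r. Qed.

End UnitizationRing.

Section TwoSidedInverses.
Variable U : pzRingType.
Implicit Types u v w : U.

Definition invertible u := exists v, u * v = 1 /\ v * u = 1.

Lemma invertible1 : invertible 1.
Proof. by exists 1; rewrite mulr1. Qed.

Lemma invertibleM u v : invertible u -> invertible v -> invertible (u * v).
Proof.
move=> [u' [uu' u'u]] [v' [vv' v'v]]; exists (v' * u'); split.
  by rewrite mulrA -(mulrA u) vv' mulr1.
by rewrite mulrA -(mulrA v') u'u mulr1.
Qed.

(** With $w$ the inverse of $uv$, $vw$ is a right and $wv$ a left inverse of $u$. Thus a polynomial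
    in one element is invertible as soon as a multiple of it is. *)
Lemma invertible_factor u v : u * v = v * u -> invertible (u * v) -> invertible u.
Proof.
move=> uv [w [h1 h2]]; exists (v * w); rewrite mulrA; split=> //.
have wvu : w * v * u = 1 by rewrite -mulrA -uv.
have e : w * v = v * w.
  by rewrite -[LHS]mulr1 -h1 !mulrA wvu mul1r.
by rewrite -e.
Qed.

Lemma invertible_sides u v w : u * v = 1 -> w * u = 1 -> invertible u.
Proof.
move=> uv wu; exists v; split=> //.
by have -> : v = w by rewrite -[v]mul1r -wu -mulrA uv mulr1.
Qed.

Lemma inv_comm u v w : u * v = 1 -> v * u = 1 -> u * w = w * u -> v * w = w * v.
Proof.
by move=> uv vu uw; rewrite -[v * w]mulr1 -uv mulrA -(mulrA v) -uw mulrA vu mul1r.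
Qed.

End TwoSidedInverses.

Lemma invertibleZ (R : realType) (U : algType R) (k : R) (u : U) : k != 0 ->
  invertible u -> invertible (k *: u).
Proof.
move=> k0 [v [h1 h2]]; exists (k^-1 *: v).
by rewrite -!scalerAl -!scalerAr !scalerA h1 h2 mulfV // mulVf // scale1r.
Qed.

Section InvertibleUnitization.
Context (R : realType) (A : nuAlgType R).

Lemma invertible_unital (u : unital A) :
  invertible u <-> unit_invertible (u : unitization A).
Proof. by split=> -[v] [h1 h2]; exists v. Qed.

Lemma quasi_inverse_invertible (a b : A) :
  quasi_inverse a b <-> (1 + emb a) * (1 + emb b) = 1 /\ (1 + emb b) * (1 + emb a) = 1.
Proof.
have e (x y : A) : (1 + emb x) * (1 + emb y) = 1 + emb (x + y + x ** y).
  rewrite mulrDl mul1r mulrDr mulr1 -embM !linearD /= !addrA; congr (_ + _).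
  by rewrite -!addrA [emb y + _]addrC.
have i (z : A) : 1 + emb z = 1 <-> z = 0.
  split=> [/eqP|->]; last by rewrite linear0 addr0.
  by rewrite -subr_eq0 addrC addKr => /eqP/(congr1 snd).
split=> [[h1 h2]|[]].
  by rewrite !e h1 [b + a]addrC h2 linear0 addr0.
by rewrite !e => /i h1 /i; rewrite [b + a]addrC.
Qed.

Lemma invertible1Demb (a : A) : invertible (1 + emb a) <-> exists b, quasi_inverse a b.
Proof.
rewrite -unit_invertibleP -invertible_unital.
by rewrite (_ : 1 + emb a = ((1, a) : unital A)) //; congr pair; rewrite /= ?addr0 ?add0r.
Qed.

End InvertibleUnitization.

(** * Uniform continuity and limits of sequences *)

Lemma segment_uniform (R : realType) (V : normedModType R) (f : R -> V) (a b e : R) :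
  continuous f -> 0 < e ->
  exists2 d : R, 0 < d & forall x y, a <= x <= b -> `|x - y| < d -> `|f x - f y| <= e.
Proof.
move=> fc e0.
have /compact_near_coveringP/(_ R (0 : R)^'+
  (fun d x => forall y, `|x - y| < d -> `|f x - f y| <= e)) := @segment_compact R a b.
have e20 : 0 < e / 2 by lra.
case=> [x _ /=|d /= d0 H].
  have /cvgrPdist_le/(_ _ e20)/nbhs_ballP[r /= r0 xr] := fc x.
  have r20 : 0 < r / 2 by lra.
  exists (ball x (r / 2), [set d : R | d < r / 2]).
    split; first exact: nbhsx_ballx.
    by apply: nbhs_right_lt.
  move=> [x' d] [/= xx' dr] y x'y.
  have h1 : `|f x - f x'| <= e / 2.
    by apply: xr; apply: (le_ball _ xx'); lra.
  have h2 : `|f x - f y| <= e / 2.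
    apply: xr; rewrite -ball_normE /= in xx' *.
    have := ler_normD (x - x') (x' - y); rewrite addrA subrK; lra.
  have := ler_normB (f x - f y) (f x - f x').
  rewrite opprB [f x - f y + _]addrC addrA subrK; lra.
exists (d / 2); first by rewrite divr_gt0.
move=> x y xab xy.
have d2 : 0 < d / 2 by rewrite divr_gt0.
have d2d : ball_ Num.norm 0 d (d / 2).
  by rewrite /ball_ /= sub0r normrN gtr0_norm //; move: d0 => /=; lra.
exact: (H (d / 2) d2d d2 x).
Qed.

Section Limits.
Context (R : realType) (D : realCstarType R).
Implicit Types (u v : nat -> D) (a b : D).

Lemma cvg_amul u v a b : u @ \oo --> a -> v @ \oo --> b ->
  (fun n => u n ** v n) @ \oo --> a ** b.
Proof.
move=> ua vb; apply/cvgrPdist_le => /=.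
pose h n := `|a - u n| * `|v n| + `|a| * `|b - v n|.
have h0 : h @ \oo --> (0 : R).
  have -> : (0 : R) = `|a - a| * `|b| + `|a| * `|b - b|.
    by rewrite !subrr normr0 mul0r mulr0 addr0.
  apply: cvgD; apply: cvgM; [|exact: cvg_norm|exact: cvg_cst|];
    by apply: cvg_norm; apply: cvgB => //; exact: cvg_cst.
move=> e e0; move/cvgr0Pnorm_le: h0 => /(_ e e0); apply: filterS => n.
apply: le_trans; apply: le_trans (ler_norm _).
have -> : a ** b - u n ** v n = (a - u n) ** v n + a ** (b - v n).
  by rewrite amulBl amulBr [RHS]addrC addrA subrK.
by rewrite (le_trans (ler_normD _ _)) // lerD // normr_amul.
Qed.

Lemma cvg_star u a : u @ \oo --> a -> (fun n => star (u n)) @ \oo --> star a.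
Proof.
move=> ua; apply/cvgrPdist_le => /= e e0; move/cvgrPdist_le: ua => /(_ e e0).
by apply: filterS => n; rewrite -starB norm_star.
Qed.

Lemma cvg_geometric_increments (V : completeNormedModType R) (u : nat -> V) (C q : R) :
  0 <= q < 1 -> (forall n, `|u n.+1 - u n| <= C * q ^+ n) -> cvgn u.
Proof.
move=> /andP[q0 q1] uC.
have -> : u = (fun n => u 0%N + series (fun n => u n.+1 - u n) n).
  by apply/funext => n; rewrite /series /= telescope_sumr // addrC subrK.
apply: is_cvgD; first exact: is_cvg_cst.
apply: normed_cvg; apply: (series_le_cvg _ _ uC) => // [n|].
  by apply: le_trans (uC n).
by apply: is_cvg_geometric_series; rewrite ger0_norm.
Qed.

Lemma cvg_scale (V : normedModType R) (k : R) (u : nat -> V) (a : V) :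
  u @ \oo --> a -> (fun n => k *: u n) @ \oo --> k *: a.
Proof. by move=> ua; apply: cvgZr. Qed.

Lemma cvg_sub (V : normedModType R) (u v : nat -> V) (a b : V) :
  u @ \oo --> a -> v @ \oo --> b -> (fun n => u n - v n) @ \oo --> a - b.
Proof. exact: cvgB. Qed.

Lemma increments_le (V : normedModType R) (u : nat -> V) (v : V) n :
  (forall n, `|v - u n| <= 2^-1 ^+ n) -> `|u n.+1 - u n| <= 2 * 2^-1 ^+ n.
Proof.
move=> uv; have := ler_normB (v - u n) (v - u n.+1); rewrite opprB [v - _ + _]addrC addrA subrK.
have : 0 <= (2 : R)^-1 ^+ n by rewrite exprn_ge0 // invr_ge0.
by have := uv n; have := uv n.+1; rewrite exprS; lra.
Qed.

Lemma lim_unique (V : normedModType R) (u v : nat -> V) (a b : V) :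
  u @ \oo --> a -> v @ \oo --> b -> u =1 v -> a = b.
Proof.
move=> ua vb uv; have e : u = v by apply/funext.
by rewrite e in ua; rewrite -(cvg_lim _ ua) // -(cvg_lim _ vb).
Qed.

Lemma cvg0_geometric (V : normedModType R) (u : nat -> V) (C q : R) :
  0 <= q < 1 -> (forall n, `|u n| <= C * q ^+ n) -> u @ \oo --> (0 : V).
Proof.
move=> /andP[q0 q1] uC; apply/cvgr0Pnorm_le => e e0.
have : (fun n => C * q ^+ n) @ \oo --> (0 : R).
  rewrite -(mulr0 C); apply: cvgM; first exact: cvg_cst.
  by apply: cvg_expr; rewrite ger0_norm.
move=> /cvgr0Pnorm_le/(_ e e0); apply: filterS => n; apply: le_trans.
by apply: le_trans (uC n) (ler_norm _).
Qed.

Lemma norm_lim_le (V : normedModType R) (u : nat -> V) (l : V) (M : R) :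
  u @ \oo --> l -> (forall n, `|u n| <= M) -> `|l| <= M.
Proof.
move=> ul uM; have nl : (fun n => `|u n|) @ \oo --> `|l| by exact: cvg_norm.
rewrite -(cvg_lim _ nl) //; apply: limr_le; first by apply/cvg_ex; exists `|l|.
exact: nearW.
Qed.

End Limits.

(** * Neumann series and quadratics without real roots *)

Section Spectrum.
Context (R : realType) (D : realCstarType R).
Implicit Types (a b h : D) (r s : R).
Local Notation U := (unital D).
Local Notation ev u := (@horner_alg R U u).

(** The fixed points of the contractions $x\mapsto a+ax$ and $x\mapsto a+xa$ give a right and a left
    inverse. Both live in [D], so the unitization needs no norm. *)
Lemma invertible_neumann a : `|a| < 1 -> invertible (1 - emb a).
Proof.
move=> a1.
have sol (L : D -> D) : (forall x y, L x - L y = L (x - y)) ->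
    (forall x, `|L x| <= `|a| * `|x|) -> exists p, p = a + L p.
  move=> LB Lle; pose u n := iter n (fun x => a + L x) 0.
  have inc n : `|u n.+1 - u n| <= `|u 1%N - u 0%N| * `|a| ^+ n.
    elim: n => [|n IH]; first by rewrite mulr1.
    rewrite [u n.+2]/(a + L (u n.+1)) [u n.+1 in X in _ - X]/(a + L (u n)).
    rewrite opprD addrACA subrr add0r LB (le_trans (Lle _)) //.
    by rewrite exprS mulrCA ler_wpM2l.
  have /cvg_ex[p up] : cvgn u.
    by apply: (cvg_geometric_increments _ inc); rewrite a1 normr_ge0.
  exists p.
  have up1 : (fun n => u n.+1) @ \oo --> p.
    by rewrite (cvg_shiftS u).
  transitivity (lim ((fun n => u n.+1) @ \oo)); first exact/esym/cvg_lim.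
  apply: cvg_lim => //.
  apply: cvgD; first exact: cvg_cst.
  apply/cvgrPdist_le => e e0; move/cvgrPdist_le: up => /(_ e e0).
  apply: filterS => n; rewrite LB; apply: le_trans.
  by apply: le_trans (Lle _) _; rewrite ler_piMl // ltW.
have [p ep] : exists p, p = a + a ** p.
  apply: sol => [x y|x]; [exact: esym (amulBr _ _ _)|exact: normr_amul].
have [q eq] : exists q, q = a + q ** a.
  apply: (sol (fun x => x ** a)) => [x y|x]; first exact: esym (amulBl _ _ _).
  by rewrite mulrC normr_amul.
have hp : emb p - emb (a ** p) = emb a by rewrite -linearB /= {1}ep addrK.
have hq : emb q - emb (q ** a) = emb a by rewrite -linearB /= {1}eq addrK.
apply: (@invertible_sides _ _ (1 + emb p) (1 + emb q)).
  by rewrite mulrDr mulr1 mulrBl mul1r -embM hp subrK.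
by rewrite mulrDl mul1r mulrBr mulr1 -embM hq subrK.
Qed.

Lemma invertible_pos a r : 0 < r -> invertible (r%:A + emb (star a ** a) : U).
Proof.
move=> r0; pose c := (Num.sqrt r)^-1; pose b := c *: a.
have -> : r%:A + emb (star a ** a) = r *: (1 + emb (star b ** b)).
  rewrite scalerDr; congr (_ + _).
  rewrite /b starZ amulZl amulZr !linearZ /= !scalerA.
  rewrite (_ : c * c * r = 1) ?scale1r // /c -invfM -expr2.
  by rewrite sqr_sqrtr ?(ltW r0) // mulVf // lt0r_neq0.
apply: invertibleZ; first by rewrite lt0r_neq0.
apply/invertible1Demb/unit_invertibleP; exact: cstar_invertible.
Qed.

(* [1 + b^2] with [b] a polynomial in [h] without constant term is invertible,
   and [b] may be chosen with [b(s + i r) = i], so that the quadratic divides it. *)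
Lemma invertible_quadratic h s r : star h = h -> r != 0 ->
  invertible ((emb h - s%:A) ^+ 2 + (r ^+ 2)%:A : U).
Proof.
move=> hh r0.
pose m := s ^+ 2 + r ^+ 2.
have m0 : 0 < m by rewrite ltr_wpDl ?sqr_ge0 // lt0r sqrf_eq0 r0 sqr_ge0.
(* This [k] cancels the real part of $b(s+ir)$ and leaves $b(s+ir)=i\,m\,r$. Instead of dividing by
   $mr$, the proof uses $m^2r^2+b^2$. *)
pose k := r ^+ 2 - s ^+ 2; pose b := s *: (h ** h) + k *: h.
have bb : star b = b by rewrite starD !starZ starM hh.
pose P : {poly R} := ('X - s%:P) ^+ 2 + (r ^+ 2)%:P.
pose Q : {poly R} := s%:P ^+ 2 * 'X ^+ 2 + 2 * s%:P * r%:P ^+ 2 * 'X + m%:P * r%:P ^+ 2.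
pose B : {poly R} := s *: 'X ^+ 2 + k *: 'X.
have PQ : P * Q = m%:P ^+ 2 * r%:P ^+ 2 + B ^+ 2.
  by rewrite /P /Q /B /m /k -!mul_polyC !rmorphD !rmorphN !rmorphXn /=; ring.
have evP : ev (emb h) P = (emb h - s%:A) ^+ 2 + (r ^+ 2)%:A.
  by rewrite /P rmorphD rmorphXn rmorphB /= !horner_algC horner_algX.
have evB : ev (emb h) B = emb b.
  rewrite /B /b -!mul_polyC rmorphD !rmorphM /= !horner_algC horner_algX.
  by rewrite !mulr_algl linearD !linearZ /= embM.
have evPQ : ev (emb h) P * ev (emb h) Q = (m ^+ 2 * r ^+ 2)%:A + emb (star b ** b).
  rewrite -rmorphM /= PQ bb embM -evB rmorphD /= -!rmorphXn -rmorphM /= horner_algC.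
  by rewrite rmorphXn expr2.
rewrite -evP; apply: (@invertible_factor _ _ (ev (emb h) Q)).
  by rewrite -!rmorphM mulrC.
rewrite evPQ; apply: invertible_pos.
by rewrite mulr_gt0 // exprn_even_gt0 //= ?r0 // lt0r_neq0.
Qed.

End Spectrum.

(** * Norms of selfadjoint elements, by Poisson kernels *)

Section NormOfSelfadjoint.
Context (R : realType) (D : realCstarType R).
Implicit Types (a b h u x : D) (t r s : R).
Local Notation U := (unital D).
Local Notation ev u := (@horner_alg R U u).

Lemma selfadj_normM x : star x = x -> `|x ** x| = `|x| ^+ 2.
Proof. by move=> {1}<-; exact: cstar_identity. Qed.

Lemma ev_mul u (p q : {poly R}) : ev (emb u) (p * q) = ev (emb u) p * ev (emb u) q.
Proof. exact: rmorphM. Qed.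

Lemma ev_scale u k (p : {poly R}) : ev (emb u) (k *: p) = k *: ev (emb u) p.
Proof. by rewrite -mul_polyC ev_mul horner_algC mulr_algl. Qed.

Lemma ev_quadratic u k : ev (emb u) (1 - k%:P * 'X + 'X * 'X) =
  1 + emb (u ** u - k *: u).
Proof.
rewrite rmorphD rmorphB rmorph1 !rmorphM /= horner_algX horner_algC mulr_algl.
by rewrite embB embZ embM [LHS]addrAC -addrA.
Qed.

Lemma ev_linear u k : ev (emb u) (1 + k%:P * 'X) = 1 + k *: emb u.
Proof. by rewrite rmorphD rmorph1 rmorphM /= horner_algX horner_algC mulr_algl. Qed.

(** The denominator of the Poisson kernel. Its roots $e^{\pm it}$ are not real when $\sin t\neq 0$;
    otherwise $\cos t=\pm1$ and it is the square of $1\mp u$. *)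
Lemma invertible_poisson u t : star u = u ->
  invertible (1 - emb u : U) -> invertible (1 + emb u : U) ->
  invertible (1 + emb (u ** u - (2 * cos t) *: u) : U).
Proof.
move=> uu i1 i2; have [st|st] := eqVneq (sin t) 0.
  have [k k1 ->] : exists2 k : R, k * k = 1 & cos t = k.
    by exists (cos t) => //; have := cos2Dsin2 t; rewrite st expr0n addr0 expr2.
  have ik : invertible (1 + (- k) *: emb u : U).
    have /eqP := k1; rewrite -expr2 sqrf_eq1 => /orP[] /eqP ->.
      by rewrite scaleN1r.
    by rewrite opprK scale1r.
  rewrite -ev_quadratic (_ : _ + _ = (1 + (- k)%:P * 'X) * (1 + (- k)%:P * 'X)).
    by rewrite rmorphM /= ev_linear; exact: invertibleM.
  have kk : k%:P * k%:P = 1 by rewrite -polyCM k1.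
  have -> : (1 + (- k)%:P * 'X) * (1 + (- k)%:P * 'X) =
      1 - (k%:P + k%:P) * 'X + (k%:P * k%:P) * ('X * 'X) by rewrite polyCN; ring.
  by rewrite kk mul1r mulr_natl mulr2n polyCD.
have := invertible_quadratic (cos t) uu st.
suff -> : (emb u - (cos t)%:A) ^+ 2 + (sin t ^+ 2)%:A =
  1 + emb (u ** u - (2 * cos t) *: u) :> U by [].
rewrite -ev_quadratic sin2cos2.
have -> : 1 - (2 * cos t)%:P * 'X + 'X * 'X =
    ('X - (cos t)%:P) ^+ 2 + (1 - cos t ^+ 2)%:P :> {poly R}.
  by rewrite mulr_natl mulr2n polyCD polyCB polyCM -polyC1 polyC1; ring.
by rewrite rmorphD rmorphXn rmorphB /= horner_algX !horner_algC.
Qed.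

(* With [u = a^2] and [x_k = u^(2^k)], the elements [P_k(t)] below are the Poisson kernels
   [(1 - x_k^2) / (1 - 2 x_k cos t + x_k^2)].  They are averages of more and more
   values of [P_0], so that [P_k(0) - P_k(pi) = 4 x_k / (1 - x_k^2)] tends to 0,
   although all [x_k] have norm 1. *)
Lemma selfadj_not_invertible a : star a = a -> `|a| = 1 ->
  ~ invertible (1 - emb (a ** a) : U).
Proof.
move=> aa a1 iu; set u := a ** a in iu.
pose x k := iter k (fun y : D => y ** y) u.
have xx k : star (x k) = x k by elim: k => [|k IH] /=; rewrite starM ?aa ?IH.
have x1 k : `|x k| = 1.
  elim: k => [|k IH] /=; first by rewrite selfadj_normM // a1 expr1n.
  by rewrite selfadj_normM ?xx // IH expr1n.
have ip k : invertible (1 + emb (x k) : U).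
  rewrite -[1]scale1r; case: k => [|k] /=.
    by rewrite /u -{1}aa; exact: invertible_pos.
  by rewrite -{1}(xx k); exact: invertible_pos.
have ipm k : invertible ((1 - emb (x k)) * (1 + emb (x k)) : U) ->
    invertible (1 - emb (x k.+1) : U).
  by rewrite mulrDr mulr1 mulrBl mul1r addrA subrK -embM.
have im k : invertible (1 - emb (x k) : U).
  by elim: k => [//|k IH]; apply/ipm/invertibleM.
have ptw t : exists b, quasi_inverse (u ** u - (2 * cos t) *: u) b.
  by apply/invertible1Demb/invertible_poisson; rewrite ?(xx 0%N) //; exact: (ip 0%N).
have [q qP] := choice ptw.
have qc : continuous q.
  apply: (continuous_quasi_inverse qP) => t; apply: cvgB; first exact: cvg_cst.
  apply: cvgZl; apply: cvgM; first exact: cvg_cst.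
  exact: continuous_cos.
(* The kernel is $P_0=(1-w)(1+q)=1+p_0$; only the summand $p_0$ in [D], which has a norm, is
   kept. *)
pose w := u ** u; pose p0 t := q t - w - w ** q t.
have p0c : continuous p0.
  move=> t; apply: cvgB; first by apply: cvgB; [exact: qc|exact: cvg_cst].
  exact: (@continuous_amul R D _ (fun=> w) q (@cst_continuous _ _ w) qc t).
(* Angles $t/2$ and $t/2+\pi$ belong to the two square roots of $e^{it}$. Their kernels for $x_k$
   average to the kernel for $x_k^2$ at $t$. *)
pose p k := iter k (fun (f : R -> D) t => 2^-1 *: (f (t / 2) + f (t / 2 + pi))) p0.
have pP k t : (1 + emb (p k t)) * ev (emb (x k)) (1 - (2 * cos t)%:P * 'X + 'X * 'X) =
    ev (emb (x k)) (1 - 'X * 'X).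
  elim: k t => [|k IH] t.
    rewrite ev_quadratic (_ : 1 + emb (p 0%N t) = (1 - emb w) * (1 + emb (q t))).
      by rewrite -mulrA (proj2 ((quasi_inverse_invertible _ _).1 (qP t))) mulr1
        rmorphB rmorph1 rmorphM /= horner_algX -embM.
    rewrite mulrDr mulr1 mulrBl mul1r -embM /= /p0 !embB !addrA.
    by congr (_ - _); exact: addrAC.
  rewrite [p k.+1 t]/(2^-1 *: (p k (t / 2) + p k (t / 2 + pi))).
  pose c := cos (t / 2).
  have ct : cos t = 2 * c ^+ 2 - 1.
    have {1}-> : t = (t / 2) *+ 2 by rewrite mulr2n -splitr.
    by rewrite cos_mulr2n mulr2n -/c mulr_natl mulr2n.
  have := IH (t / 2); have := IH (t / 2 + pi); rewrite cosDpi -/c.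
  set A := 1 - (2 * c)%:P * _ + _; set B := 1 - (2 * - c)%:P * _ + _.
  move=> eB eA.
  have -> : ev (emb (x k.+1)) (1 - (2 * cos t)%:P * 'X + 'X * 'X) = ev (emb (x k)) (A * B).
    have -> : A * B = 1 - (2 * cos t)%:P * ('X * 'X) + ('X * 'X) * ('X * 'X).
      by rewrite /A /B ct !mulr_natl !mulr2n !(polyCD, polyCN) expr2 polyCM -polyC1 polyC1; ring.
    by rewrite !(rmorphD, rmorphN, rmorph1, rmorphM) /= !horner_algX !horner_algC embM.
  have -> : ev (emb (x k.+1)) (1 - 'X * 'X) = ev (emb (x k)) (1 - ('X * 'X) * ('X * 'X)).
    by rewrite !(rmorphB, rmorph1, rmorphM) /= !horner_algX embM.
  have -> : 1 + emb (2^-1 *: (p k (t / 2) + p k (t / 2 + pi))) =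
      2^-1 *: ((1 + emb (p k (t / 2))) + (1 + emb (p k (t / 2 + pi)))).
    have h : 2^-1 *: (1 + 1) = 1 :> U.
      by rewrite -[1 + 1]/(1 *+ 2) -(@scaler_nat R U 2 1) scalerA mulVf ?pnatr_eq0 // scale1r.
    by rewrite embZ embD -[X in X + _ = _]h -scalerDr addrACA.
  rewrite -scalerAl mulrDl {1}(ev_mul (x k) A B) [_ * (horner_alg _ A * _)]mulrA eA.
  rewrite [A * B]mulrC (ev_mul (x k) B A) [_ * (horner_alg _ B * _)]mulrA eB.
  rewrite -!ev_mul -rmorphD /= -ev_scale; congr (ev _ _).
  have -> : (1 - 'X * 'X) * B + (1 - 'X * 'X) * A =
      2 *: ((1 - 'X * 'X) * (1 + 'X * 'X)) :> {poly R}.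
    by rewrite /A /B mulrN polyCN scaler_nat; ring.
  by rewrite scalerA mulVf ?pnatr_eq0 // scale1r; ring.
have [d d0 p0d] := @segment_uniform R D p0 0 (2 * pi) 1 p0c ltr01.
(* Halving the angle doubles the scale on which the kernel oscillates by at most 1. The interval
   $[0,2\pi]$ is stable under both halvings. *)
have pd k t s : 0 <= t <= 2 * pi -> 0 <= s <= 2 * pi -> `|t - s| < 2 ^+ k * d ->
    `|p k t - p k s| <= 1.
  elim: k t s => [|k IH] t s t01 s01; first by rewrite mul1r; exact: p0d.
  rewrite exprS -mulrA -ltr_pdivrMl // => ts.
  have tsE : 2^-1 * `|t - s| = `|t / 2 - s / 2|.
    by rewrite -mulrBl normrM [`|2^-1|]ger0_norm ?invr_ge0 // mulrC.
  rewrite tsE in ts; have p_gt0 := pi_gt0 R.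
  have h1 : `|p k (t / 2) - p k (s / 2)| <= 1 by apply: IH ts; lra.
  have h2 : `|p k (t / 2 + pi) - p k (s / 2 + pi)| <= 1.
    by apply: IH; [lra|lra|rewrite opprD addrACA subrr addr0].
  rewrite -scalerBr normrZ ger0_norm ?invr_ge0 // opprD addrACA.
  have := ler_normD (p k (t / 2) - p k (s / 2)) (p k (t / 2 + pi) - p k (s / 2 + pi)).
  by rewrite ler_pdivrMl // mulr1; lra.
have [k kd] : exists k, pi < 2 ^+ k * d.
  exists (Num.truncn (pi / d)).+1; rewrite -ltr_pdivrMr //.
  apply: lt_le_trans (truncnS_gt _) _.
  by rewrite -natrX ler_nat ltnW // ltn_expl.
have {pd kd}dk : `|p k 0 - p k pi| <= 1.
  have p_gt0 := pi_gt0 R.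
  by apply: pd; [lra|lra|rewrite sub0r normrN gtr0_norm].
have e0 := pP k 0; have e1 := pP k pi; rewrite cos0 cospi in e0 e1.
have [v [v1 _]] := im k.+1.
pose z := p k 0 - p k pi.
have ex : emb z * (1 - emb (x k.+1)) = 4 *: emb (x k).
  have e2 : ev (emb (x k)) (1 - 'X * 'X) = 1 - emb (x k.+1).
    by rewrite rmorphB rmorph1 rmorphM /= horner_algX -embM.
  have e3 : emb z = (1 + emb (p k 0)) - (1 + emb (p k pi)).
    by rewrite embB opprD addrACA subrr add0r.
  suff : emb z * (1 - emb (x k.+1)) * (1 - emb (x k.+1)) =
      4 *: emb (x k) * (1 - emb (x k.+1)).
    by move=> /(congr1 ( *%R^~ v)); rewrite -!mulrA v1 !mulr1.
  rewrite -e2 -mulrA -ev_mul e3 mulrBl.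
  have -> : (1 - 'X * 'X) * (1 - 'X * 'X) =
     (1 - (2 * 1)%:P * 'X + 'X * 'X) * (1 - (2 * -1)%:P * 'X + 'X * 'X) :> {poly R}.
    by rewrite mulr1 mulrN1 polyCN; ring.
  rewrite {1}ev_mul mulrA e0 [_ * (1 - (2 * -1)%:P * 'X + _)]mulrC ev_mul mulrA e1.
  have -> : 4 *: emb (x k) = ev (emb (x k)) (4 *: 'X) by rewrite ev_scale horner_algX.
  rewrite -!ev_mul -rmorphB /=.
  by congr (ev _ _); rewrite mulr1 mulrN1 polyCN scaler_nat; ring.
have {ex} : z - z ** x k.+1 = 4 *: x k.
  by apply: emb_inj; rewrite embB embM embZ -ex mulrBr mulr1.
(* The contradiction: $4=\|z-zx_{k+1}\|\le 2\|z\|\le 2$. *)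
move=> /(congr1 Num.norm); rewrite normrZ x1 mulr1 ger0_norm // => e4.
have := ler_normB z (z ** x k.+1); have := normr_amul z (x k.+1).
by rewrite e4 x1 mulr1; move: dk; rewrite -/z; lra.
Qed.

End NormOfSelfadjoint.

(** * Polynomials and rational expressions in a selfadjoint element *)

Section PolynomialCalculus.
Context (R : realType) (D : realCstarType R).
Implicit Types (a b h u x : D) (t r s : R) (p q : {poly R}).
Local Notation U := (unital D).
Local Notation ev u := (@horner_alg R U (emb u)).

(** If $\|a\|>m$, then $M=\|a\|$ is allowed, and $a/\|a\|$ contradicts [selfadj_not_invertible]. *)
Lemma norm_le_invertible a (m : R) : star a = a -> 0 <= m ->
  (forall M : R, m < M -> invertible ((M ^+ 2)%:A - emb (a ** a) : U)) -> `|a| <= m.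
Proof.
move=> aa m0 H; rewrite leNgt; apply/negP => ma; have a0 := le_lt_trans m0 ma.
apply: (@selfadj_not_invertible _ _ (`|a|^-1 *: a)).
- by rewrite starZ aa.
- by rewrite normrZ ger0_norm ?invr_ge0 // mulVf // lt0r_neq0.
have -> : 1 - emb ((`|a|^-1 *: a) ** (`|a|^-1 *: a)) =
    (`|a|^-1 ^+ 2) *: ((`|a| ^+ 2)%:A - emb (a ** a)) :> U.
  rewrite amulZl amulZr !scalerA embZ scalerBr scalerA -expr2 -exprMn.
  by rewrite mulVf ?lt0r_neq0 // expr1n scale1r.
by apply: invertibleZ; [rewrite expf_neq0 // invr_neq0 // lt0r_neq0|exact: H].
Qed.

Definition ustar (u : U) : U := (u.1, star u.2).

Lemma ustarM (u v : U) : ustar (u * v) = ustar v * ustar u.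
Proof.
apply: injective_projections; first exact: mulrC.
by rewrite /= !starD !starZ starM [RHS]addrAC -addrA addrC -addrA addrC addrAC.
Qed.

Lemma ustarD (u v : U) : ustar (u + v) = ustar u + ustar v.
Proof. by apply: injective_projections => //=; rewrite starD. Qed.

Lemma ustarZ r (u : U) : ustar (r *: u) = r *: ustar u.
Proof. by apply: injective_projections => //=; rewrite starZ. Qed.

Lemma ustar1 : ustar 1 = 1.
Proof. by apply: injective_projections => //=; rewrite star0. Qed.

Lemma ustar_emb a : ustar (emb a) = emb (star a). Proof. by []. Qed.

Lemma ev_comm h p q : ev h p * ev h q = ev h q * ev h p.
Proof. by rewrite -!ev_mul mulrC. Qed.

Lemma ustar_ev h p : star h = h -> ustar (ev h p) = ev h p.
Proof.
move=> hh; elim/poly_ind: p => [|p c IH].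
  by rewrite rmorph0; apply: injective_projections => //=; rewrite star0.
rewrite rmorphD /= ustarD ev_mul horner_algC horner_algX ustarM IH ustarZ ustar1.
by rewrite ustar_emb hh; congr (_ + _); have := ev_comm h 'X p; rewrite horner_algX.
Qed.

(** [S] only has to contain the real spectrum. Real points suffice for selfadjoint [h], since
    [invertible_quadratic] disposes of conjugate pairs of nonreal ones. *)
Definition spectrum_in h (S : set R) := forall s, ~ S s -> invertible (emb h - s%:A : U).

(** Induction on the degree through a complex root of [p]. A real root lies outside [S] and splits
    off an invertible linear factor. A nonreal one splits off a quadratic: the remainder has degree
    at most 1 and real coefficients, so it cannot vanish there unless it is zero. *)
Lemma invertible_poly h (S : set R) p : star h = h -> spectrum_in h S ->
  p != 0 -> (forall s, S s -> p.[s] != 0) -> invertible (ev h p : U).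
Proof.
move=> hh hS; have [n] := ubnP (size p); elim: n p => [//|n IH] p /ltnSE sp p0 pS.
have [sp1|sp1] := leqP (size p) 1.
  rewrite (size1_polyC sp1) horner_algC; apply: invertibleZ; last exact: invertible1.
  by apply: contra_neq p0 => e; rewrite (size1_polyC sp1) e.
pose f : {rmorphism R -> R[i]%C} := real_complex R.
have /closed_rootP[z] : size (map_poly f p) != 1%N.
  by rewrite size_map_poly gtn_eqF.
have factor q p' : (1 < size q)%N -> p = p' * q -> invertible (ev h q : U) -> invertible (ev h p : U).
  move=> sq ep iq; rewrite ep ev_mul; apply: invertibleM => //.
  have q0 : q != 0 by rewrite -size_poly_gt0 ltnW.
  have p'0 : p' != 0 by apply: contra_neq p0; rewrite ep => ->; rewrite mul0r.
  apply: IH => // [|s Ss]; last first.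
    by have := pS s Ss; rewrite ep hornerM mulf_eq0 negb_or => /andP[].
  have := sp; rewrite ep size_mul //; case: (size q) sq => [|[|k]] // _.
  by rewrite !addnS; apply: leq_ltn_trans; exact: leq_addr.
case: z => a b; have [->|b0] := eqVneq b 0.
  rewrite (_ : Complex a 0 = f a) // fmorph_root => pa.
  have [p' ep] := factor_theorem p a pa.
  apply: (factor _ _ _ ep); first by rewrite size_XsubC.
  rewrite rmorphB /= horner_algX horner_algC; apply: hS => Sa.
  by have := pS a Sa; rewrite (rootP pa) eqxx.
move=> rz; pose q := ('X - a%:P) ^+ 2 + (b ^+ 2)%:P.
have sq : size q = 3%N.
  by rewrite size_polyDl ?size_exp_XsubC // size_polyC expf_neq0.
have q0 : q != 0 by rewrite -size_poly_gt0 sq.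
have qz : (map_poly f q).[Complex a b] = 0.
  rewrite rmorphD rmorphXn rmorphB /= map_polyX !map_polyC /= !hornerE.
  rewrite rmorphXn /=.
  by apply/eqP; rewrite eq_complex /=; apply/andP; split; apply/eqP; ring.
have ep := divp_eq p q.
have r0 : p %% q = 0.
  have sr : (size (p %% q)%R <= 2)%N by rewrite -ltnS -sq ltn_modp.
  have : (map_poly f (p %% q)).[Complex a b] = 0.
    by have := rz; rewrite /root {1}ep rmorphD rmorphM /= hornerD hornerM qz mulr0 add0r => /eqP.
  have er : p %% q = (p %% q)`_1 *: 'X + ((p %% q)`_0)%:P.
    apply/polyP => -[|[|i]]; rewrite !coefE ?mulr0 ?mulr1 ?add0r ?addr0 //.
    by rewrite nth_default // (leq_trans sr).
  rewrite er; move: (_`_1) (_`_0) => c d.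
  rewrite rmorphD /= map_polyZ map_polyX map_polyC /= !hornerE => /eqP.
  rewrite eq_complex /= !(mul0r, mulr0, subr0, addr0, add0r) => /andP[/eqP e1 /eqP e2].
  have c0 : c = 0 by apply/eqP; move/eqP: e2; rewrite mulf_eq0 (negPf b0) orbF.
  by move: e1; rewrite c0 mul0r add0r scale0r add0r => ->.
rewrite r0 addr0 in ep; apply: (factor _ _ _ ep); first by rewrite sq.
rewrite rmorphD rmorphXn rmorphB /= horner_algX !horner_algC.
exact: invertible_quadratic.
Qed.

Lemma quotient_inverse h (S : set R) q : star h = h -> spectrum_in h S ->
  S !=set0 -> (forall s, S s -> q.[s] != 0) ->
  exists v, [/\ ev h q * v = 1, v * ev h q = 1 &
    forall p, v * ev h p = ev h p * v].
Proof.
move=> hh hS [s0 Ss0] qS.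
have q0 : q != 0 by apply: contra_neq (qS _ Ss0) => ->; rewrite horner0.
have [v [qv vq]] := invertible_poly hh hS q0 qS.
exists v; split=> // p; apply: (inv_comm qv vq); exact: ev_comm.
Qed.

Lemma star_of_quotient h a (S : set R) p q : star h = h -> spectrum_in h S ->
  S !=set0 -> (forall s, S s -> q.[s] != 0) -> emb a * ev h q = ev h p -> star a = a.
Proof.
move=> hh hS S0 qS aqp; have [v [qv vq vc]] := quotient_inverse hh hS S0 qS.
have av : emb a = ev h p * v by rewrite -aqp -mulrA qv mulr1.
have := congr1 ustar aqp; rewrite ustarM ustar_emb !ustar_ev // => e.
by apply: emb_inj; rewrite [RHS]av -vc -e mulrA vq mul1r.
Qed.

(** This stands in for the functional calculus: $a=p(h)/q(h)$, so
    $M^2-a^2=(M^2q^2-p^2)(h)\,q(h)^{-2}$, and for $M>m$ the numerator is positive on [S]. *)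
Lemma norm_rational_le h a (S : set R) p q (m : R) : star h = h -> spectrum_in h S ->
  S !=set0 -> (forall s, S s -> q.[s] != 0) -> emb a * ev h q = ev h p ->
  (forall s, S s -> `|p.[s]| <= m * `|q.[s]|) -> `|a| <= m.
Proof.
move=> hh hS S0 qS aqp pq; have [s0 Ss0] := S0.
have m0 : 0 <= m.
  have := pq _ Ss0; have := normr_ge0 p.[s0]; have q0 := qS _ Ss0.
  by move=> h1 h2; have := le_trans h1 h2; rewrite pmulr_lge0 // normr_gt0.
have [v [qv vq vc]] := quotient_inverse hh hS S0 qS.
have av : emb a = ev h p * v by rewrite -aqp -mulrA qv mulr1.
have ac (p' : {poly R}) : emb a * ev h p' = ev h p' * emb a.
  by rewrite av -mulrA vc !mulrA ev_comm.
apply: norm_le_invertible => // [|M mM]; first exact: (star_of_quotient hh hS S0 qS aqp).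
pose N := (M ^+ 2) *: q ^+ 2 - p ^+ 2.
have NS s : S s -> 0 < N.[s].
  move=> Ss; rewrite /N hornerD hornerN hornerZ !horner_exp -exprMn subr_gt0.
  rewrite -[p.[s] ^+ 2]real_normK ?num_real //.
  rewrite -[(M * _) ^+ 2]real_normK ?num_real // ltrXn2r ?normr_ge0 //.
  apply: le_lt_trans (pq _ Ss) _; rewrite normrM ltr_pM2r ?normr_gt0 ?qS //.
  exact: lt_le_trans mM (ler_norm _).
have N0 : N != 0.
  by apply: contraTneq (NS _ Ss0) => ->; rewrite horner0 ltxx.
have iN : invertible (ev h N) by apply: (invertible_poly hh hS) => // s /NS/lt0r_neq0.
have eN : ev h N = ((M ^+ 2)%:A - emb (a ** a)) * (ev h q * ev h q).
  rewrite /N rmorphB /= ev_scale !expr2 !ev_mul -aqp mulrBl mulr_algl embM.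
  by congr (_ - _); rewrite -!mulrA; congr (_ * _); rewrite !mulrA -ac.
have -> : (M ^+ 2)%:A - emb (a ** a) = ev h N * (v * v).
  rewrite eN -!mulrA (mulrA (ev h q) v) qv mul1r qv mulr1 //.
apply: invertibleM => //; apply: invertibleM; by exists (ev h q).
Qed.

Lemma norm_poly_le h a (S : set R) p (m : R) : star h = h -> spectrum_in h S ->
  S !=set0 -> emb a = ev h p -> (forall s, S s -> `|p.[s]| <= m) -> `|a| <= m.
Proof.
move=> hh hS S0 ap pm.
apply: (@norm_rational_le h a S p 1 m) => // [s _||s Ss].
- by rewrite hornerE oner_neq0.
- by rewrite rmorph1 mulr1.
- by rewrite hornerE normr1 mulr1 pm.
Qed.

(** Negative numbers are excluded by the invertibility axiom, those above [L] by the Neumann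
    series. *)
Lemma spectrum_star a (L : R) : `|star a ** a| <= L ->
  spectrum_in (star a ** a) [set s | 0 <= s <= L].
Proof.
move=> aL s /= /negP; rewrite negb_and -!ltNge => /orP[s0|Ls].
  have := invertible_pos a (_ : 0 < - s); rewrite oppr_gt0 => /(_ s0).
  by rewrite scaleNr addrC.
have s0 : 0 < s by apply: le_lt_trans Ls; apply: le_trans aL.
have -> : emb (star a ** a) - s%:A = - s *: (1 - emb (s^-1 *: (star a ** a))) :> U.
  rewrite scalerBr !scaleNr opprK embZ scalerA mulfV ?lt0r_neq0 // scale1r.
  by rewrite addrC.
apply: invertibleZ; first by rewrite oppr_eq0 lt0r_neq0.
apply: invertible_neumann; rewrite normrZ gtr0_norm ?invr_gt0 //.
by rewrite ltr_pdivrMl // mulr1 (le_lt_trans aL).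
Qed.

Lemma star_amul_self a : star (star a ** a) = star a ** a.
Proof. by rewrite starM starK. Qed.

End PolynomialCalculus.

(** * Resolvents as approximate units *)

Section Resolvent.
Context (R : realType) (D : realCstarType R).
Implicit Types (a b e : D) (n : R).
Local Notation U := (unital D).
Local Notation ev u := (@horner_alg R U (emb u)).

(* [1 - e] is the inverse of [1 + n a^* a]. *)
Definition resolvent n a e := e = n *: (star a ** a - (star a ** a) ** e) /\
  emb e * ev (star a ** a) (1 + n%:P * 'X) = ev (star a ** a) (n%:P * 'X).

Lemma resolvent_exists n a : 0 < n -> exists e, resolvent n a e.
Proof.
move=> n0; set t := star a ** a.
have n1 : 0 < n^-1 by rewrite invr_gt0.
have := invertible_pos a n1; rewrite -/t => /(invertibleZ (lt0r_neq0 n0)).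
rewrite scalerDr scalerA mulfV ?lt0r_neq0 // scale1r => -[v [h1 h2]].
have e1 : ev t (1 + n%:P * 'X) = 1 + n *: emb t by exact: ev_linear.
have ee : emb (1 - v).2 = 1 - v.
  apply: emb_snd; rewrite /=; have := congr1 fst h1.
  rewrite unital_fst_mul /= (@scaler0 R R^o) addr0 mul1r => ->.
  by rewrite subrr.
move: (1 - v).2 ee => e ee; exists e; split; last first.
  rewrite ee e1 mulrBl mul1r h2 addrC addKr ev_mul horner_algC horner_algX.
  by rewrite mulr_algl.
apply: emb_inj; rewrite embZ embB (embM t e) ee mulrBr mulr1 opprB addrCA subrr addr0.
by apply/eqP; rewrite subr_eq addrC -{1}h1 mulrDl mul1r scalerAl.
Qed.

Lemma resolvent_pow n a e k : 0 < n -> resolvent n a e -> exists2 E,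
  emb E * ev (star a ** a) ((1 + n%:P * 'X) ^+ k) =
    ev (star a ** a) ((1 + n%:P * 'X) ^+ k - 1) &
  1 - emb E = (1 - emb e) ^+ k.
Proof.
move=> n0 [_ re]; elim: k => [|k [E E1 E2]].
  by exists 0; rewrite emb0 ?mul0r ?subr0 // expr0 subrr rmorph0.
exists (E + e - E ** e); last first.
  rewrite exprSr -E2 embB embD embM mulrBl mul1r mulrBr mulr1.
  by rewrite !opprD !opprK !addrA; congr (_ + _); exact: addrAC.
have -> : emb (E + e - E ** e) = emb E + emb e - emb E * emb e by rewrite embB embD embM.
set q := 1 + n%:P * 'X.
have e3 : emb e * ev (star a ** a) q = ev (star a ** a) (q - 1).
  by rewrite re /q addrC addKr.
have h1 : emb E * ev (star a ** a) (q ^+ k.+1) = ev (star a ** a) ((q ^+ k - 1) * q).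
  by rewrite exprSr !ev_mul mulrA E1.
have h2 : emb e * ev (star a ** a) (q ^+ k.+1) = ev (star a ** a) ((q - 1) * q ^+ k).
  by rewrite exprS !ev_mul mulrA e3.
have h3 : emb E * emb e * ev (star a ** a) (q ^+ k.+1) =
    ev (star a ** a) ((q ^+ k - 1) * (q - 1)).
  by rewrite -mulrA h2 mulrC !ev_mul mulrA E1.
rewrite mulrBl mulrDl h1 h2 h3 -rmorphD -rmorphB /= exprS; congr (ev _ _); ring.
Qed.

(** If $r_0=1+d$ with $d>0$, then $r_k\ge 1+2^kd$ by repeated squaring, which passes 2. *)
Lemma iterated_square_le1 (r : nat -> R) : (forall k, 0 <= r k <= 2) ->
  (forall k, r k ^+ 2 <= r k.+1) -> r 0%N <= 1.
Proof.
move=> r2 rr; rewrite leNgt; apply/negP => r1; pose d := r 0%N - 1.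
have d0 : 0 < d by rewrite subr_gt0.
have H k : 1 + 2 ^+ k * d <= r k.
  elim: k => [|k IH]; first by rewrite mul1r /d addrC subrK.
  apply: le_trans (rr k); have := mulr_gt0 (exprn_gt0 k (ltr0n R 2)) d0.
  rewrite exprS -mulrA; move: (_ * d) IH => x IH x0.
  apply: (@le_trans _ _ ((1 + x) ^+ 2)).
    by rewrite sqrrD expr1n mul1r mulr_natl lerDl sqr_ge0.
  by rewrite lerXn2r // nnegrE; have := r2 k; lra.
pose k := (Num.truncn d^-1).+1.
have : 1 < 2 ^+ k * d.
  rewrite -ltr_pdivrMr // mul1r; apply: lt_le_trans (truncnS_gt _) _.
  by rewrite -natrX ler_nat ltnW // ltn_expl.
by have := H k; have := r2 k; lra.
Qed.

(** Since $1-e$ is not an element of [D], its norm is reached by squaring: by the C*-identity,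
    $\|b(1-e)^{2^k}\|^2\le\|b(1-e)^{2^{k+1}}\|\,\|b\|$. The ratios to $\|b\|$ stay below 2 because
    $1-(1-e)^{2^k}$ has norm at most 1, so [iterated_square_le1] applies. *)
Lemma resolvent_contraction n a e b : 0 < n -> resolvent n a e -> `|b - b ** e| <= `|b|.
Proof.
move=> n0 re.
have pow k : exists E, [/\ `|E| <= 1, 1 - emb E = (1 - emb e) ^+ k & star E = E].
  have [E E1 E2] := resolvent_pow k n0 re; exists E.
  pose S := [set s : R | 0 <= s <= `|star a ** a|].
  have qS s : S s -> 1 <= 1 + n * s.
    by move=> /= /andP[s0 _]; rewrite lerDl mulr_ge0 // ltW.
  have tS := spectrum_star (lexx `|star a ** a|).
  have S0 : S !=set0 by exists 0; rewrite /S /= lexx normr_ge0.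
  have qS0 s : S s -> ((1 + n%:P * 'X) ^+ k).[s] != 0.
    by move=> /qS qs; rewrite horner_exp !hornerE expf_neq0 // lt0r_neq0 //; lra.
  split=> //; last exact: star_of_quotient (star_amul_self a) tS S0 qS0 E1.
  apply: (norm_rational_le (star_amul_self a) tS S0 qS0 E1) => s /qS qs.
  rewrite mul1r !(hornerE, horner_exp).
  have h : 1 <= (1 + n * s) ^+ k by apply: exprn_ege1.
  by rewrite !ger0_norm; lra.
pose E k := xget (0 : D) [set E | [/\ `|E| <= 1, 1 - emb E = (1 - emb e) ^+ (2 ^ k) & star E = E]].
have EP k : [/\ `|E k| <= 1, 1 - emb (E k) = (1 - emb e) ^+ (2 ^ k) & star (E k) = E k].
  by have [x xP] := pow (2 ^ k)%N; rewrite /E; case: xgetP => [y _ //|/(_ x)].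
have [->|b0] := eqVneq b 0; first by rewrite amul0l subr0.
have nb0 : 0 < `|b| by rewrite normr_gt0.
pose r k := `|b - b ** E k| / `|b|.
have E0 : E 0%N = e.
  apply: emb_inj; have [_ h _] := EP 0%N; apply/eqP.
  by rewrite -(inj_eq (@oppr_inj _)) -(inj_eq (@addrI _ 1)) h expr1.
suff : r 0%N <= 1 by rewrite /r E0 ler_pdivrMr // mul1r.
apply: iterated_square_le1 => k.
  have [h1 _ _] := EP k; rewrite divr_ge0 //= ler_pdivrMr //.
  have := ler_normB b (b ** E k); have := normr_amul b (E k).
  have := ler_wpM2l (normr_ge0 b) h1; lra.
have [_ h2 h3] := EP k; have [_ h4 _] := EP k.+1.
have sq : (b - b ** E k) ** star (b - b ** E k) = (b - b ** E k.+1) ** star b.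
  have h5 : E k.+1 = E k + E k - E k ** E k.
    apply: emb_inj; apply/eqP.
    rewrite -(inj_eq (@oppr_inj _)) -(inj_eq (@addrI _ 1)) h4 expnS mul2n -addnn exprD -h2.
    rewrite embB embD embM mulrBl mul1r mulrBr mulr1 !opprD !opprK.
    by rewrite !addrA eqxx.
  rewrite starB starM h3 h5 !(amulBr, amulBl, amulDr, amulDl) !amulA.
  by rewrite !opprD !opprK !addrA.
rewrite /r expr_div_n ler_pdivrMr ?exprn_gt0 // [X in _ <= _ * X]expr2 mulrA.
rewrite divfK ?lt0r_neq0 //.
rewrite -[X in X ^+ 2]norm_star -cstar_identity starK sq.
by apply: le_trans (normr_amul _ _) _; rewrite norm_star.
Qed.

Lemma resolvent_star n a e : 0 < n -> resolvent n a e -> star e = e.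
Proof.
move=> n0 [_ re].
apply: (star_of_quotient (star_amul_self a) (spectrum_star (lexx _)) _ _ re).
  by exists 0; rewrite /= lexx normr_ge0.
move=> s /= /andP[s0 _]; rewrite !hornerE lt0r_neq0 //.
by rewrite ltr_pwDl // mulr_ge0 // ltW.
Qed.

Lemma resolvent_contractionl n a e b : 0 < n -> resolvent n a e ->
  `|b - e ** b| <= `|b|.
Proof.
move=> n0 re; rewrite -[leLHS]norm_star -[leRHS]norm_star starB starM.
by rewrite (resolvent_star n0 re); exact: (resolvent_contraction _ n0 re).
Qed.

(** For $x=a-ae$ and $t=a^*a$, $x^*x$ is the rational expression $t/(1+nt)^2$, which is at most
    $1/n$ for $t\ge0$. *)
Lemma resolvent_approx n a e : 0 < n -> resolvent n a e -> `|a - a ** e| ^+ 2 <= n^-1.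
Proof.
move=> n0 rP; have ee := resolvent_star n0 rP; have [_ re] := rP; set t := star a ** a in re *.
pose S := [set s : R | 0 <= s <= `|t|].
have tS := spectrum_star (lexx `|star a ** a|); rewrite -/t -/S in tS.
have tt : star t = t by exact: star_amul_self.
have qS s : S s -> 1 <= 1 + n * s.
  by move=> /= /andP[s0 _]; rewrite lerDl mulr_ge0 // ltW.
have qS0 s : S s -> (1 + n%:P * 'X).[s] != 0.
  by move=> /qS qs; rewrite !hornerE lt0r_neq0 //; lra.
have S0 : S !=set0 by exists 0; rewrite /S /= lexx normr_ge0.
rewrite -cstar_identity.
pose c := star (a - a ** e) ** (a - a ** e).
have ec : emb c = (1 - emb e) * emb t * (1 - emb e).
  have -> : c = t - t ** e - (e ** t - e ** t ** e).
    by rewrite /c /t starB starM ee amulBl !amulBr !amulA.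
  move: (t) => x; rewrite !embB !embM mulrBl mul1r mulrBr mulr1 mulrBl !opprB.
  by rewrite addrACA [RHS]addrACA; congr (_ + _); exact: addrC.
have e1 : (1 - emb e) * ev t (1 + n%:P * 'X) = 1.
  by rewrite mulrBl mul1r re -rmorphB /= addrK rmorph1.
apply: (@norm_rational_le _ _ _ c S 'X ((1 + n%:P * 'X) ^+ 2) _ tt tS S0).
- by move=> s /qS0 qs; rewrite horner_exp expf_neq0.
- rewrite ec expr2 ev_mul mulrA -(mulrA _ (1 - _)) e1 mulr1 -mulrA.
  have := ev_comm t 'X (1 + n%:P * 'X); rewrite horner_algX => ->.
  by rewrite mulrA e1 mul1r.
move=> s Ss; have qs := qS s Ss; have /= /andP[s0 _] := Ss.
rewrite horner_exp !hornerE [leLHS]ger0_norm // [X in _ * X]ger0_norm ?sqr_ge0 //.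
rewrite ler_pdivlMl // sqrrD expr1n mul1r.
have := sqr_ge0 (n * s); have := mulr_ge0 (ltW n0) s0; rewrite mulr2n; lra.
Qed.

End Resolvent.

(** * Closed ideals are selfadjoint *)

Section SelfadjointIdeals.
Context (R : realType) (B : realCstarType R) (J : closed_ideal B).
Implicit Types (a b x y : B).

Lemma closed_approx (V : normedModType R) (S : set V) v : closed S ->
  (forall e : R, 0 < e -> exists2 w, S w & `|v - w| <= e) -> S v.
Proof.
move=> Sc Sv; apply: Sc => N /nbhs_ballP[e /= e0 Ne].
have e20 : 0 < e / 2 by rewrite divr_gt0.
have [w Sw vw] := Sv _ e20.
exists w; split=> //; apply: Ne; rewrite -ball_normE /=; lra.
Qed.

Lemma idealN x : ideal_set J x -> ideal_set J (- x).
Proof. by move=> Jx; rewrite -scaleN1r; exact: idealZ. Qed.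

Lemma idealB x y : ideal_set J x -> ideal_set J y -> ideal_set J (x - y).
Proof. by move=> Jx Jy; apply: idealD => //; exact: idealN. Qed.

Lemma resolvent_ideal n a e : resolvent n a e -> ideal_set J a -> ideal_set J e.
Proof.
move=> [-> _] Ja; apply/idealZ/idealB; first exact: idealMl.
by apply: idealMr; exact: idealMl.
Qed.

(** The resolvent $r$ of $x$ lies in the ideal and is selfadjoint, so $rx^*=(xr)^*$ belongs to the
    ideal as well and tends to $x^*$. *)
Lemma ideal_star x : ideal_set J x -> ideal_set J (star x).
Proof.
move=> Jx; apply: (closed_approx (@ideal_closed _ _ J)) => e e0.
have n0 : 0 < e ^- 2 by rewrite invr_gt0 exprn_gt0.
have [r rP] := resolvent_exists x n0.
exists (star (x ** r)).
  by rewrite starM (resolvent_star n0 rP); apply: idealMr; exact: resolvent_ideal rP Jx.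
rewrite -starB norm_star -(@ler_sqr R) ?nnegrE ?(ltW e0) //.
by apply: le_trans (resolvent_approx n0 rP) _; rewrite invrK.
Qed.

End SelfadjointIdeals.

(** * Quotients as real C*-algebras *)

Section QuotientNorm.
Context (R : realType) (B : realCstarType R) (J : closed_ideal B).
Implicit Types (x y : quot J) (a b : B).

Definition quot_norm x : R := inf [set `|b| | b in [set b | quot_pi J b = x]].

Let norms_inf x : has_inf [set `|b| | b in [set b | quot_pi J b = x]].
Proof.
split; first by exists `|quot_repr x|, (quot_repr x) => //; exact: quot_reprK.
by exists 0 => _ [b _ <-].
Qed.

Lemma quot_norm_pi_le b : quot_norm (quot_pi J b) <= `|b|.
Proof. by apply: ge_inf; [exact: (norms_inf _).2|exists b]. Qed.

Lemma quot_norm_lift x (e : R) : 0 < e ->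
  exists2 b, quot_pi J b = x & `|b| < quot_norm x + e.
Proof.
move=> e0; have [_ [b bx <-] lt] := inf_adherent e0 (norms_inf x).
by exists b.
Qed.

Lemma quot_normD x y : quot_norm (x + y) <= quot_norm x + quot_norm y.
Proof.
apply/ler_addgt0Pr => e e0; have e20 : 0 < e / 2 by rewrite divr_gt0.
have [a ax an] := quot_norm_lift x e20; have [b yb bn] := quot_norm_lift y e20.
rewrite -ax -yb -quot_piD ax yb; apply: le_trans (quot_norm_pi_le _) _.
by have := ler_normD a b; lra.
Qed.

Lemma quot_normZ (k : R) x : quot_norm (k *: x) = `|k| * quot_norm x.
Proof.
have le l y : quot_norm (l *: y) <= `|l| * quot_norm y.
  apply/ler_addgt0Pr => e e0; have l1 : 0 < `|l| + 1 by rewrite ltr_wpDl.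
  have [b yb bn] := quot_norm_lift y (divr_gt0 e0 l1).
  rewrite -{1}yb -quot_piZ; apply: le_trans (quot_norm_pi_le _) _.
  rewrite normrZ; apply: le_trans (ler_wpM2l (normr_ge0 _) (ltW bn)) _.
  rewrite mulrDr lerD2l mulrCA ler_piMr ?(ltW e0) // ler_pdivrMr // mul1r.
  by rewrite lerDl.
apply/le_anti; rewrite le /=.
have [->|k0] := eqVneq k 0.
  rewrite normr0 mul0r; apply: lb_le_inf; first exact: (norms_inf _).1.
  by move=> _ [b _ <-].
rewrite -ler_pdivlMl ?normr_gt0 // -normfV.
by rewrite -[X in quot_norm X <= _]scale1r -(mulVf k0) -scalerA le.
Qed.

Lemma quot_norm0_eq0 x : quot_norm x = 0 -> x = 0.
Proof.
move=> x0; rewrite -[x]quot_reprK; apply/eqP.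
have -> : 0 = quot_pi J 0 by rewrite -[0 in RHS](subrr 0) quot_piB subrr.
apply/eqP/quot_piP; rewrite subr0; apply/idealP.
apply: (closed_approx (@ideal_closed _ _ J)) => e e0.
have [b bx] := quot_norm_lift x e0; rewrite x0 add0r => be.
exists (quot_repr x - b); last by rewrite subKr ltW.
by apply/idealP/quot_piP; rewrite quot_reprK.
Qed.

HB.instance Definition _ :=
  Lmodule_isNormed.Build R (quot J) quot_normD quot_normZ quot_norm0_eq0.

Lemma quot_normE x : `|x| = quot_norm x. Proof. by []. Qed.

Lemma norm_quot_pi_le b : `|quot_pi J b| <= `|b|. Proof. exact: quot_norm_pi_le. Qed.

(** Points that follow the filter with error $2^{-n}$ have geometric increments. These are lifted
    with almost minimal norm, and the lifts sum to a convergent sequence in [B]. *)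
Lemma quot_complete (F : set_system (quot J)) : ProperFilter F -> cauchy F -> cvg F.
Proof.
move=> FF /cauchy_ballP Fc.
have pick n : exists x, \forall y \near F, `|x - y| <= (2 : R)^-1 ^+ n.
  have p0 : 0 < (2 : R)^-1 ^+ n by rewrite exprn_gt0 // invr_gt0.
  have [[P Q] [FP FQ] PQ] := Fc _ p0.
  have [x Px] := filter_ex FP; exists x; apply: filterS FQ => y Qy.
  by have := PQ (x, y) (conj Px Qy); rewrite -ball_normE /= => /ltW.
have [x xP] := choice pick.
have step n : exists c, quot_pi J c = x n.+1 - x n /\ `|c| <= 3 * 2^-1 ^+ n.
  have [y [y1 y2]] := filter_ex (filterI (xP n) (xP n.+1)).
  have p0 : 0 < (2 : R)^-1 ^+ n by rewrite exprn_gt0 // invr_gt0.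
  have [c cx cn] := quot_norm_lift (x n.+1 - x n) p0; exists c; split=> //.
  have := ler_normD (x n.+1 - y) (y - x n); rewrite addrA subrK -quot_normE in cn *.
  have := y1; rewrite distrC; move: y2; rewrite exprS; lra.
have [c cP] := choice step.
pose b n := quot_repr (x 0%N) + \sum_(i < n) c i.
have bx n : quot_pi J (b n) = x n.
  elim: n => [|n IH]; first by rewrite /b big_ord0 addr0 quot_reprK.
  rewrite /b big_ord_recr /= addrA quot_piD -/(b n) IH (cP n).1 addrC subrK //.
have /cvg_ex[l bl] : cvgn b.
  apply: (@cvg_geometric_increments _ _ _ 3 2^-1); first lra.
  by move=> n; rewrite /b big_ord_recr /= opprD addrACA subrr add0r addrAC subrr add0r (cP n).2.
apply/cvg_ex; exists (quot_pi J l); apply/cvgrPdist_le => e e0.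
have e20 : 0 < e / 2 by rewrite divr_gt0.
have h1 : \forall n \near \oo, `|l - b n| <= e / 2 by move/cvgrPdist_le: bl; apply.
have h2 : \forall n \near \oo, (2 : R)^-1 ^+ n <= e / 2.
  have : (fun n => (2 : R)^-1 ^+ n) @ \oo --> (0 : R).
    by apply: cvg_expr; rewrite ger0_norm ?invr_ge0 // invf_lt1 // ltr1n.
  move/cvgr0Pnorm_le => /(_ _ e20); apply: filterS => n.
  by apply: le_trans; rewrite ler_norm.
have [n [n1 n2]] := filter_ex (filterI h1 h2).
apply: filterS (xP n) => y xy.
have := ler_normD (quot_pi J l - x n) (x n - y); rewrite addrA subrK.
have := norm_quot_pi_le (l - b n); rewrite quot_piB bx; lra.
Qed.

HB.instance Definition _ := Uniform_isComplete.Build (quot J) quot_complete.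

Lemma quot_star_piE b : star (quot_pi J b) = quot_pi J (star b).
Proof. by apply: quot_star_pi => y; exact: ideal_star. Qed.

Lemma quot_mul_piE a b : quot_pi J a ** quot_pi J b = quot_pi J (a ** b).
Proof. exact: quot_mul_pi. Qed.

Lemma quot_normM x y : `|x ** y| <= `|x| * `|y|.
Proof.
apply/ler_addgt0Pr => e e0.
pose m := `|x| + `|y| + 1.
have m0 : 0 < m by rewrite ltr_wpDl // addr_ge0.
pose d := Num.min 1 (e / m).
have d0 : 0 < d by rewrite lt_min ltr01 divr_gt0.
have [a ax an] := quot_norm_lift x d0; have [b yb bn] := quot_norm_lift y d0.
rewrite -{1}ax -{1}yb quot_mul_piE; apply: le_trans (norm_quot_pi_le _) _.
apply: le_trans (normr_amul _ _) _.
apply: (@le_trans _ _ ((`|x| + d) * (`|y| + d))).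
  by apply: ler_pM => //; exact: ltW.
have -> : (`|x| + d) * (`|y| + d) = `|x| * `|y| + d * (`|x| + `|y| + d) by ring.
rewrite lerD2l; apply: (@le_trans _ _ (d * m)).
  by rewrite ler_pM2l // /m lerD2l /d ge_min lexx.
by rewrite -ler_pdivlMr // /d ge_min lexx orbT.
Qed.

Lemma quot_starD : {morph (star : quot J -> quot J) : x y / x + y}.
Proof.
move=> x y; rewrite -[x]quot_reprK -[y]quot_reprK.
by rewrite -quot_piD !quot_star_piE starD quot_piD.
Qed.

Lemma quot_starZ (k : R) x : star (k *: x) = k *: star x.
Proof.
by rewrite -[x]quot_reprK -quot_piZ !quot_star_piE starZ quot_piZ.
Qed.

Lemma quot_starM x y : star (x ** y) = star y ** star x.
Proof.
rewrite -[x]quot_reprK -[y]quot_reprK.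
by rewrite quot_mul_piE !quot_star_piE starM quot_mul_piE.
Qed.

Lemma quot_starK : involutive (star : quot J -> quot J).
Proof. by move=> x; rewrite -[x]quot_reprK !quot_star_piE starK. Qed.

Lemma norm_quot_star x : `|star x| <= `|x|.
Proof.
apply/ler_addgt0Pr => e e0; have [b bx bn] := quot_norm_lift x e0.
rewrite -{1}bx quot_star_piE; apply: le_trans (norm_quot_pi_le _) _.
by rewrite norm_star ltW.
Qed.

Lemma quot_cstar_invertible x : unit_invertible ((1, star x ** x) : unitization (quot J)).
Proof.
rewrite -[x]quot_reprK quot_star_piE quot_mul_piE.
have /unit_invertibleP[b [h1 h2]] := cstar_invertible (quot_repr x).
apply/unit_invertibleP; exists (quot_pi J b).
have pi0 : quot_pi J 0 = 0 by rewrite -[0 in LHS](subrr 0) quot_piB subrr.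
by split; rewrite quot_mul_piE -!quot_piD ?h1 ?h2.
Qed.

(* [1 - e] for [e] in the ideal is a contraction that nearly annihilates a given
   element of the ideal, hence computes the norm of the quotient. *)
Lemma quot_cstar_identity x : `|star x ** x| = `|x| ^+ 2.
Proof.
apply/le_anti/andP; split.
  apply: le_trans (quot_normM _ _) _; rewrite expr2 ler_wpM2r //.
  exact: norm_quot_star.
apply/ler_addgt0Pr => e e0; have e20 : 0 < e / 2 by rewrite divr_gt0.
have [b bx] : exists b, quot_pi J b = x by exists (quot_repr x); exact: quot_reprK.
have [c cx cn] := quot_norm_lift (star x ** x) e20.
pose j := star b ** b - c.
have Jj : ideal_set J j.
  by apply/idealP/quot_piP; rewrite cx -quot_mul_piE -quot_star_piE bx.
have n0 : 0 < (e / 2) ^- 2 by rewrite invr_gt0 exprn_gt0.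
have [r rP] := resolvent_exists j n0.
have Jr := resolvent_ideal rP Jj.
have jr : `|j - j ** r| <= e / 2.
  rewrite -(@ler_sqr R) ?nnegrE ?(ltW e20) //.
  by apply: le_trans (resolvent_approx n0 rP) _; rewrite invrK.
have ex : x = quot_pi J (b - b ** r).
  by rewrite -bx; apply/quot_piP; rewrite subKr; apply/idealP/idealMl.
apply: (@le_trans _ _ (`|b - b ** r| ^+ 2)).
  by rewrite {1}ex lerXn2r ?nnegrE // norm_quot_pi_le.
rewrite -cstar_identity.
have rr := resolvent_star n0 rP.
(* This is $(1-r)c(1-r)+(1-r)j(1-r)$; by the contraction lemmas the summands have norms at most
   $\|c\|$ and $\|j-jr\|$. *)
have -> : star (b - b ** r) ** (b - b ** r) =
    (c - c ** r - r ** (c - c ** r)) + (j - j ** r - r ** (j - j ** r)).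
  rewrite addrACA -opprD -amulDr addrACA -opprD -amulDl /j addrC.
  rewrite [c + _]addrC subrK starB starM rr amulBl !amulBr !amulA.
  by rewrite [LHS]addrC.
apply: le_trans (ler_normD _ _) _.
have h1 := resolvent_contractionl (c - c ** r) n0 rP.
have h2 := resolvent_contractionl (j - j ** r) n0 rP.
have h3 := resolvent_contraction c n0 rP.
by rewrite -quot_normE in cn; lra.
Qed.

HB.instance Definition _ := isRealCstar.Build R (quot J) quot_normM quot_starD quot_starZ
  quot_starM quot_starK quot_cstar_identity quot_cstar_invertible.

End QuotientNorm.

(** * Homomorphisms and their contractivity *)

Section StarHoms.
Context (R : realType).

Section Linear.
Context (V W : lmodType R) (f : V -> W).
Hypothesis fl : forall k x y, f (k *: x + y) = k *: f x + f y.

Lemma linear_add x y : f (x + y) = f x + f y.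
Proof. by have := fl 1 x y; rewrite !scale1r. Qed.

Lemma linear_scale k x : f (k *: x) = k *: f x.
Proof.
have f0 : f 0 = 0 by apply: (@addrI _ (f 0)); rewrite -linear_add !addr0.
by have := fl k x 0; rewrite f0 !addr0.
Qed.

End Linear.

Section Algebra.
Context (A D : preStarAlgType R) (f : A -> D) (fh : star_hom f).

Lemma homD a b : f (a + b) = f a + f b.
Proof. by case: fh => fl _ _; exact: linear_add. Qed.

Lemma homZ (k : R) a : f (k *: a) = k *: f a.
Proof. by case: fh => fl _ _; exact: linear_scale. Qed.

Lemma hom0 : f 0 = 0.
Proof. by have := homZ 0 0; rewrite !scale0r. Qed.

Lemma homN a : f (- a) = - f a.
Proof. by rewrite -scaleN1r homZ scaleN1r. Qed.

Lemma homB a b : f (a - b) = f a - f b.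
Proof. by rewrite homD homN. Qed.

Lemma homM a b : f (a ** b) = f a ** f b. Proof. by case: fh. Qed.

Lemma hom_star a : f (star a) = star (f a). Proof. by case: fh. Qed.

End Algebra.

Lemma star_hom_comp (A B D : preStarAlgType R) (f : A -> B) (g : B -> D) :
  star_hom f -> star_hom g -> star_hom (g \o f).
Proof.
move=> fh gh; split=> [k a b|a b|a] /=.
- by rewrite (homD fh) (homZ fh) (homD gh) (homZ gh).
- by rewrite (homM fh) (homM gh).
- by rewrite (hom_star fh) (hom_star gh).
Qed.

Section Contractive.
Context (A D : realCstarType R) (f : A -> D) (fh : star_hom f).

(** For selfadjoint $t$ and $M>\|t\|$, the quasi-inverse of $-t^2/M^2$ is carried to one of its
    image, so $M^2-f(t)^2$ is invertible and [norm_le_invertible] applies. The C*-identity reduces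
    the general case to $a^*a$. *)
Lemma norm_hom_le a : `|f a| <= `|a|.
Proof.
have self t : star t = t -> `|f t| <= `|t|.
  move=> tt; apply: norm_le_invertible => // [|M tM].
    by rewrite -(hom_star fh) tt.
  have M0 : 0 < M by apply: le_lt_trans tM.
  have M20 : 0 < M ^+ 2 by rewrite exprn_gt0.
  have : invertible (1 - emb ((M ^- 2) *: (t ** t))).
    apply: invertible_neumann; rewrite normrZ selfadj_normM //.
    rewrite ger0_norm ?invr_ge0 ?sqr_ge0 // ltr_pdivrMl // mulr1.
    by rewrite ltrXn2r ?nnegrE // ltW.
  rewrite -embN => /invertible1Demb[b [h1 h2]].
  have : invertible (1 + emb (f (- ((M ^- 2) *: (t ** t))))).
    apply/invertible1Demb; exists (f b).
    by split; rewrite -(homM fh) -!(homD fh) ?h1 ?h2 (hom0 fh).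
  move=> /(invertibleZ (lt0r_neq0 M20)).
  rewrite (homN fh) (homZ fh) (homM fh) embN embZ scalerDr scalerN scalerA.
  by rewrite mulfV ?scale1r // lt0r_neq0.
rewrite -(@ler_sqr R) ?nnegrE // -!cstar_identity -(hom_star fh) -(homM fh).
by apply: self; exact: star_amul_self.
Qed.

Lemma hom_cvg (u : nat -> A) a : u @ \oo --> a -> (fun n => f (u n)) @ \oo --> f a.
Proof.
move=> /cvgrPdist_le ua; apply/cvgrPdist_le => e /ua; apply: filterS => n.
by apply: le_trans; rewrite -(homB fh); exact: norm_hom_le.
Qed.

End Contractive.

Section QuotientHoms.
Context (B : realCstarType R).

Lemma quot_pi_hom (J : closed_ideal B) : star_hom (quot_pi J).
Proof.
split=> [k a b|a b|a]; first by rewrite quot_piD quot_piZ.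
  by rewrite quot_mul_piE.
by rewrite quot_star_piE.
Qed.

Lemma quot_map_hom (I J : closed_ideal B) : I `<=` J -> star_hom (@quot_map R B I J).
Proof.
move=> IJ; split=> [k x y|x y|x].
- rewrite -[x]quot_reprK -[y]quot_reprK -quot_piZ -quot_piD !quot_map_pi //.
  by rewrite quot_piD quot_piZ.
- rewrite -[x]quot_reprK -[y]quot_reprK quot_mul_piE !quot_map_pi //.
  by rewrite quot_mul_piE.
- by rewrite -[x]quot_reprK quot_star_piE !quot_map_pi // quot_star_piE.
Qed.

Lemma quot_pi_eq0 (J : closed_ideal B) b : quot_pi J b = 0 <-> ideal_set J b.
Proof.
have -> : 0 = quot_pi J 0 by rewrite (hom0 (quot_pi_hom J)).
split=> [/quot_piP/idealP|Jb]; rewrite ?subr0 //.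
by apply/quot_piP/idealP; rewrite subr0.
Qed.

Lemma quot_pi_surj (J : closed_ideal B) x : exists b, quot_pi J b = x.
Proof. by exists (quot_repr x); exact: quot_reprK. Qed.

Lemma norm_quot_pi_small (J : nat -> closed_ideal B) (Joo : closed_ideal B) b (e : R) :
  (forall n, J n `<=` J n.+1) -> Joo = closure (\bigcup_n J n) :> set B ->
  ideal_set Joo b -> 0 < e -> exists n, forall m, (n <= m)%N -> `|quot_pi (J m) b| <= e.
Proof.
move=> JS JooE Jb e0.
have JM n m : (n <= m)%N -> J n `<=` J m.
  move=> /subnK <-; elim: (m - n)%N => [//|k IH]; exact: subset_trans IH (JS _).
have : closure (\bigcup_n J n) b by rewrite -JooE.
move=> /(_ _ (nbhsx_ballx b e e0))[x [[n _ Jx]]]; rewrite -ball_normE /= => bx.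
exists n => m nm; have <- : quot_pi (J m) (b - x) = quot_pi (J m) b.
  by rewrite quot_piB (quot_pi_eq0 _ x).2 ?subr0 //; exact: JM nm _ Jx.
by apply: le_trans (norm_quot_pi_le _ _) (ltW _).
Qed.

Lemma ideal_bigcup_sub (J : nat -> closed_ideal B) (Joo : closed_ideal B) n :
  Joo = closure (\bigcup_n J n) :> set B -> J n `<=` Joo.
Proof.
by move=> JooE x Jx; rewrite JooE; apply: subset_closure; exists n.
Qed.

End QuotientHoms.
End StarHoms.

(** * The algebra [D[j]], Newton's iteration and its limit *)

Section Twisted.
Context (R : realType) (D : realCstarType R) (s : bool).
Local Notation sg := ((-1) ^+ s : R).

(* [D[j]] with [j] central and [j^2 = - (-1)^s]. *)
Definition twisted_of (t : bool) : Type := (D * D)%type.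
Local Notation twisted := (twisted_of s).

HB.instance Definition _ := GRing.Lmodule.copy twisted (D * D)%type.

Definition twisted_mul (u v : twisted) : twisted :=
  (u.1 ** v.1 - sg *: (u.2 ** v.2), u.1 ** v.2 + u.2 ** v.1).

Lemma twisted_mulA : associative twisted_mul.
Proof.
move=> [a b] [c d] [x y]; rewrite /twisted_mul /=; congr pair.
  rewrite !(amulBr, amulBl, amulDr, amulDl) !(amulZl, amulZr) !amulA !scalerDr.
  by rewrite !opprD !addrA [LHS](ACl (1*4*2*3)).
rewrite !(amulBr, amulBl, amulDr, amulDl) !(amulZl, amulZr) !amulA.
by rewrite !addrA [LHS](ACl (1*4*2*3)).
Qed.

Lemma twisted_mulDl : left_distributive twisted_mul +%R.
Proof.
move=> [a b] [c d] [x y]; rewrite /twisted_mul /=; congr pair.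
  by rewrite !amulDl scalerDr opprD addrACA.
by rewrite !amulDl addrACA.
Qed.

Lemma twisted_mulDr : right_distributive twisted_mul +%R.
Proof.
move=> [a b] [c d] [x y]; rewrite /twisted_mul /=; congr pair.
  by rewrite !amulDr scalerDr opprD addrACA.
by rewrite !amulDr addrACA.
Qed.

Lemma twisted_mulZl (k : R) (u v : twisted) : twisted_mul (k *: u) v = k *: twisted_mul u v.
Proof.
case: u v => [a b] [c d]; apply: injective_projections; rewrite /= !amulZl.
  by rewrite scalerBr !scalerA [k * _]mulrC.
by rewrite scalerDr.
Qed.

Lemma twisted_mulZr (k : R) (u v : twisted) : twisted_mul u (k *: v) = k *: twisted_mul u v.
Proof.
case: u v => [a b] [c d]; apply: injective_projections; rewrite /= !amulZr.
  by rewrite scalerBr !scalerA [k * _]mulrC.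
by rewrite scalerDr.
Qed.

HB.instance Definition _ := isNUAlgebra.Build R twisted twisted_mulA twisted_mulDl
  twisted_mulDr twisted_mulZl twisted_mulZr.

(* For [t = s] this is the linear extension of [star] fixing [j], up to the sign of [j^2];
   for [t = ~~ s] it is the involution of [D[j]]. *)
Definition twisted_star (t : bool) (u : twisted) : twisted :=
  (star u.1, (-1) ^+ t *: star u.2).

Lemma twisted_starM t u v :
  twisted_star t (u ** v) = twisted_star t v ** twisted_star t u.
Proof.
case: u v => [a b] [c d]; apply: injective_projections; rewrite /= /twisted_star.
  rewrite starB starZ !starM amulZl amulZr scalerA -!signr_addb addbb scale1r //.
by rewrite starD !starM scalerDr amulZl amulZr addrC.
Qed.

Lemma twisted_starD t u v :
  twisted_star t (u + v) = twisted_star t u + twisted_star t v.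
Proof. by apply: injective_projections; rewrite /= starD // scalerDr. Qed.

Lemma twisted_starZ t (k : R) u : twisted_star t (k *: u) = k *: twisted_star t u.
Proof. by apply: injective_projections; rewrite /= starZ // !scalerA mulrC. Qed.

Lemma twisted_starK t u : twisted_star t (twisted_star t u) = u.
Proof.
by apply: injective_projections; rewrite /= ?starZ starK // scalerA -signr_addb addbb scale1r.
Qed.

Lemma twisted_starC t t' u :
  twisted_star t (twisted_star t' u) = twisted_star t' (twisted_star t u).
Proof. by apply: injective_projections; rewrite /= ?starZ ?starK // !scalerA mulrC. Qed.

(** Not a C*-norm: the iteration asks only for submultiplicativity and control of both
    coordinates. *)
Definition twisted_norm (u : twisted) : R := `|u.1| + `|u.2|.

Lemma twisted_normD u v : twisted_norm (u + v) <= twisted_norm u + twisted_norm v.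
Proof. by rewrite addrACA lerD // ler_normD. Qed.

Lemma twisted_normZ (k : R) u : twisted_norm (k *: u) = `|k| * twisted_norm u.
Proof. by rewrite /twisted_norm /= !normrZ mulrDr. Qed.

Lemma twisted_normM u v : twisted_norm (u ** v) <= twisted_norm u * twisted_norm v.
Proof.
case: u v => [a b] [c d]; rewrite /twisted_norm /=.
have := normr_amul a c; have := normr_amul b d; have := normr_amul a d.
have := normr_amul b c; have := ler_normB (a ** c) (sg *: (b ** d)).
have := ler_normD (a ** d) (b ** c); rewrite normrZ normr_sign mul1r mulrDl !mulrDr.
lra.
Qed.

Lemma twisted_norm_ge0 u : 0 <= twisted_norm u. Proof. exact: addr_ge0. Qed.

(* Writing [v = 1 + w] one has [1 + defect w = 2 - v^* v], and [newton] is the step [v (3 - v^* v) / 2] of the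
   Newton iteration for the polar decomposition. *)
Definition defect (w : twisted) : twisted :=
  - (w + twisted_star (~~ s) w + twisted_star (~~ s) w ** w).

Definition newton (w : twisted) : twisted := w + 2^-1 *: (defect w + w ** defect w).

Lemma defect_emb w :
  emb (defect w) = 1 - (1 + emb (twisted_star (~~ s) w)) * (1 + emb w).
Proof.
rewrite /defect embN !embD embM mulrDl mul1r mulrDr mulr1 !opprD.
by rewrite !addrA subrr add0r.
Qed.

Lemma newton_emb w : 1 + emb (newton w) = (1 + emb w) * (1 + emb (2^-1 *: defect w)).
Proof.
rewrite /newton embD embZ embD embM mulrDr mulr1 -addrA; congr (_ + (_ + _)).
by rewrite embZ mulrDl mul1r scalerDr scalerAr.
Qed.

Lemma defect_star w : twisted_star (~~ s) (defect w) = defect w.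
Proof.
rewrite /defect -scaleN1r twisted_starZ !twisted_starD twisted_starM !twisted_starK.
by rewrite [_ + w]addrC.
Qed.

(** With $e$ the defect, the new one is $1-(1+e/2)(1-e)(1+e/2)$. The linear terms cancel, which
    makes the convergence quadratic. *)
Lemma defect_newton w : defect (newton w) =
  4^-1 *: (3 *: (defect w ** defect w) + defect w ** defect w ** defect w).
Proof.
set e := defect w; set v := 1 + emb w.
pose v' := 1 + emb (twisted_star (~~ s) w).
have ve : v' * v = 1 - emb e by rewrite /e defect_emb opprB addrC subrK.
have ns : 1 + emb (twisted_star (~~ s) (newton w)) = (1 + emb (2^-1 *: e)) * v'.
  rewrite /newton twisted_starD twisted_starZ twisted_starD twisted_starM defect_star -/e.
  rewrite embD embZ embD embM /v' embZ mulrDl mul1r mulrDr mulr1 scalerDr scalerAl.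
  by rewrite -!addrA; congr (_ + _); rewrite addrCA.
apply: emb_inj; rewrite defect_emb ns newton_emb -/v -/e.
rewrite -mulrA [v' * _]mulrA ve.
have evk : 1 + emb (2^-1 *: e) = @horner_alg R (unital twisted) (emb e) (1 + 2^-1 *: 'X).
  by rewrite rmorphD rmorph1 -mul_polyC rmorphM /= horner_algC horner_algX mulr_algl embZ.
have ev1 : 1 - emb e = @horner_alg R (unital twisted) (emb e) (1 - 'X).
  by rewrite rmorphB rmorph1 /= horner_algX.
rewrite evk ev1 -!rmorphM -[X in X - _](rmorph1 (horner_alg (emb e))) -rmorphB /=.
have -> : 1 - (1 + 2^-1 *: 'X) * ((1 - 'X) * (1 + 2^-1 *: 'X)) =
   4^-1%:P * (3%:P * ('X * 'X) + 'X * 'X * 'X) :> {poly R}.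
  have -> : 4^-1 = 2^-1 * 2^-1 :> R by field.
  have -> : 3%:P = 1 + 1 + 1 :> {poly R} by rewrite -!polyC1 -!polyCD; congr (_%:P); ring.
  rewrite -mul_polyC polyCM.
  have : 2^-1%:P + 2^-1%:P = 1 :> {poly R} by rewrite -polyCD -[2^-1]mul1r -splitr.
  move: (2^-1%:P) => h hh.
  have -> : 1 - (1 + h * 'X) * ((1 - 'X) * (1 + h * 'X)) = (1 - (h + h)) * 'X +
      ((h + h) - h * h) * ('X * 'X) + h * h * ('X * 'X * 'X) by ring.
  rewrite hh subrr mul0r add0r.
  have -> : 1 - h * h = (h + h) * (h + h) - h * h by rewrite hh mulr1.
  ring.
rewrite !(rmorphD, rmorphM) /= !horner_algX !horner_algC !mulr_algl.
by rewrite embZ embD embZ !embM scale1r !mulrDl !mul1r scaler_nat [(_ * _) *+ 3]mulrS mulr2n.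
Qed.

End Twisted.

Section ExactPairs.
Context (R : realType) (s : bool).
Local Notation sg := ((-1) ^+ s : R).

(* [1 + h + j y] is a unitary of the unitization of [D[j]] fixed by [twisted_star s]. *)
Definition exact_pair (D : realCstarType R) (h y : D) : Prop :=
  [/\ star h = h, star y = sg *: y, h ** y = y ** h &
    h + h + h ** h + sg *: (y ** y) = 0].

Lemma exact_pair_hom (D D' : realCstarType R) (f : D -> D') h y : star_hom f ->
  exact_pair h y -> exact_pair (f h) (f y).
Proof.
move=> fh [h1 h2 h3 h4]; split.
- by rewrite -(hom_star fh) h1.
- by rewrite -(hom_star fh) h2 (homZ fh).
- by rewrite -!(homM fh) h3.
- by rewrite -!(homM fh) -(homZ fh) -!(homD fh) h4 (hom0 fh).
Qed.

Section Newton.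
Context (D : realCstarType R).
Implicit Types (h y : D) (w : twisted_of D s).
Local Notation N := (@twisted_norm R D s).

Definition twisted_fixed w := twisted_star s w = w.

Lemma newton_fixed w : twisted_fixed w -> twisted_fixed (newton w).
Proof.
move=> ww; rewrite /twisted_fixed.
have dw : twisted_star s (defect w) =
    - (w + twisted_star (~~ s) w + w ** twisted_star (~~ s) w).
  rewrite /defect -scaleN1r twisted_starZ !twisted_starD twisted_starM.
  by rewrite [twisted_star s (twisted_star _ _)]twisted_starC ww scaleN1r.
rewrite /newton twisted_starD twisted_starZ twisted_starD twisted_starM ww dw.
congr (_ + _ *: _); set d := - _.
have e : emb d = 1 - (1 + emb w) * (1 + emb (twisted_star (~~ s) w)).
  rewrite /d embN !embD embM mulrDl mul1r mulrDr mulr1 !opprD !addrA subrr add0r.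
  by congr (_ - _); exact: addrC.
apply: emb_inj; rewrite !embD !embM.
transitivity (emb d * (1 + emb w)); first by rewrite mulrDr mulr1.
transitivity ((1 + emb w) * emb (defect w)); last by rewrite mulrDl mul1r.
by rewrite e defect_emb mulrBl mulrBr mul1r mulr1 mulrA.
Qed.

(** On a fixed element the involution of [D[j]] only changes the sign of $y$. The defect thus
    measures separately the circle relation and the failure to commute. *)
Lemma defect_fixed w : twisted_fixed w -> defect w =
  (- (w.1 + w.1 + w.1 ** w.1 + sg *: (w.2 ** w.2)), w.2 ** w.1 - w.1 ** w.2).
Proof.
case: w => h y [hh yy].
have -> : defect (h, y) =
      - (((h, y) : twisted_of D s) + (h, - y) +
        ((h, - y) : twisted_of D s) ** ((h, y) : twisted_of D s)).
  rewrite /defect; congr (- (_ + _ + _ ** _)); apply: injective_projections => //=.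
    by rewrite -[in RHS]yy signrN scaleNr.
  by rewrite -[in RHS]yy signrN scaleNr.
apply: injective_projections => /=.
  by rewrite amulNl scalerN opprK -!addrA.
by rewrite subrr add0r amulNl opprD opprK addrC.
Qed.

Lemma exact_pairP w : exact_pair w.1 w.2 <-> twisted_fixed w /\ defect w = 0.
Proof.
split=> [[h1 h2 h3 h4]|[ww w0]].
  have ww : twisted_fixed w.
    apply: injective_projections; rewrite //= h2 scalerA -signr_addb addbb scale1r //.
  split=> //; rewrite defect_fixed // h4 h3 subrr oppr0 //.
move: w0 ww; rewrite /twisted_fixed; case: w => h y /= w0 ww.
have := defect_fixed ww; rewrite w0 => -[/= e1 e2]; case: ww => hh yy.
split=> //.
- by rewrite -{2}yy scalerA -signr_addb addbb scale1r.
- by apply/esym/eqP; rewrite -subr_eq0 -e2.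
- by apply/eqP; rewrite -oppr_eq0 -e1.
Qed.

(** For a defect $e\le1/4$ one has $(3e^2+e^3)/4\le e^2\le e/4$. The crude growth bound $2^n$ is
    harmless: against the decay $4^{-n}$ it still leaves increments of ratio $1/2$. *)
Lemma newton_iterates w n : twisted_fixed w -> N (defect w) <= 4^-1 ->
  let u n := iter n (@newton R D s) w in
  [/\ twisted_fixed (u n), N (defect (u n)) <= 4^-1 ^+ n.+1 &
    1 + N (u n) <= (1 + N w) * 2 ^+ n].
Proof.
move=> ww wN u; elim: n => [|n [IH1 IH2 IH3]] //=; first by rewrite expr1 mulr1.
have q0 : 0 < (4 : R)^-1 ^+ n.+1 by rewrite exprn_gt0 // invr_gt0.
have q1 : (4 : R)^-1 ^+ n.+1 <= 4^-1.
  by rewrite exprS ler_piMr ?invr_ge0 // exprn_ile1 ?invr_ge0 // invf_le1 // ler1n.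
split; first exact: newton_fixed.
  rewrite defect_newton -/(u n); set e := defect _ in IH2 *; have e0 := twisted_norm_ge0 e.
  rewrite twisted_normZ ger0_norm ?invr_ge0 //.
  have := twisted_normD (3 *: (e ** e)) (e ** e ** e); rewrite twisted_normZ ger0_norm //.
  have := twisted_normM e e; have := twisted_normM (e ** e) e.
  have := ler_pM e0 e0 IH2 IH2; have := ler_wpM2r (ltW q0) q1.
  have a1 : N e <= 1 by apply: le_trans IH2 (le_trans q1 _); rewrite invf_le1 // ler1n.
  have := ler_wpM2l (twisted_norm_ge0 (e ** e)) a1.
  rewrite [_ ^+ n.+2]exprS; move: (4^-1 ^+ n.+1 : R) => q; lra.
have := twisted_normD (u n) (2^-1 *: (defect (u n) + u n ** defect (u n))).
rewrite -/(newton (u n)) twisted_normZ ger0_norm ?invr_ge0 //.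
have := twisted_normD (defect (u n)) (u n ** defect (u n)).
have := twisted_normM (u n) (defect (u n)).
have e1 : N (defect (u n)) <= 1.
  by apply: le_trans IH2 (le_trans q1 _); rewrite invf_le1 // ler1n.
have := ler_wpM2l (twisted_norm_ge0 (u n)) e1.
rewrite exprS mulrCA; move: IH3; move: ((1 + N w) * 2 ^+ n) => m.
have := twisted_norm_ge0 (u n); lra.
Qed.

End Newton.

Section NewtonLimit.
Context (D : realCstarType R).
Implicit Types (h y : D) (w : twisted_of D s).
Local Notation N := (@twisted_norm R D s).

(** A homomorphism under which [w] becomes exact kills the defect, so all iterates, and the limit,
    have the image of [w]. Applied to a quotient map, this says that the correction stays inside the
    ideal. *)
Lemma newton_limit w : twisted_fixed w -> N (defect w) <= 4^-1 ->
  exists h y, exact_pair h y /\ forall (D' : realCstarType R) (f : D -> D'),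
    star_hom f -> exact_pair (f w.1) (f w.2) -> f h = f w.1 /\ f y = f w.2.
Proof.
move=> ww wN; pose u n := iter n (@newton R D s) w.
have uP n := newton_iterates n ww wN; rewrite /= -/(u _) in uP.
have inc n : N (u n.+1 - u n) <= (1 + N w) * 2^-1 ^+ n.
  have [_ h1 h2] := uP n.
  have -> : u n.+1 - u n = 2^-1 *: (defect (u n) + u n ** defect (u n)).
    by rewrite [u n.+1]/(newton (u n)) /newton addrC addKr.
  rewrite twisted_normZ ger0_norm ?invr_ge0 //.
  have h3 : N (defect (u n) + u n ** defect (u n)) <= (1 + N (u n)) * N (defect (u n)).
    apply: le_trans (twisted_normD _ _) _; rewrite mulrDl mul1r lerD2l.
    exact: twisted_normM.
  have p0 := twisted_norm_ge0 (u n); have p1 := twisted_norm_ge0 (defect (u n)).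
  have h4 := ler_pM (addr_ge0 ler01 p0) p1 h2 h1.
  have h5 : (1 + N w) * 2 ^+ n * 4^-1 ^+ n.+1 = 4^-1 * ((1 + N w) * 2^-1 ^+ n).
    have e2 : (2 : R) ^+ n * 2^-1 ^+ n = 1 by rewrite -exprMn mulfV ?expr1n // pnatr_eq0.
    have e4 : (4 : R)^-1 ^+ n = 2^-1 ^+ n * 2^-1 ^+ n.
      by rewrite -exprMn; congr (_ ^+ _); field.
    rewrite exprS e4; move: e2; move: (2 ^+ n : R) (2^-1 ^+ n : R) => p q pq.
    have -> : (1 + N w) * p * (4^-1 * (q * q)) = 4^-1 * ((1 + N w) * q) * (p * q) by ring.
    by rewrite pq mulr1.
  have q0 : 0 <= (2 : R)^-1 by rewrite invr_ge0.
  have := mulr_ge0 (addr_ge0 ler01 (twisted_norm_ge0 w)) (exprn_ge0 n q0).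
  move: h4; rewrite h5; move: h3; rewrite -/(u n); lra.
have cvg1 : cvgn (fun n => (u n).1).
  apply: (@cvg_geometric_increments _ _ _ (1 + N w) 2^-1); first lra.
  by move=> n; apply: le_trans (inc n); rewrite lerDl.
have cvg2 : cvgn (fun n => (u n).2).
  apply: (@cvg_geometric_increments _ _ _ (1 + N w) 2^-1); first lra.
  by move=> n; apply: le_trans (inc n); rewrite lerDr.
move/cvg_ex: cvg1 => [h uh]; move/cvg_ex: cvg2 => [y uy]; exists h, y; split.
  have fx n : star (u n).1 = (u n).1 /\ sg *: star (u n).2 = (u n).2.
    by have [h1 _ _] := uP n; split; [exact: (congr1 fst h1)|exact: (congr1 snd h1)].
  have fix_hy : twisted_fixed (h, y).
    apply: injective_projections => /=.
      by apply: (lim_unique (cvg_star uh) uh) => n; have [] := fx n.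
    exact: (lim_unique (cvg_scale (k := sg) (cvg_star uy)) uy (fun n => (fx n).2)).
  apply: (exact_pairP (h, y)).2; split=> //; rewrite defect_fixed //.
  have nd n : `|(defect (u n)).1| <= 4^-1 * 4^-1 ^+ n /\ `|(defect (u n)).2| <= 4^-1 * 4^-1 ^+ n.
    have [_ h1 _] := uP n; rewrite -exprS.
    by split; apply: le_trans h1; rewrite ?lerDl ?lerDr.
  have q1 : 0 <= (4 : R)^-1 < 1 by lra.
  have dE n : defect (u n) = _ := defect_fixed (let: And3 h1 _ _ := uP n in h1).
  apply: injective_projections.
    apply: (lim_unique _ (cvg0_geometric q1 (fun n => (nd n).1)) _); last first.
      by move=> n; rewrite dE.
    apply: cvgN; apply: cvgD; first by apply: cvgD; [apply: cvgD|exact: cvg_amul].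
    by apply: cvg_scale; exact: cvg_amul.
  apply: (lim_unique _ (cvg0_geometric q1 (fun n => (nd n).2)) _); last first.
    by move=> n; rewrite dE.
  by apply: cvgB; exact: cvg_amul.
move=> D' f fh ex.
pose F (v : twisted_of D s) : twisted_of D' s := (f v.1, f v.2).
have FM v v' : F (v ** v') = F v ** F v'.
  apply: injective_projections => /=.
    by rewrite (homB fh) (homZ fh) !(homM fh).
  by rewrite (homD fh) !(homM fh).
have FD v v' : F (v + v') = F v + F v'.
  by apply: injective_projections; rewrite /= (homD fh).
have FZ k v : F (k *: v) = k *: F v.
  by apply: injective_projections; rewrite /= (homZ fh).
have Fstar t v : F (twisted_star t v) = twisted_star t (F v).
  by apply: injective_projections; rewrite /= ?(homZ fh) (hom_star fh).
have Fdefect v : F (defect v) = defect (F v).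
  by rewrite /defect -scaleN1r FZ scaleN1r !FD FM !Fstar.
have Fnewton v : F (newton v) = newton (F v).
  by rewrite /newton FD FZ FD FM Fdefect.
have Fu n : F (u n) = F w.
  elim: n => [//|n IH]; rewrite [u n.+1]/(newton (u n)) Fnewton IH.
  have [_ e0] := (exact_pairP (F w)).1 ex.
  by rewrite /newton e0 amul0r addr0 scaler0 addr0.
split.
  apply: (lim_unique (hom_cvg fh uh) (cvg_cst (f w.1))) => n.
  exact: (congr1 fst (Fu n)).
apply: (lim_unique (hom_cvg fh uy) (cvg_cst (f w.2))) => n.
exact: (congr1 snd (Fu n)).
Qed.

End NewtonLimit.
End ExactPairs.

(** * Polynomial calculus of an exact pair *)

Section PairCalculus.
Context (R : realType) (s : bool).
Local Notation sg := ((-1) ^+ s : R).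
Local Notation polys := ({poly R} * {poly R})%type.

Section Calculus.
Context (D : realCstarType R).
Implicit Types (a b h y : D) (p q : {poly R}) (r : polys).
Local Notation U := (unital D).
Local Notation ev u := (@horner_alg R U (emb u)).

(** As $y^2$ is a polynomial in $h$, the elements $hp(h)+yq(h)$ form the algebra generated by an
    exact pair; there are no constant terms, so they stay in [D]. *)
Definition calc h y r : D := (emb h * ev h r.1 + emb y * ev h r.2).2.

Lemma calc_emb h y r : emb (calc h y r) = emb h * ev h r.1 + emb y * ev h r.2.
Proof. by apply: emb_snd; rewrite /= !mul0r addr0. Qed.

Lemma ev_X h p : emb h * ev h p = ev h ('X * p).
Proof. by rewrite ev_mul horner_algX. Qed.

Lemma calcD h y r r' : calc h y (r + r') = calc h y r + calc h y r'.
Proof.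
by apply: emb_inj; rewrite [RHS]embD !calc_emb /= !rmorphD /= !mulrDr addrACA.
Qed.

Lemma calcZ h y (k : R) r : calc h y (k *: r) = k *: calc h y r.
Proof.
by apply: emb_inj; rewrite [RHS]embZ !calc_emb /= !ev_scale -!scalerAr scalerDr.
Qed.

Lemma calcB h y r r' : calc h y (r - r') = calc h y r - calc h y r'.
Proof. by rewrite -scaleN1r calcD calcZ scaleN1r. Qed.

Lemma calc_h h y : calc h y (1, 0) = h.
Proof. by apply: emb_inj; rewrite calc_emb /= rmorph1 rmorph0 mulr1 mulr0 addr0. Qed.

Lemma calc_y h y : calc h y (0, 1) = y.
Proof. by apply: emb_inj; rewrite calc_emb /= rmorph1 rmorph0 mulr1 mulr0 add0r. Qed.

(** The product after substituting $y^2=-(-1)^s h(2+h)$, with the factor $h$ of the first coordinate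
    divided out. *)
Definition polys_mul r r' : polys :=
  ('X * r.1 * r'.1 - sg *: ((2%:P + 'X) * r.2 * r'.2), 'X * (r.1 * r'.2 + r.2 * r'.1)).

Definition polys_star r : polys := (r.1, sg *: r.2).

Section Exact.
Context (h y : D) (ex : exact_pair s h y).

Lemma exact_square : emb y * emb y = ev h (- sg *: ('X * (2%:P + 'X))).
Proof.
have [_ _ _ e4] := ex.
have -> : ev h (- sg *: ('X * (2%:P + 'X))) = emb (- sg *: (h + h + h ** h)).
  rewrite ev_scale ev_mul rmorphD /= horner_algX horner_algC embZ !embD embM mulrDr.
  by rewrite mulr_algr scaler_nat mulr2n.
rewrite -embM; congr emb; have -> : h + h + h ** h = - (sg *: (y ** y)).
  by apply/eqP; rewrite -addr_eq0 e4.
by rewrite scalerN scaleNr opprK scalerA -signr_addb addbb scale1r.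
Qed.

Lemma exact_comm p : emb y * ev h p = ev h p * emb y.
Proof.
have [_ _ hy _] := ex; elim/poly_ind: p => [|p c IH].
  by rewrite rmorph0 mulr0 mul0r.
rewrite rmorphD /= ev_mul horner_algX horner_algC mulrDr mulrDl mulrA IH.
by rewrite -!mulrA -!embM hy mulr_algr mulr_algl.
Qed.

Lemma calcM r r' : calc h y (polys_mul r r') = calc h y r ** calc h y r'.
Proof.
apply: emb_inj; rewrite [RHS]embM !calc_emb /polys_mul /= !ev_X.
set P := ev h ('X * r.1); set P' := ev h ('X * r'.1).
rewrite [RHS]mulrDl [P * _]mulrDr [_ * (P' + _)]mulrDr.
have -> : emb y * ev h r.2 * P' = emb y * ev h ('X * (r.2 * r'.1)).
  by rewrite -mulrA -ev_mul; congr (_ * ev _ _); ring.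
have -> : P * (emb y * ev h r'.2) = emb y * ev h ('X * (r.1 * r'.2)).
  by rewrite /P [LHS]mulrA -exact_comm -[LHS]mulrA -ev_mul; congr (_ * ev _ _); ring.
have -> : emb y * ev h r.2 * (emb y * ev h r'.2) =
    ev h ('X * (- (sg *: ((2%:P + 'X) * r.2 * r'.2)))).
  rewrite {1}exact_comm -[LHS]mulrA [emb y * (emb y * _)]mulrA exact_square -!ev_mul; congr (ev _ _).
  by rewrite -!mul_polyC polyCN; ring.
have -> : ev h ('X * ('X * r.1 * r'.1 - sg *: ((2%:P + 'X) * r.2 * r'.2))) =
    P * P' + ev h ('X * - (sg *: ((2%:P + 'X) * r.2 * r'.2))).
  by rewrite mulrDr rmorphD /= /P /P' -ev_mul; congr (ev _ _ + _); ring.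
have -> : emb y * ev h ('X * (r.1 * r'.2 + r.2 * r'.1)) =
    emb y * ev h ('X * (r.1 * r'.2)) + emb y * ev h ('X * (r.2 * r'.1)).
  by rewrite mulrDr rmorphD /= mulrDr.
rewrite addrACA; congr (_ + _).
exact: addrC.
Qed.

Lemma calc_star r : calc h y (polys_star r) = star (calc h y r).
Proof.
have [hh yy _ _] := ex.
apply: emb_inj; rewrite -ustar_emb !calc_emb /= ustarD !ustarM !ustar_ev // !ustar_emb hh yy.
congr (_ + _); first by have := ev_comm h 'X r.1; rewrite horner_algX.
by rewrite ev_scale embZ -!scalerAr exact_comm.
Qed.

(** Here $y^*y=-(2h+h^2)$. For $t$ outside the interval, $k=t(t+2)$ is positive, hence
    $k+y^*y=-(h-t)(h+t+2)$ is invertible, and so is its factor $h-t$. *)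
Lemma exact_spectrum : spectrum_in h [set t | - 2 <= t <= 0].
Proof.
have [hh yy _ e4] := ex.
have ey : star y ** y = - (h + h + h ** h).
  by rewrite yy amulZl; apply/eqP; rewrite -addr_eq0 addrC e4.
move=> t /= tN.
have [k k0 ek] : exists2 k : R, 0 < k &
    ('X - t%:P) * (- ('X + (t + 2)%:P)) = k%:P - ('X + 'X + 'X * 'X) :> {poly R}.
  exists (t * (t + 2)).
    move/negP: tN; rewrite negb_and -!ltNge => /orP[t2|t0]; first by nra.
    by rewrite mulr_gt0 //; lra.
  have e2 : (t + 2)%:P = t%:P + 1 + 1 :> {poly R}.
    by rewrite -polyC1 -!polyCD; congr _%:P; ring.
  by rewrite polyCM e2; ring.
have := invertible_pos y k0; rewrite ey => i.
have : invertible (ev h (('X - t%:P) * (- ('X + (t + 2)%:P)))).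
  rewrite ek (_ : ev h _ = k%:A + emb (- (h + h + h ** h))) //.
  by rewrite rmorphB /= !rmorphD rmorphM /= horner_algC horner_algX embN !embD embM.
rewrite ev_mul => /(invertible_factor _).
rewrite rmorphB /= horner_algX horner_algC; apply.
by have := ev_comm h ('X - t%:P) (- ('X + (t + 2)%:P));
  rewrite rmorphB /= horner_algX horner_algC.
Qed.

End Exact.
End Calculus.
End PairCalculus.

(** * Universal pairs and the homomorphisms they define *)

Section UniversalPairs.
Context (R : realType) (s : bool).
Local Notation sg := ((-1) ^+ s : R).
Local Notation polys := ({poly R} * {poly R})%type.

(* The function [t p(t) + j eta q(t)] on the circle [(1 + t)^2 + eta^2 = 1] is
   bounded by [m], where [j] is [1] or the imaginary unit. *)
Definition circle_bound (r : polys) (m : R) : Prop :=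
  forall t eta : R, eta ^+ 2 = - (t * (2 + t)) ->
    if s then (t * r.1.[t]) ^+ 2 + (eta * r.2.[t]) ^+ 2 <= m ^+ 2
    else `|t * r.1.[t] + eta * r.2.[t]| <= m.

Section Bound.
Context (D : realCstarType R) (h y : D) (ex : exact_pair s h y).
Implicit Types (p q : {poly R}) (r : polys).
Local Notation U := (unital D).
Local Notation ev := (@horner_alg R U (emb h)).

Let S0 : [set t : R | - 2 <= t <= 0] !=set0.
Proof. by exists 0 => /=; rewrite lexx andbT; lra. Qed.

Let eta_exists t : - 2 <= t <= 0 -> exists eta : R, eta ^+ 2 = - (t * (2 + t)).
Proof.
move=> t2; exists (Num.sqrt (- (t * (2 + t)))); rewrite sqr_sqrtr //.
by rewrite oppr_ge0 mulr_le0_ge0; lra.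
Qed.

(** Here $y$ is skew, so $c^*c$ for $c=hp(h)+yq(h)$ is a polynomial in $h$ alone. Its value at $t$
    is the squared modulus of $tp(t)+i\eta q(t)$. *)
Lemma calc_norm_le_unitary r (m : R) : s = true -> 0 <= m -> circle_bound r m ->
  `|calc h y r| <= m.
Proof.
move=> s1 m0 b; have [hh yy hy e4] := ex.
rewrite -(@ler_sqr R) ?nnegrE // -cstar_identity -(calc_star ex) -(calcM ex).
apply: (norm_poly_le hh (exact_spectrum ex) S0
  (p := 'X ^+ 2 * r.1 ^+ 2 - 'X * (2%:P + 'X) * r.2 ^+ 2)).
  rewrite calc_emb /= s1 expr1 !scaleN1r opprK.
  rewrite (_ : 'X * (r.1 * r.2 + - r.2 * r.1) = 0); last by ring.
  rewrite rmorph0 mulr0 addr0 ev_X; congr (ev _); ring.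
move=> t /= t2; have [eta etaE] := eta_exists t2.
have := b t eta etaE; rewrite s1 !exprMn etaE => le.
have -> : ('X ^+ 2 * r.1 ^+ 2 - 'X * (2%:P + 'X) * r.2 ^+ 2).[t] =
    t ^+ 2 * r.1.[t] ^+ 2 + - (t * (2 + t)) * r.2.[t] ^+ 2.
  by rewrite !(hornerD, hornerN, hornerM, horner_exp, hornerX, hornerC) mulNr.
rewrite ger0_norm // addr_ge0 // mulr_ge0 ?sqr_ge0 //.
by rewrite oppr_ge0 mulr_le0_ge0; lra.
Qed.

(* For [s = false] the element [c = h p(h) + y q(h)] is selfadjoint, and
   [(M - c) (M - c')] with [c' = h p(h) - y q(h)] is a polynomial in [h]. *)
Lemma calc_norm_le_selfadj r (m : R) : s = false -> 0 <= m -> circle_bound r m ->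
  `|calc h y r| <= m.
Proof.
move=> s0 m0 b; have [hh yy hy e4] := ex.
have fact r' M : m < M -> circle_bound r' m -> invertible (M%:A - emb (calc h y r')).
  move=> mM b'; pose N := (M%:P - 'X * r'.1) ^+ 2 + 'X * (2%:P + 'X) * r'.2 ^+ 2.
  have NE t eta : eta ^+ 2 = - (t * (2 + t)) -> N.[t] =
      (M - (t * r'.1.[t] + eta * r'.2.[t])) * (M - (t * r'.1.[t] + - eta * r'.2.[t])).
    move=> etaE; have e2 : t * (2 + t) = - eta ^+ 2 by rewrite etaE opprK.
    rewrite /N !(hornerD, hornerN, hornerM, horner_exp, hornerX, hornerC) e2; ring.
  have N0 t : - 2 <= t <= 0 -> 0 < N.[t].
    move=> t2; have [eta etaE] := eta_exists t2; rewrite (NE _ _ etaE).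
    have := b' t eta etaE; have := b' t (- eta); rewrite sqrrN => /(_ etaE).
    rewrite s0 => /(le_trans (ler_norm _)) h1 /(le_trans (ler_norm _)) h2.
    by rewrite mulr_gt0 // subr_gt0; lra.
  have iN : invertible (ev N).
    apply: (invertible_poly hh (exact_spectrum ex)) => [|t /N0/lt0r_neq0 //].
    have /N0 : - 2 <= (0 : R) <= 0 by rewrite lexx andbT; lra.
    by apply: contraTneq => ->; rewrite horner0 ltxx.
  pose V := M%:P - 'X * r'.1; pose Y := emb y * ev r'.2.
  have YV : Y * ev V = ev V * Y.
    by rewrite /Y -mulrA ev_comm mulrA (exact_comm ex) mulrA.
  have YY : Y * Y = ev (- ('X * (2%:P + 'X) * r'.2 ^+ 2)).
    rewrite /Y {1}(exact_comm ex) -[LHS]mulrA [emb y * (emb y * _)]mulrA (exact_square ex).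
    by rewrite s0 -!ev_mul; congr (ev _); rewrite expr0 scaleN1r; ring.
  have -> : M%:A - emb (calc h y r') = ev V - Y.
    by rewrite calc_emb ev_X opprD addrA /V rmorphB /= horner_algC.
  have NcE : ev N = (ev V - Y) * (ev V + Y).
    rewrite mulrBl !mulrDr YV opprD addrA addrK YY -ev_mul -rmorphB /=.
    by rewrite opprK; congr (ev _); rewrite /N /V; ring.
  apply: (@invertible_factor _ _ (ev V + Y)); last by rewrite -NcE.
  by rewrite mulrBl !mulrBr !mulrDl !mulrDr YV; congr (_ - _); rewrite opprD addrA addrK.
have cc : star (calc h y r) = calc h y r.
  by rewrite -(calc_star ex); case: (r) => p q; rewrite /polys_star s0 expr0 scale1r.
apply: norm_le_invertible => // M mM.
have -> : (M ^+ 2)%:A - emb (calc h y r ** calc h y r) =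
    (M%:A - emb (calc h y r)) * (M%:A - emb (calc h y (- r))) :> U.
  rewrite -[- r]scaleN1r calcZ scaleN1r embN opprK embM mulrBl !mulrDr.
  by rewrite !mulr_algl mulr_algr opprD addrA addrK scalerA expr2.
apply: invertibleM; apply: (fact _ _ mM) => //.
move=> t eta etaE; have := b t eta etaE; rewrite s0 /= !hornerN !mulrN -opprD normrN.
exact.
Qed.

Lemma calc_norm_le r (m : R) : 0 <= m -> circle_bound r m -> `|calc h y r| <= m.
Proof.
case: (boolP s) => [|/negbTE] ?; first exact: calc_norm_le_unitary.
exact: calc_norm_le_selfadj.
Qed.

End Bound.

(* By the two conditions after [exact_pair] the pair generates [A], and its
   spectrum is the whole circle. *)
Definition universal_pair (A : realCstarType R) (h y : A) : Prop :=
  [/\ exact_pair s h y,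
      forall (f : A) (e : R), 0 < e -> exists r, `|f - calc h y r| <= e &
      forall r, circle_bound r `|calc h y r| ].

Section Extension.
Context (A : realCstarType R) (h y : A) (un : universal_pair h y).
Implicit Types (f g : A) (r : polys).

Let ex : exact_pair s h y. Proof. by case: un. Qed.

Lemma polys_approx f : exists2 r : nat -> polys,
  forall n, `|f - calc h y (r n)| <= 2^-1 ^+ n & (fun n => calc h y (r n)) @ \oo --> f.
Proof.
have [_ dense _] := un.
have H n : exists r, `|f - calc h y r| <= 2^-1 ^+ n.
  by apply: dense; rewrite exprn_gt0 // invr_gt0.
have [r rP] := choice H; exists r => //.
apply/cvgrPdist_le => e e0; have : (fun n => (2 : R)^-1 ^+ n) @ \oo --> (0 : R).
  by apply: cvg_expr; rewrite ger0_norm ?invr_ge0 // invf_lt1 // ltr1n.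
move=> /cvgr0Pnorm_le/(_ _ e0); apply: filterS => n; apply: le_trans.
exact: le_trans (rP n) (ler_norm _).
Qed.

Section Target.
Context (D : realCstarType R) (k z : D) (ex' : exact_pair s k z).

Lemma calc_contractive r : `|calc k z r| <= `|calc h y r|.
Proof. by have [_ _ b] := un; apply: calc_norm_le => //; exact: b. Qed.

(** Distinct pairs of polynomials may give the same element of [A]. Contractivity makes the limit
    independent of the approximating sequence, so the map is fixed by its behaviour on all of them
    at once. *)
Lemma universal_hom_exists : exists psi : A -> D,
  forall f (r : nat -> polys), (fun n => calc h y (r n)) @ \oo --> f ->
    (fun n => calc k z (r n)) @ \oo --> psi f.
Proof.
have H f : exists d : D, forall (r : nat -> polys), (fun n => calc h y (r n)) @ \oo --> f ->
    (fun n => calc k z (r n)) @ \oo --> d.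
  have [r rP rf] := polys_approx f.
  have /cvg_ex[d rd] : cvgn (fun n => calc k z (r n)).
    apply: (@cvg_geometric_increments _ _ _ 2 2^-1); first lra.
    move=> n; rewrite -calcB; apply: le_trans (calc_contractive _) _; rewrite calcB.
    exact: (increments_le (u := fun n => calc h y (r n)) n rP).
  exists d => r' r'f.
  have d0 : (fun n => calc k z (r' n) - calc k z (r n)) @ \oo --> (0 : D).
    have : (fun n => calc h y (r' n) - calc h y (r n)) @ \oo --> (0 : A).
      by have := cvg_sub r'f rf; rewrite subrr.
    move=> /cvgr0Pnorm_le d0; apply/cvgr0Pnorm_le => e /d0; apply: filterS => n.
    by rewrite -!calcB; exact: le_trans (calc_contractive _).
  have : (fun n => calc k z (r' n) - calc k z (r n) + calc k z (r n)) @ \oo --> 0 + d.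
    exact: cvgD.
  by rewrite add0r; under eq_fun do rewrite subrK.
have [psi psiP] := choice H; by exists psi.
Qed.

Lemma universal_hom : exists psi : A -> D, [/\ star_hom psi, psi h = k & psi y = z].
Proof.
have [psi psiP] := universal_hom_exists.
have ap f : exists r : nat -> polys, (fun n => calc h y (r n)) @ \oo --> f.
  by have [r _ rf] := polys_approx f; exists r.
have uniq f (r : nat -> polys) d : (fun n => calc h y (r n)) @ \oo --> f ->
    (fun n => calc k z (r n)) @ \oo --> d -> psi f = d.
  by move=> rf rd; apply: (lim_unique (psiP _ _ rf) rd).
exists psi; split; last 2 first.
- by apply: (uniq _ (fun=> (1, 0))); rewrite calc_h; exact: cvg_cst.
- by apply: (uniq _ (fun=> (0, 1))); rewrite calc_y; exact: cvg_cst.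
split=> [c f g|f g|f].
- have [r rf] := ap f; have [r' rg] := ap g.
  apply: (uniq _ (fun n => c *: r n + r' n)).
    under eq_fun do rewrite calcD calcZ.
    by apply: cvgD => //; exact: cvg_scale.
  under eq_fun do rewrite calcD calcZ.
  by apply: cvgD; [apply: cvg_scale|]; exact: psiP.
- have [r rf] := ap f; have [r' rg] := ap g.
  apply: (uniq _ (fun n => polys_mul s (r n) (r' n))).
    by under eq_fun do rewrite (calcM ex); exact: cvg_amul.
  by under eq_fun do rewrite (calcM ex'); apply: cvg_amul; exact: psiP.
- have [r rf] := ap f.
  apply: (uniq _ (fun n => polys_star s (r n))).
    by under eq_fun do rewrite (calc_star ex); exact: cvg_star.
  by under eq_fun do rewrite (calc_star ex'); apply: cvg_star; exact: psiP.
Qed.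

Lemma hom_calc (psi : A -> D) r : star_hom psi -> psi (calc h y r) = calc (psi h) (psi y) r.
Proof.
move=> ph.
have hmul (p : {poly R}) a : exists b, [/\ emb b = emb a * horner_alg (emb h) p &
    emb (psi b) = emb (psi a) * horner_alg (emb (psi h)) p].
  elim/poly_ind: p => [|p c [b [b1 b2]]].
    by exists 0; rewrite (hom0 ph) !rmorph0 !mulr0 !emb0.
  exists (b ** h + c *: a); rewrite (homD ph) (homZ ph) (homM ph).
  rewrite !embD !embM !embZ b1 b2 !rmorphD !rmorphM /= !horner_algX !horner_algC.
  by rewrite !mulrDr !mulrA !mulr_algr.
have [b [b1 b2]] := hmul r.1 h; have [c [c1 c2]] := hmul r.2 y.
have -> : calc h y r = b + c by apply: emb_inj; rewrite calc_emb embD b1 c1.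
by apply: emb_inj; rewrite (homD ph) calc_emb embD b2 c2.
Qed.

Lemma universal_hom_unique (psi psi' : A -> D) : star_hom psi -> star_hom psi' ->
  psi h = psi' h -> psi y = psi' y -> psi =1 psi'.
Proof.
move=> ph ph' eh ey f; apply/eqP; rewrite -subr_eq0 -normr_le0.
apply/ler_addgt0Pr => e e0; rewrite add0r; have e20 : 0 < e / 2 by rewrite divr_gt0.
have [_ dense _] := un; have [r fr] := dense f _ e20.
have -> : psi f - psi' f = psi (f - calc h y r) - psi' (f - calc h y r).
  by rewrite (homB ph) (homB ph') !hom_calc // eh ey opprB addrA subrK.
apply: le_trans (ler_normB _ _) _.
by have := norm_hom_le ph (f - calc h y r); have := norm_hom_le ph' (f - calc h y r); lra.
Qed.

End Target.
End Extension.
End UniversalPairs.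

Lemma scale_half (R : realType) (V : lmodType R) (v : V) : 2^-1 *: (v + v) = v.
Proof.
by rewrite -mulr2n -(@scaler_nat R V 2 v) scalerA mulVf ?pnatr_eq0 // scale1r.
Qed.

(** * Perturbing approximate pairs to exact ones *)

Section Semiprojectivity.
Context (R : realType) (s : bool).
Local Notation sg := ((-1) ^+ s : R).

(** The map [f] is left free because it serves twice: as the quotient map from $B/J_n$, and as that
    map restricted to a subalgebra. *)
Lemma universal_perturb (A : realCstarType R) (h y : A) (D : realCstarType R)
    (w : twisted_of D s) :
  universal_pair s h y -> twisted_fixed w -> twisted_norm (defect w) <= 4^-1 ->
  exists psi : A -> D, star_hom psi /\
    forall (D' : realCstarType R) (f : D -> D') (phi : A -> D'),
      star_hom f -> star_hom phi -> f w.1 = phi h -> f w.2 = phi y ->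
      forall a, f (psi a) = phi a.
Proof.
move=> un ww wN; have [h' [y' [ex' H]]] := newton_limit ww wN.
have [psi [ph eh ey]] := universal_hom un ex'; exists psi; split=> //.
move=> D' f phi fh phih e1 e2; have [ex _ _] := un.
have [e3 e4] : f h' = f w.1 /\ f y' = f w.2.
  by apply: H => //; rewrite e1 e2; exact: exact_pair_hom ex.
apply: (universal_hom_unique un (star_hom_comp ph fh) phih) => /=.
  by rewrite eh e3.
by rewrite ey e4.
Qed.

Lemma quot_lift_sym (B : realCstarType R) (J : closed_ideal B) x (t : bool) :
  star x = (-1) ^+ t *: x -> exists b : B, quot_pi J b = x /\ star b = (-1) ^+ t *: b.
Proof.
move=> xx; have [b bx] := quot_pi_surj x.
exists (2^-1 *: (b + (-1) ^+ t *: star b)); split.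
  rewrite quot_piZ quot_piD quot_piZ -quot_star_piE bx xx scalerA -signr_addb addbb scale1r.
  exact: scale_half.
rewrite starZ starD starZ starK [RHS]scalerA [(-1) ^+ t * _]mulrC -[RHS]scalerA.
congr (_ *: _); rewrite scalerDr scalerA -signr_addb addbb scale1r; exact: addrC.
Qed.

(** The symmetry of [h] and [y] is exact, so only the two coordinates of the defect matter. They lie
    in the limit ideal, and each drops to $1/8$ modulo some $J_n$. *)
Lemma quot_almost_exact (B : realCstarType R) (J : nat -> closed_ideal B) (Joo : closed_ideal B)
    (h y : B) : (forall n, J n `<=` J n.+1) -> Joo = closure (\bigcup_n J n) :> set B ->
  star h = h -> star y = sg *: y -> exact_pair s (quot_pi Joo h) (quot_pi Joo y) ->
  exists n, let w : twisted_of (quot (J n)) s := (quot_pi (J n) h, quot_pi (J n) y) in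
    twisted_fixed w /\ twisted_norm (defect w) <= 4^-1.
Proof.
move=> JS JE hs ys exoo.
have fixd (I : closed_ideal B) : twisted_fixed ((quot_pi I h, quot_pi I y) : twisted_of (quot I) s).
  have qh := quot_pi_hom I.
  apply: injective_projections => /=; rewrite -(hom_star qh) ?hs ?ys //.
  by rewrite (homZ qh) scalerA -signr_addb addbb scale1r.
pose d1 := - (h + h + h ** h + sg *: (y ** y)); pose d2 := y ** h - h ** y.
have defE (I : closed_ideal B) : defect ((quot_pi I h, quot_pi I y) : twisted_of (quot I) s) =
    (quot_pi I d1, quot_pi I d2).
  have qh := quot_pi_hom I; rewrite defect_fixed // /d1 /d2.
  by rewrite (homN qh) (homB qh) !(homD qh) (homZ qh) !(homM qh).
have [_ ] := (exact_pairP (quot_pi Joo h, quot_pi Joo y)).1 exoo.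
rewrite defE => -[/quot_pi_eq0 J1 /quot_pi_eq0 J2].
have e8 : 0 < (8 : R)^-1 by rewrite invr_gt0.
have [n1 n1P] := norm_quot_pi_small JS JE J1 e8.
have [n2 n2P] := norm_quot_pi_small JS JE J2 e8.
exists (maxn n1 n2); split=> //; rewrite defE /twisted_norm /=.
by have := n1P _ (leq_maxl n1 n2); have := n2P _ (leq_maxr n1 n2); lra.
Qed.

Theorem universal_semiprojective (A : realCstarType R) (h y : A) :
  universal_pair s h y -> semiprojective A.
Proof.
move=> un B J Joo JS JE phi ph; have [ex _ _] := un.
have [hh yy _ _] := ex.
have [h0 [h0E h0s]] : exists b : B, quot_pi Joo b = phi h /\ star b = (-1) ^+ false *: b.
  by apply: quot_lift_sym; rewrite -(hom_star ph) hh scale1r.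
have [y0 [y0E y0s]] : exists b : B, quot_pi Joo b = phi y /\ star b = sg *: b.
  by apply: quot_lift_sym; rewrite -(hom_star ph) yy (homZ ph).
rewrite scale1r in h0s; have exoo := exact_pair_hom ph ex; rewrite -h0E -y0E in exoo.
have [n [fixd small]] := quot_almost_exact JS JE h0s y0s exoo.
have JnJ : J n `<=` Joo by exact: ideal_bigcup_sub.
have [psi [psih H]] := universal_perturb un fixd small.
exists n, psi; split=> // a.
by apply: H => //=; [exact: quot_map_hom|rewrite quot_map_pi|rewrite quot_map_pi].
Qed.

End Semiprojectivity.

(** * Weierstrass approximation by Bernstein polynomials *)

Section Weierstrass.
Variable R : realType.
Implicit Types (F G : nat -> R) (f : R -> R).

(* The Bernstein polynomial with values [F], by de Casteljau's recursion. *)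
Fixpoint bernstein n F : {poly R} :=
  if n is n'.+1 then 'X * bernstein n' (fun k => F k.+1) + (1 - 'X) * bernstein n' F
  else (F 0%N)%:P.

Lemma bernsteinS n F x : (bernstein n.+1 F).[x] =
  x * (bernstein n (fun k => F k.+1)).[x] + (1 - x) * (bernstein n F).[x].
Proof. by rewrite /= !(hornerD, hornerM, hornerN, hornerX, hornerC). Qed.

Lemma bernstein_le n F G x : 0 <= x <= 1 -> (forall k, (k <= n)%N -> F k <= G k) ->
  (bernstein n F).[x] <= (bernstein n G).[x].
Proof.
move=> /andP[x0 x1]; elim: n F G => [|n IH] F G FG.
  by rewrite /= !hornerC FG.
rewrite !bernsteinS lerD // ler_wpM2l ?subr_ge0 //; apply: IH => k kn; apply: FG => //.
exact: leqW.
Qed.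

(** The variance of the binomial distribution. The centre [m] is general because the recursion
    shifts [k] and hence replaces [m] by [m - 1]. *)
Lemma bernstein_square n (c d m x : R) :
  (bernstein n (fun k => c + d * (k%:R - m) ^+ 2)).[x] =
  c + d * ((n%:R * x - m) ^+ 2 + n%:R * x * (1 - x)).
Proof.
elim: n m => [|n IH] m; first by rewrite /= hornerC !mul0r addr0.
have eF : (fun k : nat => c + d * (k.+1%:R - m) ^+ 2) = fun k => c + d * (k%:R - (m - 1)) ^+ 2.
  by apply/funext => k; rewrite -natr1 opprB addrA.
rewrite bernsteinS eF !IH -natr1; ring.
Qed.

(** Chebyshev's argument: $|f(x)-f(y)|\le e/2+K(x-y)^2$, where the square absorbs the pairs further
    apart than [d]. Monotonicity of the Bernstein operator transports this bound, and the variance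
    makes the quadratic term $O(K/n)$. *)
Lemma weierstrass01 f (e : R) : continuous f -> 0 < e ->
  exists p : {poly R}, forall x, 0 <= x <= 1 -> `|f x - p.[x]| <= e.
Proof.
move=> fc e0; have e20 : 0 < e / 2 by rewrite divr_gt0.
have [d d0 fd] := @segment_uniform R R^o f 0 1 _ fc e20.
have [c _ cM] : exists2 c : R, c \in `[0, 1]%R &
    forall t, t \in `[0, 1]%R -> `|f t| <= `|f c|.
  apply: (@EVT_max R (fun t => `|f t|)) => //.
  by apply: continuous_subspaceT => x; apply: cvg_norm; exact: fc.
pose K := 2 * `|f c| / d ^+ 2.
have K0 : 0 <= K by apply: divr_ge0; [exact: mulr_ge0|exact: sqr_ge0].
have fK x y : 0 <= x <= 1 -> 0 <= y <= 1 -> `|f x - f y| <= e / 2 + K * (x - y) ^+ 2.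
  move=> x01 y01; have [xy|xy] := ltP `|x - y| d.
    apply: le_trans (fd x y x01 xy) _.
    by rewrite lerDl mulr_ge0 ?sqr_ge0.
  have h1 : d ^+ 2 <= (x - y) ^+ 2.
    by rewrite -[(x - y) ^+ 2]real_normK ?num_real // lerXn2r // nnegrE ltW.
  apply: le_trans (ler_normB _ _) _.
  have h2 : 2 * `|f c| <= K * (x - y) ^+ 2.
    apply: (@le_trans _ _ (K * d ^+ 2)); last by rewrite ler_wpM2l.
    by rewrite /K divfK // expf_neq0 // lt0r_neq0.
  have := cM x; rewrite in_itv /= x01 => /(_ isT).
  have := cM y; rewrite in_itv /= y01 => /(_ isT); lra.
pose n := (Num.truncn (2 * K / e)).+1.
have n0 : 0 < n%:R :> R by rewrite ltr0n.
have Kn : K / n%:R <= e / 2.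
  rewrite ler_pdivrMr // mulrC -ler_pdivrMr //.
  have := truncnS_gt (2 * K / e); rewrite -/n => /ltW; apply: le_trans.
  by rewrite invf_div mulrA [K * 2]mulrC.
exists (bernstein n (fun k => f (k%:R / n%:R))) => x x01.
have /andP[x0 x1] := x01.
have key k : (k <= n)%N -> `|f x - f (k%:R / n%:R)| <= e / 2 + K / n%:R ^+ 2 * (k%:R - n%:R * x) ^+ 2.
  move=> kn; apply: le_trans (fK _ _ x01 _) _.
    by rewrite divr_ge0 // ler_pdivrMr // mul1r ler_nat.
  rewrite lerD2l -mulrA ler_wpM2l // le_eqVlt; apply/orP; left; apply/eqP.
  by field; rewrite lt0r_neq0.
have var : K / n%:R ^+ 2 * (n%:R * x * (1 - x)) <= e / 2.
  apply: le_trans Kn.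
  have -> : K / n%:R ^+ 2 * (n%:R * x * (1 - x)) = K / n%:R * (x * (1 - x)).
    by field; rewrite lt0r_neq0.
  apply: ler_piMr; first by rewrite divr_ge0 // ltW.
  by rewrite mulr_ile1 // ?subr_ge0 // lerBlDr lerDl.
rewrite ler_norml; apply/andP; split.
  have /(bernstein_le x01) : forall k, (k <= n)%N -> f (k%:R / n%:R) <=
      f x + e / 2 + K / n%:R ^+ 2 * (k%:R - n%:R * x) ^+ 2.
    move=> k /key; rewrite ler_norml => /andP[h _]; lra.
  rewrite bernstein_square subrr expr0n add0r; lra.
have /(bernstein_le x01) : forall k, (k <= n)%N ->
    f x - e / 2 + - (K / n%:R ^+ 2) * (k%:R - n%:R * x) ^+ 2 <= f (k%:R / n%:R).
  move=> k /key; rewrite ler_norml mulNr => /andP[_ h]; lra.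
rewrite bernstein_square subrr expr0n add0r mulNr; lra.
Qed.

Lemma weierstrass f (e a b : R) : continuous f -> 0 < e -> a < b ->
  exists p : {poly R}, forall x, a <= x <= b -> `|f x - p.[x]| <= e.
Proof.
move=> fc e0 ab; have ba : 0 < b - a by rewrite subr_gt0.
have [|p pP] := @weierstrass01 (fun u => f (a + (b - a) * u)) e _ e0.
  move=> u; apply: (@continuous_comp _ _ _ (fun u => a + (b - a) * u) f); last exact: fc.
  apply: cvgD; first exact: cvg_cst.
  by apply: cvgM; [exact: cvg_cst|exact: cvg_id].
exists (p \Po ((b - a)^-1 *: ('X - a%:P))) => x /andP[ax xb].
rewrite horner_comp hornerZ hornerD hornerN hornerX hornerC.
have := pP ((b - a)^-1 * (x - a)).
rewrite mulrA mulfV ?lt0r_neq0 // mul1r (addrC a) subrK; apply.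
by rewrite mulr_ge0 ?invr_ge0 ?(ltW ba) ?subr_ge0 //= ler_pdivrMl // mulr1 lerD2r.
Qed.

End Weierstrass.

(** * Continuous functions on a compact space *)

Section RealFunctions.
Context (R : realType) (T : topologicalType).
Implicit Types (f g : T -> R).

Lemma continuous_Re (f : T -> Rcomplex R) : continuous f ->
  continuous (fun t => complex.Re (f t)).
Proof.
move=> fc t; apply: (@cvg_bound R R^o _ _ t (fun x => `|f t - f x|)).
  exact: (dist_cvg0 (fc t)).
by apply: nearW => x; apply: le_trans (Re_le_norm _); case: (f t) (f x) => ? ? [].
Qed.

Lemma continuous_Im (f : T -> Rcomplex R) : continuous f ->
  continuous (fun t => complex.Im (f t)).
Proof.
move=> fc t; apply: (@cvg_bound R R^o _ _ t (fun x => `|f t - f x|)).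
  exact: (dist_cvg0 (fc t)).
by apply: nearW => x; apply: le_trans (Im_le_norm _); case: (f t) (f x) => ? ? [].
Qed.

Lemma continuous_Complex f g : continuous f -> continuous g ->
  continuous (fun t => Complex (f t) (g t) : Rcomplex R).
Proof.
move=> fc gc t; apply: (@cvg_bound R (Rcomplex R) _ _ t (fun x => `|f t - f x| + `|g t - g x|)).
  rewrite -[0]addr0; apply: cvgD; first exact: (@dist_cvg0 R R^o _ f t (fc t)).
  exact: (@dist_cvg0 R R^o _ g t (gc t)).
by apply: nearW => x; exact: le_trans (norm_le_ReIm _) (lexx _).
Qed.

Lemma continuous_mul f g : continuous f -> continuous g -> continuous (fun t => f t * g t).
Proof. by move=> fc gc t; apply: cvgM; [exact: fc|exact: gc]. Qed.

Lemma continuous_add f g : continuous f -> continuous g -> continuous (fun t => f t + g t).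
Proof. by move=> fc gc t; apply: cvgD; [exact: fc|exact: gc]. Qed.

Lemma continuous_opp f : continuous f -> continuous (fun t => - f t).
Proof. by move=> fc t; apply: cvgN; exact: fc. Qed.

Lemma continuous_inv f : continuous f -> (forall t, f t != 0) ->
  continuous (fun t => (f t)^-1).
Proof. by move=> fc f0 t; apply: cvgV => //; exact: fc. Qed.

Lemma continuous_abs f : continuous f -> continuous (fun t => `|f t|).
Proof. exact: (@continuous_norm R R^o). Qed.

Lemma continuous_sqrt f : continuous f -> continuous (fun t => Num.sqrt (f t)).
Proof. by move=> fc t; apply: continuous_comp; [exact: fc|exact: sqrt_continuous]. Qed.

Lemma compact_ge f (e : R) : compact [set: T] -> continuous f ->
  compact [set t | e <= f t].
Proof.
move=> Tc fc; apply: (subclosed_compact _ Tc) => //.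
by apply: (@closed_comp _ _ f [set x | e <= x]) => [t _|]; [exact: fc|exact: closed_ge].
Qed.

(** The quantity is the error $f-fg/(g+d)$ of regularising a division by $g$. Where $|f|\ge e$,
    compactness keeps $g$ away from 0 and a small [d] suffices; elsewhere the bound is immediate. *)
Lemma small_ratio f g (t0 : T) (e : R) : compact [set: T] -> continuous f -> continuous g ->
  (forall t, 0 <= g t) -> (forall t, g t = 0 -> f t = 0) -> 0 < e ->
  exists2 d : R, 0 < d & forall t, `|f t| * (d / (g t + d)) <= e.
Proof.
move=> Tc fc gc g0 gf e0.
pose A := [set t | e <= `|f t|].
have Ac : compact A by apply: compact_ge => //; exact: continuous_abs.
have [A0|/set0P A0] := eqVneq A set0.
  exists 1 => // t; have ft : `|f t| <= e.
    rewrite leNgt; apply/negP => /ltW ft; suff : A t by rewrite A0.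
    exact: ft.
  apply: le_trans ft; rewrite ler_piMr // ler_pdivrMr ?ltr_wpDl //.
  by rewrite mul1r lerDr.
have [c cA cmin] := compact_EVT_min A0 Ac (continuous_subspaceT gc).
have [b _ bmax] := @compact_EVT_max _ R (fun t => `|f t|) setT
  (ex_intro _ t0 I) Tc (continuous_subspaceT (continuous_abs fc)).
have gc0 : 0 < g c.
  rewrite lt0r g0 andbT; apply/eqP => /gf fc0; move: cA.
  by rewrite inE /A /= fc0 normr0 leNgt e0.
have M1 : 0 < `|f b| + 1 by rewrite ltr_wpDl.
pose d := e * g c / (`|f b| + 1).
have d0 : 0 < d by rewrite divr_gt0 // mulr_gt0.
exists d => // t; have gd : 0 < g t + d by rewrite ltr_wpDl.
have [ft|ft] := leP e `|f t|; last first.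
  apply: le_trans (ltW ft); rewrite ler_piMr // ler_pdivrMr // mul1r lerDr //.
rewrite mulrA ler_pdivrMr //.
have gt : g c <= g t by apply: cmin; rewrite inE.
have fb : `|f t| <= `|f b| by apply: bmax; rewrite inE.
apply: (@le_trans _ _ (e * g c)); last first.
  by rewrite ler_pM2l // (le_trans gt) // lerDl ltW.
rewrite /d mulrA ler_pdivrMr // mulrC ler_pM2l ?mulr_gt0 //.
by apply: le_trans fb _; rewrite lerDl.
Qed.

End RealFunctions.

(** * Even and odd functions on the circle *)

Section CircleFunctions.
Variable R : realType.
Local Notation circ := (circle R).
Implicit Types (z : circ) (f g : circ -> R).

Definition cre z : R := complex.Re (circle_val z).
Definition cim z : R := complex.Im (circle_val z).

Lemma circle_eq z : cre z ^+ 2 + cim z ^+ 2 = 1.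
Proof.
have := circle_valP z; rewrite normcE => /(congr1 (fun x => x ^+ 2)).
by rewrite expr1n sqr_sqrtr // addr_ge0 // sqr_ge0.
Qed.

Lemma circle_val_continuous : continuous (@circle_val R).
Proof. exact: initial_continuous. Qed.

Lemma cre_continuous : continuous cre.
Proof. exact: continuous_Re circle_val_continuous. Qed.

Lemma cim_continuous : continuous cim.
Proof. exact: continuous_Im circle_val_continuous. Qed.

Lemma cre1 : cre (circle1 R) = 1. Proof. by []. Qed.
Lemma cim1 : cim (circle1 R) = 0. Proof. by []. Qed.
Lemma cre_conj z : cre (circle_conj z) = cre z.
Proof. by rewrite /cre circle_conjE; case: (circle_val z). Qed.
Lemma cim_conj z : cim (circle_conj z) = - cim z.
Proof. by rewrite /cim circle_conjE; case: (circle_val z). Qed.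

Lemma circle_inj z t : cre z = cre t -> cim z = cim t -> z = t.
Proof.
by rewrite /cre /cim => h1 h2; apply: circle_val_inj; move: h1 h2;
  case: (circle_val z) (circle_val t) => a b [c d] /= -> ->.
Qed.

Lemma cre_itv z : -2 <= cre z - 1 <= 0.
Proof.
have := circle_eq z; have := sqr_ge0 (cim z) => h1 h2.
have : cre z ^+ 2 <= 1 by lra.
by nra.
Qed.

Lemma circle_point (a b : R) : a ^+ 2 + b ^+ 2 = 1 -> exists z, cre z = a /\ cim z = b.
Proof.
move=> ab; have n1 : `|Complex a b : Rcomplex R| = 1 by rewrite normcE /= ab sqrtr1.
by exists (mk_circle n1).
Qed.

(* A section of [z |-> cre z - 1], extended to a continuous map on the line. *)
Lemma half_circle : exists2 c : R -> circ, continuous c &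
  forall z, c (cre z - 1) = z \/ c (cre z - 1) = circle_conj z.
Proof.
pose k (t : R) := 2^-1 * (`|t + 2| - `|t|).
have k1 t : k t ^+ 2 <= 1.
  have : -1 <= k t <= 1.
    have := ler_normD t 2; have := ler_normB (t + 2) 2.
    by rewrite addrK normr_nat /k; lra.
  by move: (k t) => x; nra.
have kc : continuous k.
  move=> t; apply: cvgM; first exact: cvg_cst.
  apply: cvgB; last by apply: cvg_norm; exact: cvg_id.
  by apply: cvg_norm; apply: cvgD; [exact: cvg_id|exact: cvg_cst].
have kE t : k t ^+ 2 + Num.sqrt (1 - k t ^+ 2) ^+ 2 = 1.
  by rewrite sqr_sqrtr ?subr_ge0 // addrC subrK.
have n1 t : `|Complex (k t) (Num.sqrt (1 - k t ^+ 2)) : Rcomplex R| = 1.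
  by rewrite normcE /= kE sqrtr1.
exists (fun t => mk_circle (n1 t)).
  apply: (@continuous_comp_initial circ R (Rcomplex R) (@set_val _ (@circle_set R))).
  apply: continuous_Complex => //; apply: continuous_sqrt.
  apply: continuous_add; first exact: cst_continuous.
  by apply: continuous_opp; exact: continuous_mul.
move=> z; have kz : k (cre z - 1) = cre z.
  have := cre_itv z => /andP[z1 z2].
  by rewrite /k ger0_norm ?ler0_norm //; lra.
have sz : Num.sqrt (1 - k (cre z - 1) ^+ 2) = `|cim z|.
  by rewrite kz -(circle_eq z) addrC addKr sqrtr_sqr.
have [z0|z0] := leP 0 (cim z); [left|right]; apply: circle_inj.
- by rewrite /cre /= kz.
- by rewrite {1}/cim /= sz ger0_norm.
- by rewrite cre_conj {1}/cre /= kz.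
- by rewrite cim_conj {1}/cim /= sz ltr0_norm.
Qed.

Lemma even_weierstrass g (e : R) : continuous g -> (forall z, g (circle_conj z) = g z) ->
  0 < e -> exists p : {poly R}, forall z, `|g z - p.[cre z - 1]| <= e.
Proof.
move=> gc ge e0; have [c cc cP] := half_circle.
have gE z : g z = g (c (cre z - 1)) by case: (cP z) => ->; rewrite ?ge.
have ab : (-2 : R) < 0 by lra.
have [|p pP] := @weierstrass R (fun t => g (c t)) e (-2) 0 _ e0 ab.
  by move=> t; apply: continuous_comp; [exact: cc|exact: gc].
by exists p => z; rewrite gE; exact: pP (cre_itv z).
Qed.

Lemma even_approx g (e : R) : continuous g -> (forall z, g (circle_conj z) = g z) ->
  g (circle1 R) = 0 -> 0 < e ->
  exists p : {poly R}, forall z, `|g z - (cre z - 1) * p.[cre z - 1]| <= e.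
Proof.
move=> gc ge g1 e0; have e20 : 0 < e / 2 by rewrite divr_gt0.
have [p pP] := even_weierstrass gc ge e20.
have [|q pq] := factor_theorem (p - (p.[0])%:P) 0 _.
  by rewrite /root !hornerE subrr.
exists q => z.
have -> : (cre z - 1) * q.[cre z - 1] = p.[cre z - 1] - p.[0].
  have := congr1 (fun r : {poly R} => r.[cre z - 1]) pq.
  by rewrite hornerM !hornerD !hornerN !hornerC hornerX subr0 mulrC => <-.
have h1 := pP z; have h2 := pP (circle1 R); rewrite g1 cre1 subrr sub0r normrN in h2.
have := ler_normD (g z - p.[cre z - 1]) p.[0].
by rewrite opprB [p.[0] - _]addrC addrA; lra.
Qed.

(** The quotient of $f$ by $\mathrm{Im}\,z$ need not be continuous at $\pm1$. As $f$ vanishes there,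
    the even continuous function $f\,\mathrm{Im}\,z/((\mathrm{Im}\,z)^2+d)$ replaces it. *)
Lemma odd_approx f (e : R) : continuous f -> (forall z, f (circle_conj z) = - f z) ->
  0 < e -> exists q : {poly R}, forall z, `|f z - cim z * q.[cre z - 1]| <= e.
Proof.
move=> fc fo e0; have e20 : 0 < e / 2 by rewrite divr_gt0.
have c2 : continuous (fun z => cim z ^+ 2).
  by apply: continuous_mul; exact: cim_continuous.
have [||d d0 dP] := small_ratio (circle1 R) (@circle_compact R) fc c2 _ _ e20.
- by move=> z; exact: sqr_ge0.
- move=> z /eqP; rewrite sqrf_eq0 => /eqP z0.
  have := fo z; have -> : circle_conj z = z.
    by apply: circle_inj; rewrite ?cre_conj // cim_conj z0 oppr0.
  lra.
have cd z : 0 < cim z ^+ 2 + d by rewrite ltr_wpDl ?sqr_ge0.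
pose g z := f z * cim z / (cim z ^+ 2 + d).
have gc : continuous g.
  apply: continuous_mul; first by apply: continuous_mul => //; exact: cim_continuous.
  apply: continuous_inv; last by move=> z; rewrite lt0r_neq0.
  by apply: continuous_add => //; exact: cst_continuous.
have ge z : g (circle_conj z) = g z.
  by rewrite /g fo cim_conj sqrrN mulrNN.
have [q qP] := even_weierstrass gc ge e20.
exists q => z; have h1 := qP z.
have h2 : `|f z - cim z * g z| <= e / 2.
  apply: le_trans (dP z); rewrite -[d / _]ger0_norm ?divr_ge0 ?(ltW d0) ?(ltW (cd z)) //.
  rewrite -normrM /g le_eqVlt; apply/orP; left; apply/eqP; congr `|_|.
  by field; exact: (lt0r_neq0 (cd z)).
have c1 : `|cim z| <= 1.
  by have := circle_eq z; have := sqr_ge0 (cre z); rewrite ler_norml; nra.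
have := ler_normD (f z - cim z * g z) (cim z * (g z - q.[cre z - 1])).
rewrite [`|cim z * (_ - _)|]normrM mulrBr addrA subrK.
have := ler_wpM2r (normr_ge0 (g z - q.[cre z - 1])) c1; lra.
Qed.

End CircleFunctions.

(** * The universal pairs of $A_{-1}$ and $A_1$ *)

Section RealCircle.
Variable R : realType.
Local Notation circ := (circle R).

Lemma complexP (v w : Rcomplex R) :
  complex.Re v = complex.Re w -> complex.Im v = complex.Im w -> v = w.
Proof. by case: v w => a b [c d] /= -> ->. Qed.

Lemma eval_hom (F : realCstarType R) (S : fun_algebra F) (z : circ) :
  star_hom (fun f : fun_alg S => f z : F).
Proof. by split. Qed.

Lemma circle_conj_continuous : continuous (@circle_conj R).
Proof.
apply: (@continuous_comp_initial circ circ (Rcomplex R) (@set_val _ (@circle_set R))).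
rewrite (_ : _ \o _ = fun z => Complex (cre z) (- cim z) : Rcomplex R).
  apply: continuous_Complex; first exact: cre_continuous.
  by apply: continuous_opp; exact: cim_continuous.
apply/funext => z /=; rewrite -[set_val _]/(circle_val (circle_conj z)) circle_conjE.
by rewrite /cre /cim; case: (circle_val z).
Qed.

Lemma calc_scalar (D : realCstarType R) (e y : D) (t : R) (r : {poly R} * {poly R}) :
  left_id e (@amul R D) -> right_id e (@amul R D) ->
  calc (t *: e) y r = (t * r.1.[t]) *: e + r.2.[t] *: y.
Proof.
(* [D] has the unit [e]; [chi] is the homomorphism from its unitization that sends the adjoined unit
   to [e]. *)
move=> le re; pose chi (u : unital D) : D := (u.1 : R) *: e + u.2.
have chiD u v : chi (u + v) = chi u + chi v by rewrite /chi /= scalerDl addrACA.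
have chiM u v : chi (u * v) = chi u ** chi v.
  rewrite /chi /= !(amulDl, amulDr) !(amulZl, amulZr) le re scalerA le.
  by rewrite !addrA [u.1 * v.1]mulrC.
have chi_emb x : chi (emb x) = x by rewrite /chi /= scale0r add0r.
have chiC (c : R) : chi (c%:A) = c *: e.
  by rewrite /chi /= scaler0 addr0; congr (_ *: _); exact: mulr1.
have chi_ev (p : {poly R}) : chi (horner_alg (emb (t *: e)) p) = p.[t] *: e.
  elim/poly_ind: p => [|p c IH]; first by rewrite rmorph0 horner0 scale0r /chi /= scale0r addr0.
  rewrite rmorphD /= ev_mul horner_algX horner_algC hornerD hornerM hornerX hornerC.
  by rewrite chiD chiM chiC chi_emb IH amulZl amulZr le scalerA scalerDl.
apply: (etrans (esym (chi_emb _))); apply: (etrans (congr1 chi (calc_emb _ y r))).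
apply: (etrans (chiD _ _)); apply: (congr2 +%R); apply: (etrans (chiM _ _)).
  by apply: (etrans (congr2 _ (chi_emb _) (chi_ev _))); rewrite amulZl amulZr le scalerA.
by apply: (etrans (congr2 _ (chi_emb _) (chi_ev _))); rewrite amulZr re.
Qed.

Lemma Am1_h_proof : Am1_set (fun z => (cre z - 1 : R^o)).
Proof.
split; last by rewrite cre1 subrr.
by apply: continuous_add; [exact: cre_continuous|exact: cst_continuous].
Qed.

Lemma Am1_y_proof : Am1_set (fun z => (cim z : R^o)).
Proof. by split; [exact: cim_continuous|rewrite cim1]. Qed.

Definition Am1_h : Am1 R := FunAlg (Am1_h_proof : fun_set (Am1_algebra R) _).
Definition Am1_y : Am1 R := FunAlg (Am1_y_proof : fun_set (Am1_algebra R) _).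

Lemma Am1_calc r z : (calc Am1_h Am1_y r) z =
  (cre z - 1) * r.1.[cre z - 1] + cim z * r.2.[cre z - 1].
Proof.
rewrite (hom_calc Am1_h Am1_y r (eval_hom (Am1_algebra R) z)).
have e1 : Am1_h z = (cre z - 1) *: (1 : R^o) by exact: (esym (mulr1 _)).
rewrite e1 calc_scalar; [|exact: mul1r|exact: mulr1].
by rewrite [cim z * _]mulrC; congr (_ + _); exact: mulr1.
Qed.

(** For density, the even part of a function is approximated by $hp(h)$ and the odd part by $yq(h)$.
    The bound holds because every point $(1+t,\eta)$ of the circle is a value of $(1+h,y)$. *)
Lemma Am1_universal : universal_pair false Am1_h Am1_y.
Proof.
split.
- split; apply: fun_algP => z //.
  + by rewrite /= scale1r.
  + exact: mulrC.
  have := circle_eq z => c; rewrite /= scale1r.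
  have -> : cre z - 1 + (cre z - 1) + (cre z - 1) * (cre z - 1) + cim z * cim z =
    cre z ^+ 2 + cim z ^+ 2 - 1 by ring.
  by rewrite c subrr.
- move=> f e e0; have e20 : 0 < e / 2 by rewrite divr_gt0.
  have [fc f1] := fun_valP f.
  have fcc : continuous (fun z => fun_val f (circle_conj z) : R).
    by move=> z; apply: continuous_comp; [exact: circle_conj_continuous|exact: fc].
  pose g z : R := 2^-1 * (fun_val f z + fun_val f (circle_conj z)).
  pose k z : R := 2^-1 * (fun_val f z - fun_val f (circle_conj z)).
  have [|||p pP] := @even_approx R g (e / 2) _ _ _ e20.
  + apply: continuous_mul; first exact: cst_continuous.
    exact: continuous_add.
  + by move=> z; rewrite /g circle_conjK addrC.
  + by rewrite /g circle_conj1 f1 addr0 mulr0.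
  have [||q qP] := @odd_approx R k (e / 2) _ _ e20.
  + apply: continuous_mul; first exact: cst_continuous.
    by apply: continuous_add => //; exact: continuous_opp.
  + by move=> z; rewrite /k circle_conjK -mulrN opprB.
  exists (p, q); rewrite fun_alg_normE; apply: fun_norm_le => z.
  rewrite fun_valB Am1_calc /=.
  have := ler_normD (g z - (cre z - 1) * p.[cre z - 1]) (k z - cim z * q.[cre z - 1]).
  have -> : g z - (cre z - 1) * p.[cre z - 1] + (k z - cim z * q.[cre z - 1]) =
     fun_val f z - ((cre z - 1) * p.[cre z - 1] + cim z * q.[cre z - 1]).
    by rewrite /g /k; field.
  by have := pP z; have := qP z; lra.
- move=> r t eta etaE.
  have [|z [z1 z2]] := @circle_point R (1 + t) eta; first by rewrite etaE; ring.
  have := fun_norm_ub (calc Am1_h Am1_y r) z.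
  by rewrite Am1_calc z1 z2 (_ : 1 + t - 1 = t) //; ring.
Qed.

Lemma A1_h_proof : A1_set (fun z => (Complex (cre z - 1) 0 : Rcomplex R)).
Proof.
split; last 2 first.
- by rewrite cre1 subrr.
- by move=> z; rewrite cre_conj /= oppr0.
apply: continuous_Complex; last exact: cst_continuous.
by apply: continuous_add; [exact: cre_continuous|exact: cst_continuous].
Qed.

Lemma A1_y_proof : A1_set (fun z => (Complex 0 (cim z) : Rcomplex R)).
Proof.
split; last 2 first.
- by rewrite cim1.
- by move=> z; rewrite cim_conj.
by apply: continuous_Complex; [exact: cst_continuous|exact: cim_continuous].
Qed.

Definition A1_h : A1 R := FunAlg (A1_h_proof : fun_set (A1_algebra R) _).
Definition A1_y : A1 R := FunAlg (A1_y_proof : fun_set (A1_algebra R) _).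

Lemma A1_calc r z : (calc A1_h A1_y r) z =
  Complex ((cre z - 1) * r.1.[cre z - 1]) (cim z * r.2.[cre z - 1]) :> Rcomplex R.
Proof.
rewrite (hom_calc A1_h A1_y r (eval_hom (A1_algebra R) z)).
have e1 : A1_h z = (cre z - 1) *: (Complex 1 0 : Rcomplex R).
  by apply: complexP; rewrite /= ?mulr1 ?mulr0.
rewrite e1 calc_scalar => [|[a b]|[a b]]; by apply: complexP => /=; ring.
Qed.

(** The condition $f(\overline z)=\overline{f(z)}$ makes the real part even and the imaginary part
    odd, so each is approximated by one coordinate of the calculus. *)
Lemma A1_universal : universal_pair true A1_h A1_y.
Proof.
split.
- split; apply: fun_algP => z //=.
  + by apply: complexP; rewrite //= oppr0.
  + by rewrite scaleN1r; apply: complexP; rewrite //= oppr0.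
  + exact: mulrC.
  have := circle_eq z => c; rewrite expr1 scaleN1r; apply: complexP => /=; last by ring.
  rewrite [RHS](_ : 0 = cre z ^+ 2 + cim z ^+ 2 - 1); first by ring.
  by rewrite c subrr.
- move=> f e e0; have e20 : 0 < e / 2 by rewrite divr_gt0.
  have [fc f1 fs] := fun_valP f.
  pose g z := complex.Re (fun_val f z); pose k z := complex.Im (fun_val f z).
  have [|||p pP] := @even_approx R g (e / 2) _ _ _ e20.
  + exact: continuous_Re.
  + by move=> z; rewrite /g fs; case: (fun_val f z).
  + by rewrite /g f1.
  have [||q qP] := @odd_approx R k (e / 2) _ _ e20.
  + exact: continuous_Im.
  + by move=> z; rewrite /k fs; case: (fun_val f z).
  exists (p, q); rewrite fun_alg_normE; apply: fun_norm_le => z.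
  rewrite fun_valB A1_calc /=; apply: le_trans (norm_le_ReIm _) _.
  have := pP z; have := qP z; rewrite /g /k; case: (fun_val f z) => a b /=; lra.
- move=> r t eta etaE.
  have [|z [z1 z2]] := @circle_point R (1 + t) eta; first by rewrite etaE; ring.
  have := fun_norm_ub (calc A1_h A1_y r) z.
  rewrite A1_calc z1 z2 (_ : 1 + t - 1 = t); last by ring.
  rewrite normcE /= -fun_alg_normE => h.
  rewrite -[X in X <= _]sqr_sqrtr ?addr_ge0 ?sqr_ge0 //.
  by rewrite lerXn2r ?nnegrE ?sqrtr_ge0.
Qed.

End RealCircle.

Theorem semiprojective_Am1 (R : realType) : semiprojective (Am1 R).
Proof. exact: universal_semiprojective (@Am1_universal R). Qed.

Theorem semiprojective_A1 (R : realType) : semiprojective (A1 R).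
Proof. exact: universal_semiprojective (@A1_universal R). Qed.

(** * Square roots as limits of polynomials *)

Section SquareRoots.
Variable R : realType.

Fixpoint sqrt_poly n : {poly R} :=
  if n is n'.+1 then sqrt_poly n' + 2^-1 *: ('X - sqrt_poly n' ^+ 2) else 0.

Lemma sqrt_poly0 n : (sqrt_poly n).[0] = 0.
Proof.
elim: n => [|n IH]; first by rewrite horner0.
by rewrite /= hornerD hornerZ hornerD hornerN hornerX horner_exp IH expr0n subrr mulr0 addr0.
Qed.

(** One step multiplies the error $d=u-q$ by $1-(u+q)/2\le 1-u/2$. This yields $d\le 2u/(2+nu)$, a
    rate that is uniform down to $u=0$. *)
Lemma sqrt_poly_bound n (u : R) : 0 <= u <= 1 -> let d := u - (sqrt_poly n).[u ^+ 2] in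
  [/\ 0 <= d, d <= u & d * (2 + n%:R * u) <= 2 * u].
Proof.
move=> /andP[u0 u1]; elim: n => [|n [d0 du IH]] /=.
  by rewrite horner0 subr0 mul0r addr0 mulrC.
rewrite hornerD hornerZ hornerD hornerN hornerX horner_exp.
move: ((sqrt_poly n).[u ^+ 2]) d0 du IH => q; rewrite -/(u - q).
set d := u - q => d0 du IH.
have -> : u - (q + 2^-1 * (u ^+ 2 - q ^+ 2)) = d * (1 - 2^-1 * (u + u - d)).
  by rewrite /d; field.
have f0 : 0 <= 1 - 2^-1 * (u + u - d) by lra.
have f1 : 1 - 2^-1 * (u + u - d) <= 1 - 2^-1 * u by lra.
split.
- exact: mulr_ge0.
- apply: le_trans du; rewrite ler_piMr //; lra.
apply: le_trans IH; rewrite -mulrA ler_wpM2l //.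
have n0 : 0 <= n%:R :> R by [].
apply: (@le_trans _ _ ((1 - 2^-1 * u) * (2 + n.+1%:R * u))).
  by rewrite ler_wpM2r // addr_ge0 // mulr_ge0.
rewrite -[n.+1%:R]natr1; have nu := mulr_ge0 n0 (sqr_ge0 u); have uu := sqr_ge0 u.
have -> : (1 - 2^-1 * u) * (2 + (n%:R + 1) * u) =
  2 + n%:R * u - 2^-1 * (n%:R * u ^+ 2) - 2^-1 * u ^+ 2 by field.
lra.
Qed.

(** Along powers of two the error $O(1/n)$ becomes geometric, as [cvg_geometric_increments]
    requires. *)
Definition root_poly n := sqrt_poly (2 ^ n).

Lemma root_poly_approx n (u : R) : 0 <= u <= 1 ->
  `|u - (root_poly n).[u ^+ 2]| <= 2 * 2^-1 ^+ n.
Proof.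
move=> u01; have [d0 du dn] := sqrt_poly_bound (2 ^ n) u01; have /andP[u0 u1] := u01.
rewrite ger0_norm //; rewrite -/(root_poly n) in d0 du dn *.
move: (u - _) d0 du dn => d d0 du; rewrite natrX exprVn.
have p0 : 0 < (2 : R) ^+ n by rewrite exprn_gt0.
rewrite -[_ / _]/(2 / 2 ^+ n) ler_pdivlMr // => dn.
have [u00|un] := eqVneq u 0.
  have -> : d = 0 by apply/le_anti; rewrite d0 andbT -u00.
  by rewrite mul0r.
have ugt : 0 < u by rewrite lt0r un.
by rewrite -(ler_pM2r ugt) -mulrA; move: dn; rewrite mulrDr; lra.
Qed.

Section Algebra.
Variable D : realCstarType R.
Implicit Types (a b c t r x : D).
Local Notation ev u := (@horner_alg R (unital D) (emb u)).

Definition root_seq t n : D := (ev t (root_poly n)).2.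

Lemma ev_fst t (p : {poly R}) : (ev t p).1 = p.[0].
Proof.
elim/poly_ind: p => [|p c IH]; first by rewrite rmorph0 horner0.
rewrite rmorphD /= ev_mul horner_algX horner_algC hornerD hornerM hornerX hornerC mulr0.
by rewrite unital_fst_mul mulr0; congr (_ + _); exact: mulr1.
Qed.

Lemma emb_root_seq t n : emb (root_seq t n) = ev t (root_poly n).
Proof. by apply: emb_snd; rewrite ev_fst sqrt_poly0. Qed.

(** Taking the root as this very limit makes it unique, preserved by homomorphisms and commuting
    with whatever commutes with [t]. *)
Definition is_root t r := root_seq t @ \oo --> r.

Let S : set R := [set s | 0 <= s <= 1].

Let S0 : S !=set0. Proof. by exists 0; rewrite /S /= lexx ler01. Qed.

Let root_approx n s : S s -> `|Num.sqrt s - (root_poly n).[s]| <= 2 * 2^-1 ^+ n.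
Proof.
move=> /= /andP[s0 s1]; rewrite -{2}(sqr_sqrtr s0); apply: root_poly_approx.
by rewrite sqrtr_ge0 -sqrtr1 ler_wsqrtr.
Qed.

Lemma is_root_exists a : `|star a ** a| <= 1 -> exists r, is_root (star a ** a) r.
Proof.
move=> a1; apply/cvg_ex; set t := star a ** a.
apply: (@cvg_geometric_increments _ _ _ 4 2^-1); first lra.
move=> n; apply: (norm_poly_le (star_amul_self a) (spectrum_star a1) S0
    (p := root_poly n.+1 - root_poly n)).
  by rewrite embB !emb_root_seq rmorphB.
move=> s Ss; rewrite hornerD hornerN.
have := root_approx n Ss; have := root_approx n.+1 Ss; rewrite exprS.
have := ler_normB (Num.sqrt s - (root_poly n).[s]) (Num.sqrt s - (root_poly n.+1).[s]).
rewrite opprB [Num.sqrt s - _ + _]addrC addrA subrK.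
have : 0 <= (2 : R)^-1 ^+ n by rewrite exprn_ge0 // invr_ge0.
lra.
Qed.

Lemma is_root_star a r : is_root (star a ** a) r -> star r = r.
Proof.
move=> ar; apply: (lim_unique (cvg_star ar) ar) => n; apply: emb_inj.
by rewrite -ustar_emb emb_root_seq ustar_ev // star_amul_self.
Qed.

Lemma is_root_comm t r x : is_root t r -> t ** x = x ** t -> r ** x = x ** r.
Proof.
move=> tr tx.
apply: (lim_unique (cvg_amul tr (cvg_cst x)) (cvg_amul (cvg_cst x) tr)) => n.
apply: emb_inj; rewrite !embM emb_root_seq.
elim/poly_ind: (root_poly n) => [|p c IH]; first by rewrite rmorph0 mulr0 mul0r.
rewrite rmorphD /= ev_mul horner_algX horner_algC mulrDl mulrDr mulrA -IH.
by rewrite -!mulrA -!embM tx mulr_algr mulr_algl.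
Qed.

Lemma is_root_sqr a r : `|star a ** a| <= 1 -> is_root (star a ** a) r ->
  r ** r = star a ** a.
Proof.
move=> a1 ar; apply/eqP; rewrite -subr_eq0; apply/eqP.
have q1 : 0 <= (2 : R)^-1 < 1 by lra.
pose u n := root_seq (star a ** a) n ** root_seq (star a ** a) n - star a ** a.
have u0 : u @ \oo --> r ** r - star a ** a.
  by apply: cvgB; [exact: cvg_amul|exact: cvg_cst].
apply: (lim_unique u0 (@cvg0_geometric _ _ u 4 _ q1 _)) => // n.
apply: (norm_poly_le (star_amul_self a) (spectrum_star a1) S0
    (p := root_poly n * root_poly n - 'X)).
  by rewrite embB embM emb_root_seq rmorphB /= ev_mul horner_algX.
move=> s Ss; rewrite hornerD hornerN hornerM hornerX.
have := root_approx n Ss; have /= /andP[s0 s1] := Ss.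
have u01 : 0 <= Num.sqrt s <= 1 by rewrite sqrtr_ge0 -sqrtr1 ler_wsqrtr.
have [d0 du _] := sqrt_poly_bound (2 ^ n) u01; rewrite sqr_sqrtr // -/(root_poly n) in d0 du.
have sx : s = Num.sqrt s * Num.sqrt s by rewrite -expr2 sqr_sqrtr.
move: (Num.sqrt s) (_.[s]) sx d0 du u01 => x y -> d0 du x01.
have -> : y * y - x * x = - ((x - y) * (x + y)) by ring.
rewrite normrN normrM !ger0_norm //; last lra.
by nra.
Qed.

(** This recognises the image of a root in another algebra; positivity of [b] is given by an
    explicit factorisation. *)
Lemma is_root_square b c : b = star c ** c -> `|b| <= 1 -> is_root (b ** b) b.
Proof.
move=> bc b1; have q1 : 0 <= (2 : R)^-1 < 1 by lra.
have d0 : (fun n => root_seq (b ** b) n - b) @ \oo --> (0 : D).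
  apply: (@cvg0_geometric _ _ _ 2 _ q1) => n.
  have bS : spectrum_in b S by rewrite bc; apply: spectrum_star; rewrite -bc.
  have bb : star b = b by rewrite bc star_amul_self.
  apply: (norm_poly_le bb bS S0 (p := root_poly n \Po 'X ^+ 2 - 'X)).
    rewrite embB emb_root_seq rmorphB /= horner_algX; congr (_ - _).
    elim/poly_ind: (root_poly n) => [|p k IH]; first by rewrite comp_poly0 !rmorph0.
    rewrite comp_polyD comp_polyM comp_polyX comp_polyC !rmorphD /= !ev_mul -IH.
    by rewrite !horner_algC ?expr2 ?ev_mul !horner_algX embM.
  move=> s /= s01; rewrite hornerD hornerN horner_comp horner_exp hornerX.
  by rewrite distrC root_poly_approx.
have : (fun n => root_seq (b ** b) n - b + b) @ \oo --> 0 + b.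
  by apply: cvgD => //; exact: cvg_cst.
by rewrite add0r; under eq_fun do rewrite subrK.
Qed.

End Algebra.

Lemma ev_calc (D : realCstarType R) (t y : D) (q : {poly R}) :
  (horner_alg (emb t) (q * 'X)).2 = calc t y (q, 0).
Proof.
apply: emb_inj; rewrite calc_emb emb_snd; last by rewrite ev_fst hornerM hornerX mulr0.
by rewrite [(_, _).1]/= [(_, _).2]/= rmorph0 mulr0 addr0 ev_X mulrC.
Qed.

Lemma ev_hom (D D' : realCstarType R) (f : D -> D') (t : D) (p : {poly R}) :
  star_hom f -> p.[0] = 0 ->
  f (horner_alg (emb t) p).2 = (horner_alg (emb (f t)) p).2.
Proof.
move=> fh p0; have [|q pq] := factor_theorem p 0 _; first by rewrite /root p0.
by rewrite subr0 in pq; rewrite {p0}pq (ev_calc t 0) (ev_calc (f t) (f 0)) hom_calc.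
Qed.

Lemma is_root_hom (D D' : realCstarType R) (f : D -> D') (t r : D) :
  star_hom f -> is_root t r -> is_root (f t) (f r).
Proof.
move=> fh tr; have := hom_cvg fh tr.
have -> : (fun n => f (root_seq t n)) = root_seq (f t); last by [].
by apply/funext => n; rewrite /root_seq ev_hom // sqrt_poly0.
Qed.

End SquareRoots.

(** * Quaternionic cones and their commutants *)

Section QuaternionCone.
Context (R : realType).
Local Notation H := (quaternion R).

Definition quat1 : H := Quat 1 0 0 0.

Lemma quat_mul1l (q : H) : quat1 ** q = q.
Proof. by apply: quatP => /=; ring. Qed.

Lemma quat_mul1r (q : H) : q ** quat1 = q.
Proof. by apply: quatP => /=; ring. Qed.

Lemma quat_star1 : star quat1 = quat1.
Proof. by apply: quatP => /=; ring. Qed.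

Lemma quat_star_mul (q : H) : star q ** q = (`|q| ^+ 2) *: quat1.
Proof.
have -> : `|q| ^+ 2 = qre q ^+ 2 + qi q ^+ 2 + qj q ^+ 2 + qk q ^+ 2.
  by rewrite quat_normE sqr_sqrtr // !addr_ge0 ?sqr_ge0.
by apply: quatP => /=; ring.
Qed.

Definition quat_basis (e : 'I_4) : H :=
  Quat (e == 0 :> nat)%:R (e == 1 :> nat)%:R (e == 2 :> nat)%:R (e == 3 :> nat)%:R.

Definition quat_coord (q : H) (e : 'I_4) : R := [:: qre q; qi q; qj q; qk q]`_e.

Lemma sum_ord4 (V : nmodType) (f : 'I_4 -> V) :
  \sum_e f e = f (inord 0) + f (inord 1) + f (inord 2) + f (inord 3).
Proof.
rewrite !big_ord_recl big_ord0 addr0 !addrA.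
by congr (_ + _ + _ + _); congr f; apply: val_inj; rewrite /= inordK.
Qed.

Lemma quat_expand (q : H) : q = \sum_e quat_coord q e *: quat_basis e.
Proof.
rewrite sum_ord4 /quat_coord /quat_basis !inordK //=; apply: quatP => /=; ring.
Qed.

(** The coordinates are the inner products $\langle q,pe\rangle$ and $\langle q,p\overline
    e\rangle$, and the sign in $\overline e=\pm e$ cancels. In tensor form: $\sum_e
    qe\otimes\overline e=\sum_p p\otimes\overline p q$. *)
Lemma quat_coord_adjoint (q : H) (e p : 'I_4) :
  quat_coord (star (quat_basis p) ** q) e *: quat_basis e =
  quat_coord (q ** quat_basis e) p *: star (quat_basis e).
Proof.
case: e => -[|[|[|[|//]]]] ?; case: p => -[|[|[|[|//]]]] ?;
  by apply: quatP; rewrite /quat_coord /quat_basis /=; ring.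
Qed.

Lemma quat_sum_star : \sum_e (quat_basis e ** star (quat_basis e)) = 4 *: quat1.
Proof.
rewrite sum_ord4 /quat_basis !inordK //=; apply: quatP => /=; ring.
Qed.

Context (D : realCstarType R).
Implicit Types (a b c d x : D) (p q : H).

(* The images of [s (x) q], where [s] is a positive generator of the cone [C_0((0,1])]. *)
Definition quat_cone (k : H -> D) : Prop :=
  [/\ forall r p q, k (r *: p + q) = r *: k p + k q,
      forall p q, k p ** k q = k quat1 ** k (p ** q),
      forall q, star (k q) = k (star q) &
      exists a, k quat1 = star a ** a].

Lemma amul_suml (f : 'I_4 -> D) b : (\sum_e f e) ** b = \sum_e f e ** b.
Proof. by rewrite !sum_ord4 !amulDl. Qed.

Lemma amul_sumr (f : 'I_4 -> D) b : b ** (\sum_e f e) = \sum_e b ** f e.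
Proof. by rewrite !sum_ord4 !amulDr. Qed.

Lemma cvg_sum4 (u : 'I_4 -> nat -> D) (l : 'I_4 -> D) :
  (forall e, u e @ \oo --> l e) -> (fun n => \sum_e u e n) @ \oo --> \sum_e l e.
Proof.
move=> ul; rewrite sum_ord4; under eq_fun do rewrite sum_ord4.
by apply: cvgD => //; apply: cvgD => //; apply: cvgD.
Qed.

Section Cone.
Context (k : H -> D) (kk : quat_cone k).
Local Notation U := (unital D).
Local Notation t := (k quat1).

Lemma coneD p q : k (p + q) = k p + k q.
Proof. by case: kk => kl _ _ _; exact: linear_add. Qed.

Lemma coneZ r q : k (r *: q) = r *: k q.
Proof. by case: kk => kl _ _ _; exact: linear_scale. Qed.

Lemma coneM p q : k p ** k q = t ** k (p ** q). Proof. by case: kk. Qed.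
Lemma cone_star q : star (k q) = k (star q). Proof. by case: kk. Qed.
Lemma cone_comm q : k q ** t = t ** k q.
Proof. by rewrite coneM quat_mul1r. Qed.

Lemma cone_regular_exists n : exists v : U,
  (emb t + (2^-1 ^+ n)%:A) * v = 1 /\ v * (emb t + (2^-1 ^+ n)%:A) = 1.
Proof.
case: kk => _ _ _ [a ta]; rewrite ta addrC; apply: invertible_pos.
by rewrite exprn_gt0 // invr_gt0.
Qed.

Definition cone_inv n : U := xget 0 [set v | (emb t + (2^-1 ^+ n)%:A) * v = 1 /\
  v * (emb t + (2^-1 ^+ n)%:A) = 1].

Lemma cone_invP n : (emb t + (2^-1 ^+ n)%:A) * cone_inv n = 1 /\
  cone_inv n * (emb t + (2^-1 ^+ n)%:A) = 1.
Proof.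
have [v vP] := cone_regular_exists n; rewrite /cone_inv.
by case: xgetP => [y _ //|/(_ v)].
Qed.

Lemma cone_inv_comm n q : cone_inv n * emb (k q) = emb (k q) * cone_inv n.
Proof.
have [h1 h2] := cone_invP n; apply: (inv_comm h1 h2).
by rewrite mulrDl mulrDr -!embM cone_comm mulr_algl mulr_algr.
Qed.

Lemma cone_inv_star n : ustar (cone_inv n) = cone_inv n.
Proof.
have [h1 h2] := cone_invP n.
have e : ustar (emb t + (2^-1 ^+ n)%:A) = emb t + (2^-1 ^+ n)%:A :> U.
  by rewrite ustarD ustarZ ustar1 ustar_emb cone_star quat_star1.
have := congr1 (@ustar R D) h1; rewrite ustarM e ustar1 => h3.
by rewrite -[LHS]mulr1 -h1 mulrA h3 mul1r.
Qed.

(* [s q / (s + 2^-n)], approximating the quaternion [q] on the support of [s] *)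
Definition cone_unit n q : D := (emb (k q) * cone_inv n).2.

Lemma emb_cone_unit n q : emb (cone_unit n q) = emb (k q) * cone_inv n.
Proof. exact: emb_mulr_snd. Qed.

Lemma cone_unitD n p q : cone_unit n (p + q) = cone_unit n p + cone_unit n q.
Proof. by apply: emb_inj; rewrite [RHS]embD !emb_cone_unit coneD embD mulrDl. Qed.

Lemma cone_unitZ n r q : cone_unit n (r *: q) = r *: cone_unit n q.
Proof. by apply: emb_inj; rewrite [RHS]embZ !emb_cone_unit coneZ embZ scalerAl. Qed.

Lemma cone_unitM n m p q : cone_unit n p ** cone_unit m q =
  cone_unit n quat1 ** cone_unit m (p ** q).
Proof.
apply: emb_inj; rewrite !embM !emb_cone_unit !mulrA -!(mulrA _ (cone_inv n)) !cone_inv_comm.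
by rewrite !mulrA -!embM coneM.
Qed.

Lemma cone_unit_star n q : star (cone_unit n q) = cone_unit n (star q).
Proof.
apply: emb_inj; rewrite -ustar_emb !emb_cone_unit ustarM cone_inv_star ustar_emb cone_star.
exact: cone_inv_comm.
Qed.

Lemma cone_unit_mul n p q : k p ** cone_unit n q = t ** cone_unit n (p ** q).
Proof. by apply: emb_inj; rewrite !embM !emb_cone_unit !mulrA -!embM coneM. Qed.

Lemma cone_unit_mull n p q : cone_unit n p ** k q = t ** cone_unit n (p ** q).
Proof.
by apply: emb_inj; rewrite !embM !emb_cone_unit -mulrA cone_inv_comm !mulrA -!embM coneM.
Qed.

Lemma cone_unit_norm1 n : `|cone_unit n quat1| <= 1.
Proof.
case: (kk) => _ _ _ [a ta]; have tt : star t = t by rewrite ta star_amul_self.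
have tS : spectrum_in t [set s | 0 <= s <= `|t|].
  by rewrite ta; exact: spectrum_star.
have e0 : 0 < (2 : R)^-1 ^+ n by rewrite exprn_gt0 // invr_gt0.
apply: (norm_rational_le tt tS (p := 'X) (q := 'X + (2^-1 ^+ n)%:P)).
- by exists 0; rewrite /= lexx normr_ge0.
- by move=> s /= /andP[s0 _]; rewrite hornerD hornerX hornerC lt0r_neq0 // ltr_wpDl.
- rewrite emb_cone_unit -mulrA rmorphD /= horner_algX horner_algC.
  by rewrite (cone_invP n).2 mulr1.
move=> s /= /andP[s0 _]; rewrite hornerD hornerX hornerC mul1r !ger0_norm //.
  by rewrite lerDl ltW.
by rewrite addr_ge0 // ltW.
Qed.

Lemma cone_unit_norm n q : `|cone_unit n q| <= `|q|.
Proof.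
rewrite -(@ler_sqr R) ?nnegrE // -cstar_identity cone_unit_star cone_unitM quat_star_mul.
rewrite cone_unitZ amulZr normrZ ger0_norm ?sqr_ge0 //.
rewrite ler_piMr ?sqr_ge0 //; apply: le_trans (normr_amul _ _) _.
by rewrite mulr_ile1 // cone_unit_norm1.
Qed.

Lemma cone_unit_cvg q : (fun n => t ** cone_unit n q) @ \oo --> k q.
Proof.
have q1 : 0 <= (2 : R)^-1 < 1 by lra.
have d0 : (fun n => t ** cone_unit n q - k q) @ \oo --> (0 : D).
  apply: (@cvg0_geometric _ _ _ `|q| _ q1) => n.
  have -> : t ** cone_unit n q - k q = - (2^-1 ^+ n) *: cone_unit n q.
    apply: emb_inj; rewrite embB embM [RHS]embZ !emb_cone_unit.
    have [_ h] := cone_invP n.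
    rewrite mulrA -embM -cone_comm embM -mulrA -cone_inv_comm.
    rewrite -[emb (k q) in X in _ - X]mulr1 -h mulrDr cone_inv_comm.
    by rewrite mulrDr opprD addrA subrr add0r mulr_algr -scalerAr scaleNr.
  rewrite normrZ normrN ger0_norm ?exprn_ge0 ?invr_ge0 // mulrC.
  by rewrite ler_wpM2r ?exprn_ge0 ?invr_ge0 // cone_unit_norm.
have : (fun n => t ** cone_unit n q - k q + k q) @ \oo --> 0 + k q.
  by apply: cvgD => //; exact: cvg_cst.
by rewrite add0r; under eq_fun do rewrite subrK.
Qed.

(* [c] lies in the corner generated by [s] and commutes there with the quaternions;
   [act q c] is the product [q c]. *)
Definition act q c : D := lim ((fun n => cone_unit n q ** c) @ \oo).

(** Convergence is part of the definition, so the default value of [lim] never intervenes. One limit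
    for both sides encodes commutation, and [act quat1 c = c] places [c] in the corner. *)
Definition in_commutant c : Prop := act quat1 c = c /\ forall q,
  ((fun n => cone_unit n q ** c) @ \oo --> act q c) /\
  ((fun n => c ** cone_unit n q) @ \oo --> act q c).

Lemma in_commutantI c (m : H -> D) : m quat1 = c ->
  (forall q, (fun n => cone_unit n q ** c) @ \oo --> m q) ->
  (forall q, (fun n => c ** cone_unit n q) @ \oo --> m q) ->
  in_commutant c /\ forall q, act q c = m q.
Proof.
move=> m1 ml mr; have am q : act q c = m q by apply: cvg_lim => //; exact: ml.
by split=> //; split=> [|q]; rewrite am.
Qed.

Lemma commutant_mul c d : in_commutant c -> in_commutant d ->
  [/\ in_commutant (c ** d), forall q, act q (c ** d) = act q c ** d &
    forall q, act q (c ** d) = c ** act q d].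
Proof.
move=> [c1 cP] [d1 dP].
have e q : act q c ** d = c ** act q d.
  apply: (lim_unique (cvg_amul (cP q).2 (cvg_cst d)) (cvg_amul (cvg_cst c) (dP q).1)) => n.
  by rewrite amulA.
have [h1 h2] : in_commutant (c ** d) /\ forall q, act q (c ** d) = act q c ** d.
  apply: in_commutantI => [|q|q]; first by rewrite c1.
    by under eq_fun do rewrite amulA; apply: cvg_amul; [exact: (cP q).1|exact: cvg_cst].
  rewrite e; under eq_fun do rewrite -amulA.
  by apply: cvg_amul; [exact: cvg_cst|exact: (dP q).2].
by split=> // q; rewrite h2 e.
Qed.

Lemma commutant_star c : in_commutant c ->
  in_commutant (star c) /\ forall q, act q (star c) = star (act (star q) c).
Proof.
move=> [c1 cP]; apply: in_commutantI => [|q|q]; first by rewrite quat_star1 c1.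
  by have := cvg_star (cP (star q)).2; under eq_fun do rewrite starM cone_unit_star starK.
by have := cvg_star (cP (star q)).1; under eq_fun do rewrite starM cone_unit_star starK.
Qed.

Lemma commutant_linear r c d : in_commutant c -> in_commutant d ->
  in_commutant (r *: c + d) /\ forall q, act q (r *: c + d) = r *: act q c + act q d.
Proof.
move=> [c1 cP] [d1 dP]; apply: in_commutantI => [|q|q]; first by rewrite c1 d1.
  under eq_fun do rewrite amulDr amulZr.
  by apply: cvgD; [apply: cvg_scale; exact: (cP q).1|exact: (dP q).1].
under eq_fun do rewrite amulDl amulZl.
by apply: cvgD; [apply: cvg_scale; exact: (cP q).2|exact: (dP q).2].
Qed.

Lemma commutant0 : in_commutant 0.
Proof.
apply: (in_commutantI (m := fun=> 0) _ _ _).1 => // q.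
  by under eq_fun do rewrite amul0r; exact: cvg_cst.
by under eq_fun do rewrite amul0l; exact: cvg_cst.
Qed.

Lemma act_norm q c : in_commutant c -> `|act q c| <= `|q| * `|c|.
Proof.
move=> [_ cP]; apply: (norm_lim_le (cP q).1) => n.
by apply: le_trans (normr_amul _ _) _; rewrite ler_wpM2r // cone_unit_norm.
Qed.

Lemma act_linearl r p q c : in_commutant c -> act (r *: p + q) c = r *: act p c + act q c.
Proof.
move=> [_ cP].
apply: (lim_unique (cP (r *: p + q)).1 (cvgD (cvg_scale (k := r) (cP p).1) (cP q).1)) => n.
by rewrite cone_unitD cone_unitZ amulDl amulZl.
Qed.

Lemma act_mul p q c d : in_commutant c -> in_commutant d ->
  act p c ** act q d = act (p ** q) (c ** d).
Proof.
move=> cC dC; have [_ _ e] := commutant_mul cC dC; rewrite e.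
move: cC dC => [c1 cP] [d1 dP].
have h n : cone_unit n p ** act q d = cone_unit n quat1 ** act (p ** q) d.
  apply: (lim_unique (cvg_amul (cvg_cst (cone_unit n p)) (dP q).1)
    (cvg_amul (cvg_cst (cone_unit n quat1)) (dP (p ** q)).1)) => m.
  by rewrite !amulA cone_unitM.
have h2 : (fun n => c ** cone_unit n p ** act q d) @ \oo --> act p c ** act q d.
  by apply: cvg_amul; [exact: (cP p).2|exact: cvg_cst].
have h3 : (fun n => c ** cone_unit n quat1 ** act (p ** q) d) @ \oo --> c ** act (p ** q) d.
  by rewrite -{2}c1; apply: cvg_amul; [exact: (cP quat1).2|exact: cvg_cst].
by apply: (lim_unique h2 h3) => n; rewrite -!amulA h.
Qed.

Lemma cone_act q c : in_commutant c -> t ** act q c = k q ** c.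
Proof.
move=> [_ cP].
have h1 : (fun n => t ** (cone_unit n q ** c)) @ \oo --> t ** act q c.
  by apply: cvg_amul; [exact: cvg_cst|exact: (cP q).1].
have h2 : (fun n => t ** cone_unit n q ** c) @ \oo --> k q ** c.
  by apply: cvg_amul; [exact: cone_unit_cvg|exact: cvg_cst].
by apply: (lim_unique h1 h2) => n; rewrite amulA.
Qed.

(** The approximate quaternions [cone_unit n q] are bounded by $\|q\|$ uniformly in $n$, so their
    convergence on a sequence passes to its limit. *)
Lemma commutant_closed : closed in_commutant.
Proof.
move=> c cC; have q1 : 0 <= (2 : R)^-1 < 1 by lra.
have near_ex n : exists v, in_commutant v /\ `|c - v| <= 2^-1 ^+ n.
  have p0 : 0 < (2 : R)^-1 ^+ n by rewrite exprn_gt0 // invr_gt0.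
  have [v [vC]] := cC _ (nbhsx_ballx c _ p0); rewrite -ball_normE /= => /ltW.
  by exists v.
have [u uP] := choice near_ex.
have uc : u @ \oo --> c.
  have d0 : (fun n => c - u n) @ \oo --> (0 : D).
    by apply: (@cvg0_geometric _ _ _ 1 _ q1) => n; rewrite mul1r; exact: (uP n).2.
  have : (fun n => c - (c - u n)) @ \oo --> c - 0 by apply: cvgB => //; exact: cvg_cst.
  by rewrite subr0; under eq_fun do rewrite subKr.
have act_ex q : exists l : D, (fun n => act q (u n)) @ \oo --> l.
  suff : cvgn (fun n => act q (u n)) by move=> /cvg_ex.
  apply: (@cvg_geometric_increments _ _ _ (`|q| * 2) _ q1) => n.
  have [h e] := commutant_linear (-1) (uP n).1 (uP n.+1).1.
  have -> : act q (u n.+1) - act q (u n) = act q (-1 *: u n + u n.+1).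
    by rewrite e scaleN1r addrC.
  apply: le_trans (act_norm q h) _; rewrite -mulrA ler_wpM2l // scaleN1r.
  by rewrite addrC; apply: increments_le => j; exact: (uP j).2.
have [m mP] := choice act_ex.
(* [X] is the multiplication by an approximate quaternion, on either side. *)
have three (X : nat -> H -> D -> D) q : (forall n p x y, X n p x - X n p y = X n p (x - y)) ->
    (forall n p x, `|X n p x| <= `|p| * `|x|) ->
    (forall j, (fun n => X n q (u j)) @ \oo --> act q (u j)) ->
    (fun n => X n q c) @ \oo --> m q.
  move=> XB Xn Xc; apply/cvgrPdist_le => e e0.
  have e30 : 0 < e / 3 by rewrite divr_gt0.
  have q0 : 0 < `|q| + 1 by rewrite ltr_wpDl.
  have f0 : 0 < e / 3 / (`|q| + 1) by rewrite divr_gt0.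
  have n1 : \forall j \near \oo, `|c - u j| <= e / 3 / (`|q| + 1).
    by move/cvgrPdist_le: uc; exact.
  have n2 : \forall j \near \oo, `|m q - act q (u j)| <= e / 3.
    by move/cvgrPdist_le: (mP q); exact.
  have [j [j1 j2]] := filter_ex (filterI n1 n2).
  have := Xc j; move/cvgrPdist_le => /(_ _ e30); apply: filterS => n jn.
  have := ler_normD (m q - act q (u j)) (act q (u j) - X n q c); rewrite addrA subrK.
  have := ler_normD (act q (u j) - X n q (u j)) (X n q (u j) - X n q c); rewrite addrA subrK.
  rewrite XB; have := Xn n q (u j - c); rewrite [`|u j - c|]distrC.
  have : `|q| * `|c - u j| <= e / 3.
    apply: le_trans (ler_wpM2r (normr_ge0 _) _) (_ : (`|q| + 1) * _ <= _); first by rewrite lerDl.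
    by rewrite -ler_pdivlMl // mulrC.
  lra.
have normM n q x : `|cone_unit n q ** x| <= `|q| * `|x|.
  by apply: le_trans (normr_amul _ _) _; rewrite ler_wpM2r // cone_unit_norm.
have Mnorm n q x : `|x ** cone_unit n q| <= `|q| * `|x|.
  by apply: le_trans (normr_amul _ _) _; rewrite mulrC ler_wpM2r // cone_unit_norm.
apply: (in_commutantI (m := m) _ _ _).1.
- apply: (lim_unique (mP quat1) uc) => n; exact: (uP n).1.1.
- move=> q; apply: (three (fun n q x => cone_unit n q ** x)) => // [*|j]; first by rewrite amulBr.
  exact: ((uP j).1.2 q).1.
move=> q; apply: (three (fun n q x => x ** cone_unit n q)) => // [*|j]; first by rewrite amulBl.
exact: ((uP j).1.2 q).2.
Qed.

(** Since $b=-c-cb=-c-bc$, the limits for [b] on both sides are read off from those for [c]; they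
    agree because [b] commutes with everything that commutes with [c]. *)
Lemma commutant_inverse c b : in_commutant c -> quasi_inverse c b -> in_commutant b.
Proof.
move=> cC cb; have [h1 h2] := (quasi_inverse_invertible _ _).1 cb; have [cb1 cb2] := cb.
have [c1 cP] := cC; have [ccC e1 e2] := commutant_mul cC cC.
have comm q : act q c ** b = b ** act q c.
  have h : act q c ** c = c ** act q c by rewrite -e1 e2.
  have hc : (1 + emb c) * emb (act q c) = emb (act q c) * (1 + emb c).
    by rewrite mulrDl mulrDr mul1r mulr1 -!embM h.
  have := inv_comm h1 h2 hc.
  by rewrite mulrDl mulrDr mul1r mulr1 -!embM => /addrI/emb_inj.
have bE : b = - c - c ** b by apply/eqP; rewrite -subr_eq0 opprD !opprK addrA [b + c]addrC cb1.
have bE' : b = - c - b ** c by apply/eqP; rewrite -subr_eq0 opprD !opprK addrA [b + c]addrC cb2.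
apply: (in_commutantI (m := fun q => - act q c - act q c ** b) _ _ _).1.
- by rewrite c1 -bE.
- move=> q; have -> : (fun n => cone_unit n q ** b) =
      fun n => - (cone_unit n q ** c) - (cone_unit n q ** c) ** b.
    by apply/funext => n; rewrite [in LHS]bE amulBr amulNr amulA.
  apply: cvgB; first by apply: cvgN; exact: (cP q).1.
  by apply: cvg_amul; [exact: (cP q).1|exact: cvg_cst].
move=> q; have -> : (fun n => b ** cone_unit n q) =
    fun n => - (c ** cone_unit n q) - b ** (c ** cone_unit n q).
  by apply/funext => n; rewrite [in LHS]bE' amulBl amulNl amulA.
rewrite comm; apply: cvgB; first by apply: cvgN; exact: (cP q).2.
by apply: cvg_amul; [exact: cvg_cst|exact: (cP q).2].
Qed.

Definition average b : D := \sum_e k (quat_basis e) ** b ** k (star (quat_basis e)).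

Lemma average_star b : star (average b) = average (star b).
Proof.
rewrite /average (big_morph _ (@starD _ D) (@star0 _ D)); apply: eq_bigr => e _.
by rewrite !starM !cone_star starK amulA.
Qed.

Lemma cone_sum (f : 'I_4 -> H) : k (\sum_e f e) = \sum_e k (f e).
Proof. by rewrite !sum_ord4 !coneD. Qed.

(** A quaternion multiplied from the left enters the left factors and gives $\sum_e
    k(qe)\,b\,k(\overline e)$. From the right it gives $\sum_p k(p)\,b\,k(\overline pq)$, and
    [quat_coord_adjoint] identifies the two. *)
Lemma average_commutant b : in_commutant (average b) /\
  forall q, act q (average b) = \sum_e k (q ** quat_basis e) ** b ** k (star (quat_basis e)).
Proof.
apply: in_commutantI => [|q|q].
- by apply: eq_bigr => e _; rewrite quat_mul1l.
- have -> : (fun n => cone_unit n q ** average b) = fun n => \sum_e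
      t ** cone_unit n (q ** quat_basis e) ** b ** k (star (quat_basis e)).
    apply/funext => n; rewrite amul_sumr.
    by apply: eq_bigr => e _; rewrite !amulA cone_unit_mull.
  apply: cvg_sum4 => e; apply: cvg_amul; last exact: cvg_cst.
  by apply: cvg_amul; [exact: cone_unit_cvg|exact: cvg_cst].
have -> : (fun n => average b ** cone_unit n q) = fun n => \sum_e
    k (quat_basis e) ** b ** (t ** cone_unit n (star (quat_basis e) ** q)).
  apply/funext => n; rewrite amul_suml.
  by apply: eq_bigr => e _; rewrite -!amulA cone_unit_mul.
have -> : \sum_e k (q ** quat_basis e) ** b ** k (star (quat_basis e)) =
    \sum_p k (quat_basis p) ** b ** k (star (quat_basis p) ** q).
  transitivity (\sum_e \sum_p quat_coord (q ** quat_basis e) p *: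
      (k (quat_basis p) ** b ** k (star (quat_basis e)))).
    apply: eq_bigr => e _; rewrite [q ** _ in LHS]quat_expand cone_sum !amul_suml.
    by apply: eq_bigr => p _; rewrite coneZ !amulZl.
  rewrite exchange_big; apply: eq_bigr => p _; rewrite [_ ** q in RHS]quat_expand cone_sum.
  by rewrite amul_sumr; apply: eq_bigr => e _; rewrite -amulZr -coneZ -quat_coord_adjoint.
apply: cvg_sum4 => e; apply: cvg_amul; first exact: cvg_cst.
exact: cone_unit_cvg.
Qed.

End Cone.
End QuaternionCone.

(** * Closed subalgebras as real C*-algebras *)

Record closed_subalg (R : realType) (D : realCstarType R) := ClosedSubalg {
  subalg_set :> set D;
  subalg_closed : closed subalg_set;
  subalg0 : subalg_set 0;
  subalgD : forall x y, subalg_set x -> subalg_set y -> subalg_set (x + y);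
  subalgZ : forall (k : R) x, subalg_set x -> subalg_set (k *: x);
  subalgM : forall x y, subalg_set x -> subalg_set y -> subalg_set (x ** y);
  subalg_star : forall x, subalg_set x -> subalg_set (star x);
  subalg_inverse : forall x y, subalg_set x -> quasi_inverse x y -> subalg_set y }.

Section Subalgebra.
Context (R : realType) (D : realCstarType R) (S : closed_subalg D).

Definition subalg_pred : {pred D} := fun x => `[< subalg_set S x >].

Lemma subalgP x : reflect (subalg_set S x) (x \in subalg_pred).
Proof. exact: asboolP. Qed.

Lemma subalg_submod_closed : submod_closed subalg_pred.
Proof.
split=> [|k x y /subalgP Sx /subalgP Sy]; apply/subalgP; first exact: subalg0.
by apply: subalgD => //; exact: subalgZ.
Qed.

HB.instance Definition _ := GRing.isSubmodClosed.Build R D subalg_pred subalg_submod_closed.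

Record subalg := Subalg { subalg_val : D; _ : subalg_val \in subalg_pred }.

HB.instance Definition _ := [isSub for subalg_val].
HB.instance Definition _ := [Choice of subalg by <:].
HB.instance Definition _ := [SubChoice_isSubLmodule of subalg by <:].

Local Notation A := subalg.
Implicit Types f g h : A.

Definition mk_subalg x (Sx : subalg_set S x) : A := Subalg (introT (subalgP x) Sx).

Lemma subalg_valP f : subalg_set S (subalg_val f).
Proof. by apply/subalgP; case: f. Qed.

Lemma subalg_val_inj f g : subalg_val f = subalg_val g -> f = g.
Proof. exact: val_inj. Qed.

Definition subalg_mul f g : A := mk_subalg (subalgM (subalg_valP f) (subalg_valP g)).
Definition subalg_adj f : A := mk_subalg (subalg_star (subalg_valP f)).

Lemma subalg_mulA : associative subalg_mul.
Proof. by move=> f g h; apply: subalg_val_inj; rewrite /= amulA. Qed.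

Lemma subalg_mulDl : left_distributive subalg_mul +%R.
Proof. by move=> f g h; apply: subalg_val_inj; rewrite /= amulDl. Qed.

Lemma subalg_mulDr : right_distributive subalg_mul +%R.
Proof. by move=> f g h; apply: subalg_val_inj; rewrite /= amulDr. Qed.

Lemma subalg_mulZl (k : R) f g : subalg_mul (k *: f) g = k *: subalg_mul f g.
Proof. by apply: subalg_val_inj; rewrite /= amulZl. Qed.

Lemma subalg_mulZr (k : R) f g : subalg_mul f (k *: g) = k *: subalg_mul f g.
Proof. by apply: subalg_val_inj; rewrite /= amulZr. Qed.

HB.instance Definition _ := isNUAlgebra.Build R A
  subalg_mulA subalg_mulDl subalg_mulDr subalg_mulZl subalg_mulZr.
HB.instance Definition _ := hasStar.Build A subalg_adj.

Lemma subalg_valB f g : subalg_val (f - g) = subalg_val f - subalg_val g.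
Proof. by []. Qed.

Definition subalg_norm f : R := `|subalg_val f|.

Lemma subalg_normD f g : subalg_norm (f + g) <= subalg_norm f + subalg_norm g.
Proof. exact: ler_normD. Qed.

Lemma subalg_normZ (k : R) f : subalg_norm (k *: f) = `|k| * subalg_norm f.
Proof. exact: normrZ. Qed.

Lemma subalg_norm0_eq0 f : subalg_norm f = 0 -> f = 0.
Proof. by move=> /normr0_eq0 f0; apply: subalg_val_inj. Qed.

HB.instance Definition _ :=
  Lmodule_isNormed.Build R A subalg_normD subalg_normZ subalg_norm0_eq0.

Lemma subalg_normE f : `|f| = `|subalg_val f|. Proof. by []. Qed.

Lemma subalg_complete (F : set_system A) : ProperFilter F -> cauchy F -> cvg F.
Proof.
move=> FF /cauchy_ballP Fc.
have /cvg_ex[l lP] : cvg (subalg_val @ F).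
  apply: cauchy_cvg; apply/cauchy_ballP => e e0.
  have [[P Q] [FP FQ] PQ] := Fc e e0.
  exists (subalg_val @` P, subalg_val @` Q).
    by split; [apply: filterS FP|apply: filterS FQ] => x Px; exists x.
  move=> [_ _] [[x Px <-] [y Qy <-]]; have := PQ (x, y) (conj Px Qy).
  by rewrite -!ball_normE /= subalg_normE subalg_valB.
have lS : subalg_set S l.
  apply: (closed_approx (@subalg_closed _ _ S)) => e e0.
  move/cvgrPdist_le: lP => /(_ e e0) le; have [x xe] := filter_ex le.
  by exists (subalg_val x) => //; exact: subalg_valP.
apply/cvg_ex; exists (mk_subalg lS); apply/cvgrPdist_le => e e0.
move/cvgrPdist_le: lP => /(_ e e0); apply: filterS => x.
by rewrite subalg_normE subalg_valB.
Qed.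

HB.instance Definition _ := Uniform_isComplete.Build A subalg_complete.

Lemma subalg_normM f g : `|f ** g| <= `|f| * `|g|.
Proof. exact: normr_amul. Qed.

Lemma subalg_adjD : {morph (star : A -> A) : f g / f + g}.
Proof. by move=> f g; apply: subalg_val_inj; rewrite /= starD. Qed.

Lemma subalg_adjZ (k : R) f : star (k *: f) = k *: star f.
Proof. by apply: subalg_val_inj; rewrite /= starZ. Qed.

Lemma subalg_adjM f g : star (f ** g) = star g ** star f.
Proof. by apply: subalg_val_inj; rewrite /= starM. Qed.

Lemma subalg_adjK : involutive (star : A -> A).
Proof. by move=> f; apply: subalg_val_inj; rewrite /= starK. Qed.

Lemma subalg_cstar_identity f : `|star f ** f| = `|f| ^+ 2.
Proof. exact: cstar_identity. Qed.

Lemma subalg_cstar_invertible f : unit_invertible ((1, star f ** f) : unitization A).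
Proof.
have /unit_invertibleP[b bP] := cstar_invertible (subalg_val f).
have bS := subalg_inverse (subalg_valP (star f ** f)) bP.
apply/unit_invertibleP; exists (mk_subalg bS).
by case: bP => b1 b2; split; apply: subalg_val_inj.
Qed.

HB.instance Definition _ := isRealCstar.Build R A
  subalg_normM subalg_adjD subalg_adjZ subalg_adjM subalg_adjK
  subalg_cstar_identity subalg_cstar_invertible.

Lemma subalg_val_hom : star_hom subalg_val. Proof. by []. Qed.

End Subalgebra.

(** * A quaternionic cone from two skew elements *)

Section ConeConstruction.
Context (R : realType).
Local Notation H := (quaternion R).

Definition quat_i : H := Quat 0 1 0 0.
Definition quat_j : H := Quat 0 0 1 0.
Definition quat_k : H := Quat 0 0 0 1.

Section Anticommuting.
Context (D : realCstarType R) (r p q : D).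
Hypotheses (rr : star r = r) (sp : star p = - p) (sq : star q = - q).
Hypotheses (pp : p ** p = - (r ** r)) (qq : q ** q = - (r ** r)) (qp : q ** p = - (p ** q)).
Hypotheses (rp : r ** p = p ** r) (rq : r ** q = q ** r).

(** Formally $p=rj$ and $q=rk$, so that $pq=r^2i$: every summand is $r^2$ times a quaternion. *)
Definition cone_of (z : H) : D :=
  qre z *: (r ** r) + qi z *: (p ** q) + qj z *: (r ** p) + qk z *: (r ** q).

Lemma cone_of_linear (c : R) x y : cone_of (c *: x + y) = c *: cone_of x + cone_of y.
Proof.
rewrite /cone_of /= !scalerDr !scalerDl !scalerA !addrA.
by rewrite [LHS](ACl (1*3*5*7*2*4*6*8)).
Qed.

Lemma cone_of1 : cone_of (quat1 R) = r ** r.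
Proof. by rewrite /cone_of /= !scale0r !addr0 scale1r. Qed.

Lemma cone_of_basis (e : 'I_4) :
  cone_of (quat_basis R e) = [:: r ** r; p ** q; r ** p; r ** q]`_e.
Proof.
by case: e => -[|[|[|[|//]]]] ?; rewrite /cone_of /= !(scale0r, scale1r, add0r, addr0).
Qed.

Lemma cone_of_basis_mul e e' : cone_of (quat_basis R e) ** cone_of (quat_basis R e') =
  r ** r ** cone_of (quat_basis R e ** quat_basis R e').
Proof.
have pr x : p ** (r ** x) = r ** (p ** x) by rewrite !amulA rp.
have qr x : q ** (r ** x) = r ** (q ** x) by rewrite !amulA rq.
have ppx x : p ** (p ** x) = - (r ** (r ** x)) by rewrite amulA pp amulNl amulA.
have qpx x : q ** (p ** x) = - (p ** (q ** x)) by rewrite !amulA qp amulNl.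
rewrite !cone_of_basis /cone_of.
case: e => -[|[|[|[|//]]]] ?; case: e' => -[|[|[|[|//]]]] ? /=;
  rewrite !(mulr0, mulr1, subr0, addr0, add0r) ?sub0r ?oppr0 !scale0r !(addr0, add0r)
    ?scaleN1r ?scale1r -!amulA;
  by rewrite ?(amulNl, amulNr, opprK, pr, qr, ppx, qpx, qp, pp, qq, esym rp, esym rq).
Qed.

Lemma cone_of_cone : quat_cone cone_of.
Proof.
have cS (f : 'I_4 -> H) : cone_of (\sum_e f e) = \sum_e cone_of (f e).
  by rewrite !sum_ord4 !(linear_add cone_of_linear).
have cZ := linear_scale cone_of_linear.
split=> [|x y|x|].
- exact: cone_of_linear.
- rewrite cone_of1 [x]quat_expand [y]quat_expand !cS !amul_suml cS amul_sumr.
  apply: eq_bigr => e _; rewrite !amul_sumr cS amul_sumr; apply: eq_bigr => e' _.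
  by rewrite !cZ !amulZl !amulZr !cZ !amulZr cone_of_basis_mul.
- rewrite /cone_of !starD !starZ !starM rr sp sq /= !scaleNr -!scalerN.
  by rewrite !amulNl !amulNr opprK qp rp rq.
by exists r; rewrite cone_of1 rr.
Qed.

End Anticommuting.

(* [a] and [b] stand for positive multiples of [i] and [j], up to a small error. *)
Section Polar.
Context (D : realCstarType R) (a b r : D).
Hypotheses (sa : star a = - a) (sb : star b = - b).
Hypotheses (rr : star r = r) (r2 : r ** r = star a ** a) (ra : r ** a = a ** r).

(** Formally $a=ri$. Then $p=r(b+ibi)r$ discards the part of $b$ that commutes with $i$, and $q=ip$.
    Hence $q^2=p^2$ and $qp=-pq$ hold exactly, without dividing by $r$. *)
Definition polar_p : D := r ** b ** r + a ** b ** a.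
Definition polar_q : D := a ** b ** r - r ** b ** a.

Lemma polar_star : star polar_p = - polar_p /\ star polar_q = - polar_q.
Proof.
split; rewrite /polar_p /polar_q ?starB ?starD !starM sa sb rr !(amulNl, amulNr, opprK).
  by rewrite opprD !amulA.
by rewrite opprB !amulA.
Qed.

Let aa x : a ** (a ** x) = - (r ** (r ** x)).
Proof. by rewrite !amulA r2 sa !amulNl opprK. Qed.
Let rax x : r ** (a ** x) = a ** (r ** x).
Proof. by rewrite !amulA ra. Qed.

Lemma polar_sqr : polar_q ** polar_q = polar_p ** polar_p.
Proof.
rewrite /polar_p /polar_q !amulDl !amulDr !(amulNl, amulNr) -!amulA !(aa, rax, amulNr, opprK).
exact: addrC.
Qed.

Lemma polar_anticomm : polar_q ** polar_p = - (polar_p ** polar_q).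
Proof.
rewrite /polar_p /polar_q !amulDl !amulDr !(amulNl, amulNr) -!amulA !(aa, rax, amulNr, opprK).
by rewrite !opprD !opprK addrC.
Qed.

End Polar.

(* [u n q] plays the role of [t^(n+1) (x) q] in the cone [C_0((0,1]) (x) H]. *)
Definition graded_cone (D : realCstarType R) (u : nat -> H -> D) : Prop :=
  [/\ forall n c p q, u n (c *: p + q) = c *: u n p + u n q,
      forall m n p q, u m p ** u n q = u (m + n).+1 (p ** q),
      forall n q, star (u n q) = u n (star q) &
      exists c, u 0%N (quat1 R) = star c ** c].

Section Graded.
Context (D : realCstarType R) (u : nat -> H -> D) (ug : graded_cone u).

Lemma gradedD n p q : u n (p + q) = u n p + u n q.
Proof. by case: ug => ul _ _ _; exact: linear_add. Qed.

Lemma gradedZ n c q : u n (c *: q) = c *: u n q.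
Proof. by case: ug => ul _ _ _; exact: linear_scale. Qed.

Lemma gradedM m n p q : u m p ** u n q = u (m + n).+1 (p ** q). Proof. by case: ug. Qed.

Lemma graded_norm q : star q ** q = quat1 R -> `|u 0 q| = `|u 0 (quat1 R)|.
Proof.
case: (ug) => _ _ us _ q1; apply/eqP; rewrite -(@eqrXn2 _ 2) // -!cstar_identity !us !gradedM q1.
by rewrite quat_star1 quat_mul1l.
Qed.

End Graded.

Lemma is_root_unique (D : realCstarType R) (t r r' : D) : is_root t r -> is_root t r' -> r = r'.
Proof. by move=> h h'; exact: (lim_unique h h'). Qed.

(** The cone is $s^2$ times the quaternions, where $s$ is the root of $p^*p$. If $a$ and $b$ are
    sent to $ti$ and $tj$, then $p$ goes to $2t^3j$, $s$ to $2t^3$ and $s^2$ to $4t^6$; [u 5] is the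
    term of degree 6. The bound on $b$ gives $\|p\|\le1$, so that $s$ exists. *)
Theorem cone_exists (D : realCstarType R) (a b : D) :
  star a = - a -> star b = - b -> `|a| <= 1 -> `|b| <= 2^-1 ->
  exists k : H -> D, quat_cone k /\
    forall (D' : realCstarType R) (f : D -> D') (u : nat -> H -> D'),
      star_hom f -> graded_cone u -> f a = u 0%N quat_i -> f b = u 0%N quat_j ->
      forall q, f (k q) = 4 *: u 5%N q.
Proof.
move=> sa sb a1 b1.
have aa1 : `|star a ** a| <= 1 by rewrite cstar_identity expr_le1.
have [r rP] := is_root_exists aa1; have rr := is_root_star rP.
have r2 := is_root_sqr aa1 rP.
have ra : r ** a = a ** r by apply: (is_root_comm rP); rewrite sa !(amulNl, amulNr) amulA.
have r1 : `|r| <= 1.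
  by rewrite -(@expr_le1 _ 2) // -cstar_identity rr r2.
pose p := polar_p a b r; pose q := polar_q a b r.
have [sp sq] : star p = - p /\ star q = - q by exact: polar_star.
have p1 : `|star p ** p| <= 1.
  have bnd (x : D) : `|x| <= 1 -> `|x ** b ** x| <= 2^-1.
    move=> x1; apply: le_trans (normr_amul _ _) _.
    apply: le_trans (ler_pM _ _ (normr_amul _ _) x1) _ => //.
    rewrite mulr1; apply: le_trans b1; rewrite ler_piMl //.
  rewrite cstar_identity expr_le1 //; apply: le_trans (ler_normD _ _) _.
  by have := bnd _ r1; have := bnd _ a1; lra.
have [s sP] := is_root_exists p1; have ss := is_root_star sP.
have s2 := is_root_sqr p1 sP; rewrite sp amulNl in s2.
have pp : p ** p = - (s ** s) by rewrite s2 opprK.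
have qq : q ** q = - (s ** s) by rewrite -pp; exact: polar_sqr.
have qp : q ** p = - (p ** q) by exact: polar_anticomm.
have spc : s ** p = p ** s by apply: (is_root_comm sP); rewrite sp !(amulNl, amulNr) amulA.
have sqc : s ** q = q ** s.
  apply: (is_root_comm sP); rewrite sp !(amulNl, amulNr); congr (- _).
  by rewrite -amulA [q ** (p ** p)]amulA qp amulNl -[(p ** q) ** p]amulA qp amulNr opprK.
exists (cone_of s p q); split; first exact: cone_of_cone.
move=> D' f u fh ug fa fb x; have [_ _ us [c cu]] := ug.
have i1 : star quat_i ** quat_i = quat1 R by apply: quatP => /=; ring.
have j1 : star quat_j ** quat_j = quat1 R by apply: quatP => /=; ring.
have u1 : `|u 0 (quat1 R)| <= 2^-1.
  by rewrite -(graded_norm ug j1) -fb; apply: le_trans b1; exact: norm_hom_le.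
have u2 : `|2 *: u 2 (quat1 R)| <= 1.
  have -> : u 2 (quat1 R) = u 0 (quat1 R) ** u 0 (quat1 R) ** u 0 (quat1 R).
    by rewrite !(gradedM ug) !quat_mul1l.
  rewrite normrZ ger0_norm //.
  have : `|u 0 (quat1 R) ** u 0 (quat1 R) ** u 0 (quat1 R)| <= 2^-1 * 2^-1 * 2^-1.
    apply: le_trans (normr_amul _ _) _; apply: ler_pM => //.
    by apply: le_trans (normr_amul _ _) _; apply: ler_pM.
  lra.
have fr : f r = u 0 (quat1 R).
  have h := is_root_hom fh rP; rewrite (homM fh) (hom_star fh) fa us (gradedM ug) i1 in h.
  apply: (is_root_unique h); have := is_root_square cu (le_trans u1 (_ : 2^-1 <= 1)).
  by rewrite (gradedM ug) quat_mul1l; apply; lra.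
have fp : f p = 2 *: u 2 quat_j.
  rewrite /p /polar_p (homD fh) !(homM fh) fa fb fr !(gradedM ug) -(gradedD ug) -(gradedZ ug).
  by congr (u _ _); apply: quatP => /=; ring.
have fq : f q = 2 *: u 2 quat_k.
  rewrite /q /polar_q (homB fh) !(homM fh) fa fb fr !(gradedM ug) -(gradedZ ug).
  apply/eqP; rewrite subr_eq -(gradedD ug); apply/eqP.
  by congr (u _ _); apply: quatP => /=; ring.
have fs : f s = 2 *: u 2 (quat1 R).
  have h := is_root_hom fh sP.
  rewrite (homM fh) (hom_star fh) fp starZ us amulZl amulZr (gradedM ug) j1 in h.
  apply: (is_root_unique h).
  (* [is_root_square] wants $2t^3$ as a product $x^*x$: with $t=c^*c$, take $x=\sqrt2\,ct$. *)
  have cE : 2 *: u 2 (quat1 R) = star (Num.sqrt 2 *: (c ** u 0 (quat1 R))) **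
      (Num.sqrt 2 *: (c ** u 0 (quat1 R))).
    rewrite starZ starM amulZl amulZr scalerA -expr2 sqr_sqrtr // us quat_star1.
    by rewrite amulA -(amulA (u 0 _)) -cu !(gradedM ug) !quat_mul1l.
  have := is_root_square cE u2.
  by rewrite amulZl amulZr (gradedM ug) quat_mul1l.
rewrite /cone_of !(homD fh) !(homZ fh) !(homM fh) fs fp fq !amulZl !amulZr !(gradedM ug).
rewrite -!(gradedZ ug) -!(gradedD ug); congr (u _ _).
by apply: quatP => /=; ring.
Qed.

End ConeConstruction.

(** * The commutant of a cone as a real C*-algebra *)

Section CommutantAlgebra.
Context (R : realType).
Local Notation H := (quaternion R).

Lemma quat_cone_hom (D D' : realCstarType R) (f : D -> D') (k : H -> D) :
  star_hom f -> quat_cone k -> quat_cone (f \o k).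
Proof.
move=> fh [kl kM ks [a ka]]; split=> [c p q|p q|q|] /=.
- by rewrite kl (homD fh) (homZ fh).
- by rewrite -!(homM fh) kM.
- by rewrite -(hom_star fh) ks.
by exists (f a); rewrite ka (homM fh) (hom_star fh).
Qed.

Lemma average_hom (D D' : realCstarType R) (f : D -> D') (k : H -> D) b :
  star_hom f -> f (average k b) = average (f \o k) (f b).
Proof. by move=> fh; rewrite /average !sum_ord4 !(homD fh) !(homM fh). Qed.

Section Fixed.
Context (D : realCstarType R) (k : H -> D) (kk : quat_cone k).
Local Notation C := (in_commutant k).

Lemma commutantD c d : C c -> C d -> C (c + d).
Proof. by move=> cC dC; have [h _] := commutant_linear 1 cC dC; rewrite scale1r in h. Qed.

Lemma commutantZ r c : C c -> C (r *: c).
Proof. by move=> cC; have [h _] := commutant_linear r cC (commutant0 k); rewrite addr0 in h. Qed.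

Lemma commutantM c d : C c -> C d -> C (c ** d).
Proof. by move=> cC dC; have [h _ _] := commutant_mul cC dC. Qed.

Definition commutant : closed_subalg D := ClosedSubalg (commutant_closed kk)
  (commutant0 k) commutantD commutantZ commutantM
  (fun c cC => (commutant_star kk cC).1) (fun c b cC => @commutant_inverse _ _ _ c b cC).

Context (A A' : realCstarType R) (psi : A -> subalg commutant).
Hypothesis ph : star_hom psi.
Local Notation val := (@subalg_val R D commutant).
Local Notation act := (act k).

Let C_psi a : C (val (psi a)) := subalg_valP (psi a).

Lemma act_psi_linear q c a b :
  act q (val (psi (c *: a + b))) = c *: act q (val (psi a)) + act q (val (psi b)).
Proof.
rewrite (homD ph) (homZ ph); exact: (commutant_linear c (C_psi a) (C_psi b)).2.
Qed.

Lemma act_psi_mul p q a b :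
  act p (val (psi a)) ** act q (val (psi b)) = act (p ** q) (val (psi (a ** b))).
Proof. by rewrite act_mul // (homM ph). Qed.

Lemma act_psi_mulr q a b : act q (val (psi (a ** b))) = val (psi a) ** act q (val (psi b)).
Proof. by rewrite (homM ph); have [_ _ ->] := commutant_mul (C_psi a) (C_psi b). Qed.

Lemma act_psi_star q a : star (act q (val (psi a))) = act (star q) (val (psi (star a))).
Proof.
by rewrite (hom_star ph) (commutant_star kk (C_psi a)).2 starK.
Qed.

Lemma act_psi_norm q a : `|act q (val (psi a))| <= `|q| * `|a|.
Proof.
apply: le_trans (act_norm kk q (C_psi a)) _; rewrite ler_wpM2l //.
exact: norm_hom_le ph a.
Qed.

End Fixed.
End CommutantAlgebra.

(* [t q a] is the elementary tensor of an identification of [A'] with [H (x) A]. *)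
Record quat_tensor (R : realType) (A A' : realCstarType R) (t : quaternion R -> A -> A')
    (co : 'I_4 -> A' -> A) : Prop := QuatTensor {
  tensor_linearl : forall c p q a, t (c *: p + q) a = c *: t p a + t q a;
  tensor_linearr : forall q c a b, t q (c *: a + b) = c *: t q a + t q b;
  tensorM : forall p q a b, t p a ** t q b = t (p ** q) (a ** b);
  tensor_star : forall q a, star (t q a) = t (star q) (star a);
  tensor_expand : forall x, x = \sum_e t (quat_basis R e) (co e x);
  coord_linear : forall e c x y, co e (c *: x + y) = c *: co e x + co e y;
  coord_tensor : forall e q a, co e (t q a) = quat_coord q e *: a }.

(** * Lifting from $A$ to $\mathbb H\otimes A$ *)

Section Amplification.
Context (R : realType) (A A' : realCstarType R).
Local Notation H := (quaternion R).
Context (t : H -> A -> A') (co : 'I_4 -> A' -> A) (tt : quat_tensor t co).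

Lemma tensorD q a b : t q (a + b) = t q a + t q b.
Proof. exact: linear_add (tensor_linearr tt q) a b. Qed.

Lemma tensorZr q c a : t q (c *: a) = c *: t q a.
Proof. exact: linear_scale (tensor_linearr tt q) c a. Qed.

Lemma tensorDl p q a : t (p + q) a = t p a + t q a.
Proof. exact: linear_add (fun c p q => tensor_linearl tt c p q a) p q. Qed.

Lemma tensorZl q c a : t (c *: q) a = c *: t q a.
Proof. exact: linear_scale (fun c p q => tensor_linearl tt c p q a) c q. Qed.

Lemma tensor1_hom : star_hom (t (quat1 R)).
Proof.
split=> [c a b|a b|a]; first exact: tensor_linearr tt _ _ _ _.
  by rewrite (tensorM tt) quat_mul1l.
by rewrite (tensor_star tt) quat_star1.
Qed.

Lemma tensor_norm q a : `|t q a| <= `|q| * `|a|.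
Proof.
rewrite -(@ler_sqr R) ?nnegrE ?mulr_ge0 // -cstar_identity (tensor_star tt) (tensorM tt).
rewrite quat_star_mul tensorZl normrZ ger0_norm ?sqr_ge0 // exprMn ler_wpM2l ?sqr_ge0 //.
by rewrite -cstar_identity; exact: norm_hom_le tensor1_hom _.
Qed.

Lemma tensor_exists x : exists f : 'I_4 -> A, x = \sum_e t (quat_basis R e) (f e).
Proof. by exists (co^~ x); exact: tensor_expand tt x. Qed.

Section Extension.
Context (D : realCstarType R) (k : H -> D) (kk : quat_cone k).
Context (psi : A -> subalg (commutant kk)) (ph : star_hom psi).
Local Notation val := (@subalg_val R D (commutant kk)).

Definition extension (x : A') : D := \sum_e act k (quat_basis R e) (val (psi (co e x))).

Lemma extension_linear c x y : extension (c *: x + y) = c *: extension x + extension y.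
Proof.
rewrite /extension scaler_sumr -big_split; apply: eq_bigr => e _.
by rewrite (coord_linear tt) (act_psi_linear ph).
Qed.

Lemma extension_sum (f : 'I_4 -> A') : extension (\sum_e f e) = \sum_e extension (f e).
Proof. by rewrite !sum_ord4 !(linear_add extension_linear). Qed.

Lemma extension_tensor q a : extension (t q a) = act k q (val (psi a)).
Proof.
have aC : in_commutant k (val (psi a)) := subalg_valP (psi a).
have al c p p' := act_linearl kk c p p' aC.
have -> : extension (t q a) =
    \sum_e act k (quat_coord q e *: quat_basis R e) (val (psi a)).
  apply: eq_bigr => e _; rewrite (coord_tensor tt).
  rewrite (linear_scale al).
  exact: linear_scale (fun c => act_psi_linear ph (quat_basis R e) c) _ a.
by rewrite [q in RHS]quat_expand !sum_ord4 !(linear_add al).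
Qed.

Lemma extension_hom : star_hom extension.
Proof.
split=> [c x y|x y|x]; first exact: extension_linear.
- have [[xe ->] [ye ->]] := (tensor_exists x, tensor_exists y).
  rewrite [X in extension X]amul_suml !extension_sum [RHS]amul_suml.
  apply: eq_bigr => e _; rewrite !amul_sumr extension_sum; apply: eq_bigr => e' _.
  by rewrite (tensorM tt) !extension_tensor (act_psi_mul ph).
have [xe ->] := tensor_exists x.
rewrite (big_morph _ (@starD _ A') (@star0 _ A')) !extension_sum.
rewrite (big_morph _ (@starD _ D) (@star0 _ D)); apply: eq_bigr => e _.
by rewrite (tensor_star tt) !extension_tensor (act_psi_star ph).
Qed.

End Extension.
Section Divisible.
Context (rho c0 : A).
Hypotheses (rhoE : rho = star c0 ** c0) (rhoC : forall a, rho ** a = a ** rho).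

(** This is [rho] to the power [n + 1], [A] having no unit; thus [rho_pow 5] is the sixth power and
    [rho_pow 11] the twelfth. *)
Definition rho_pow n : A := iter n (amul rho) rho.

Lemma rho_powC n a : rho_pow n ** a = a ** rho_pow n.
Proof.
by elim: n => [|n IH]; [exact: rhoC|rewrite /= -amulA IH amulA rhoC amulA].
Qed.

Lemma rho_powM m n : rho_pow m ** rho_pow n = rho_pow (m + n).+1.
Proof. by elim: m => [//|m IH]; rewrite /= -amulA IH. Qed.

Lemma rho_pow_star n : star (rho_pow n) = rho_pow n.
Proof.
have rs : star rho = rho by rewrite rhoE star_amul_self.
by elim: n => [//|n IH]; rewrite /= starM IH rs -/(rho_pow n) rhoC.
Qed.

(** The cone generator is $c\rho$ in place of $\rho$, since the lifts have to be shrunk to meet the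
    norm bounds of [cone_exists]. *)
Lemma tensor_graded (D : realCstarType R) (phi : A' -> D) (c : R) : 0 <= c -> star_hom phi ->
  graded_cone (fun n q => c ^+ n.+1 *: phi (t q (rho_pow n))).
Proof.
move=> c_ge0 ph; split=> [n r p q|m n p q|n q|].
- by rewrite (tensor_linearl tt) (homD ph) (homZ ph) scalerDr !scalerA mulrC.
- by rewrite amulZl amulZr scalerA -exprD -(homM ph) (tensorM tt) rho_powM addSn addnS.
- by rewrite starZ -(hom_star ph) (tensor_star tt) rho_pow_star.
exists (Num.sqrt c *: phi (t (quat1 R) c0)).
rewrite starZ amulZl amulZr scalerA -expr2 sqr_sqrtr // -(hom_star ph) -(homM ph).
by rewrite (tensor_star tt) (tensorM tt) quat_star1 quat_mul1l -rhoE.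
Qed.

Context (s : bool) (h y eh ey : A).
Hypotheses (un : universal_pair s h y) (eh_star : star eh = eh) (ey_star : star ey = (-1) ^+ s *: ey).
Hypotheses (hE : h = rho_pow 11 ** eh) (yE : y = rho_pow 11 ** ey).

(** Both generators are divisible by $\rho^{12}$, hence so is every [calc h y r], and these elements
    are dense. *)
Lemma rho_pow_dense n a (e : R) : (n <= 11)%N -> 0 < e ->
  exists z, `|a - rho_pow n ** z| <= e.
Proof.
move=> n11 e0; have [_ dense _] := un; have [r re] := dense a e e0.
have [w wE] : exists w, calc h y r = rho_pow 11 ** w.
  exists (emb eh * horner_alg (emb h) r.1 + emb ey * horner_alg (emb h) r.2).2.
  apply: emb_inj; rewrite calc_emb embM [emb (_.2)]emb_snd; last by rewrite /= !mul0r addr0.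
  by rewrite mulrDr !mulrA -!embM -hE -yE.
move: n11; rewrite leq_eqVlt => /orP[/eqP ->|n11]; first by exists w; rewrite -wE.
exists (rho_pow (10 - n) ** w); rewrite amulA rho_powM subnKC // -wE //.
Qed.

Section Quotients.
Context (B : realCstarType R) (I J : closed_ideal B) (IJ : I `<=` J).
Context (phi : A' -> quot J) (ph : star_hom phi).
Context (k : H -> B) (kk : quat_cone k) (c : R) (c_gt0 : 0 < c).
Hypothesis kE : forall q, quot_pi J (k q) = 4 *: (c ^+ 6 *: phi (t q (rho_pow 5))).

Let kI : quat_cone (quot_pi I \o k) := quat_cone_hom (quot_pi_hom I) kk.
Context (psi : A -> subalg (commutant kI)) (psih : star_hom psi).
Local Notation val := (@subalg_val R (quot I) (commutant kI)).
Hypothesis psiE : forall a, quot_map J (val (psi a)) = phi (t (quat1 R) a).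

(** [cone_act] gives the equality after multiplication by $\rho^6$, that is, for arguments
    $\rho^6b$. Those are dense and both sides are bounded in [a]. *)
Lemma quot_map_act q a : quot_map J (act (quot_pi I \o k) q (val (psi a))) = phi (t q a).
Proof.
have gh := quot_map_hom IJ.
pose F b := quot_map J (act (quot_pi I \o k) q (val (psi b))).
have FM b : F (rho_pow 5 ** b) = phi (t q (rho_pow 5 ** b)).
  have key : phi (t (quat1 R) (rho_pow 5)) ** F b = phi (t q (rho_pow 5 ** b)).
    have C_b := subalg_valP (psi b).
    have := congr1 (quot_map J) (cone_act kI q C_b); rewrite !(homM gh) psiE /=.
    rewrite !quot_map_pi // !kE !amulZl -(homM ph) (tensorM tt) quat_mul1r.
    have c4 : 4 * c ^+ 6 != 0 by rewrite mulf_neq0 // expf_neq0 // lt0r_neq0.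
    by rewrite !scalerA => /(scalerI c4).
  by rewrite -key /F (act_psi_mulr psih) (homM gh) psiE.
have FB b b' : F (b - b') = F b - F b'.
  rewrite -scaleN1r addrC /F (act_psi_linear psih) (homD gh) (homZ gh) scaleN1r.
  exact: addrC.
have F_norm b : `|F b| <= `|q| * `|b|.
  by apply: le_trans (norm_hom_le gh _) _; exact: act_psi_norm.
apply/eqP; rewrite -subr_eq0 -normr_le0; apply/ler_addgt0Pr => e e0; rewrite add0r.
have q1 : 0 < `|q| + 1 by rewrite ltr_wpDl.
have e1 : 0 < e / 2 / (`|q| + 1) by rewrite !divr_gt0.
have [z ze] := rho_pow_dense a (isT : 5 <= 11)%N e1.
have -> : F a - phi (t q a) = F (a - rho_pow 5 ** z) - phi (t q (a - rho_pow 5 ** z)).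
  rewrite FB FM -[in RHS](scaleN1r (_ ** _)) tensorD tensorZr (homD ph) (homZ ph) scaleN1r.
  by rewrite opprB addrA subrK.
apply: le_trans (ler_normB _ _) _.
have h1 := F_norm (a - rho_pow 5 ** z).
have h2 : `|phi (t q (a - rho_pow 5 ** z))| <= `|q| * `|a - rho_pow 5 ** z|.
  exact: le_trans (norm_hom_le ph _) (tensor_norm _ _).
have h3 : `|q| * `|a - rho_pow 5 ** z| <= e / 2.
  apply: le_trans (ler_wpM2l (normr_ge0 q) ze) _.
  rewrite [_ * (e / 2 / _)]mulrA ler_pdivrMr // [`|q| * _]mulrC ler_wpM2l ?lerDl //.
  by rewrite ltW // divr_gt0.
have := lerD h1 h2; lra.
Qed.

Lemma quot_map_extension x : quot_map J (extension psi x) = phi x.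
Proof.
have gh := quot_map_hom IJ.
have [f ->] := tensor_exists x.
rewrite (extension_sum psih) !sum_ord4 !(homD gh) !(homD ph).
by rewrite !(extension_tensor psih) !quot_map_act.
Qed.

End Quotients.
Theorem quat_semiprojective : semiprojective A'.
Proof.
move=> B J Joo JS JE phi ph; have gh := quot_pi_hom Joo; set g := quot_pi Joo in gh.
have rs : star rho = rho by rewrite rhoE star_amul_self.
have skew q : star q = - q -> exists b, g b = phi (t q rho) /\ star b = - b.
  move=> qs; have [|b [bE bs]] := @quot_lift_sym _ B Joo (phi (t q rho)) true.
    by rewrite -(hom_star ph) (tensor_star tt) rs qs -scaleN1r tensorZl (homZ ph).
  by exists b; rewrite bs expr1 scaleN1r.
have [a0 [a0E a0s]] : exists b, g b = phi (t (quat_i R) rho) /\ star b = - b.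
  by apply: skew; apply: quatP => /=; ring.
have [b0 [b0E b0s]] : exists b, g b = phi (t (quat_j R) rho) /\ star b = - b.
  by apply: skew; apply: quatP => /=; ring.
(* Chosen so that $\|ca_0\|\le1$ and $\|cb_0\|\le1/2$, as [cone_exists] demands. *)
pose m := 1 + `|a0| + 2 * `|b0|; pose c := m^-1.
have m0 : 0 < m by rewrite /m; have := normr_ge0 a0; have := normr_ge0 b0; lra.
have c_gt0 : 0 < c by rewrite invr_gt0.
have ca : `|c *: a0| <= 1.
  rewrite normrZ gtr0_norm // mulrC ler_pdivrMr // mul1r /m.
  by have := normr_ge0 b0; lra.
have cb : `|c *: b0| <= 2^-1.
  rewrite normrZ gtr0_norm // mulrC ler_pdivrMr // /m.
  by have := normr_ge0 a0; lra.
have [||k [kk kP]] := cone_exists _ _ ca cb.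
- by rewrite starZ a0s scalerN.
- by rewrite starZ b0s scalerN.
have ug := tensor_graded (ltW c_gt0) ph.
have kE := kP _ g _ gh ug (_ : _ = _) (_ : _ = _).
have {}kE : forall q, g (k q) = 4 *: (c ^+ 6 *: phi (t q (rho_pow 5))).
  by apply: kE; rewrite (homZ gh) ?a0E ?b0E expr1.
(* Each of the two cone factors in an average contributes $4c^6$, and $\sum_e e\overline e=4$. *)
pose d := (64 * c ^+ 12)^-1.
have gavg x e : g x = phi (t (quat1 R) e) ->
    g (average k (d *: x)) = phi (t (quat1 R) (rho_pow 11 ** e)).
  move=> xE; rewrite (average_hom _ _ gh) /average (homZ gh) xE.
  transitivity (\sum_e' (4^-1 : R) *: phi (t (quat_basis R e' ** star (quat_basis R e'))
      (rho_pow 11 ** e))).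
    apply: eq_bigr => e' _; rewrite /= !kE !(amulZl, amulZr) -!(homM ph) !(tensorM tt).
    rewrite quat_mul1r -amulA -rho_powC amulA rho_powM !scalerA; congr (_ *: _).
    by rewrite /d; field; rewrite lt0r_neq0.
  have sumE (f : 'I_4 -> H) x' : \sum_e' phi (t (f e') x') = phi (t (\sum_e' f e') x').
    by rewrite !sum_ord4 !tensorDl !(homD ph).
  rewrite -scaler_sumr sumE quat_sum_star tensorZl (homZ ph).
  by rewrite scalerA mulVf ?pnatr_eq0 // scale1r.
have iota := star_hom_comp tensor1_hom ph.
have [h0 [h0E h0s]] : exists b, g b = phi (t (quat1 R) eh) /\ star b = (-1) ^+ false *: b.
  by apply: quot_lift_sym; rewrite -(hom_star iota eh) /= eh_star scale1r.
have [y0 [y0E y0s]] : exists b, g b = phi (t (quat1 R) ey) /\ star b = (-1) ^+ s *: b.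
  by apply: quot_lift_sym; rewrite -(hom_star iota ey) /= ey_star -(homZ iota).
pose H0 := average k (d *: h0); pose Y0 := average k (d *: y0).
have gH : g H0 = phi (t (quat1 R) h) by rewrite (gavg _ eh) // -hE.
have gY : g Y0 = phi (t (quat1 R) y) by rewrite (gavg _ ey) // -yE.
have avgZ r x : average k (r *: x) = r *: average k x.
  by rewrite /average scaler_sumr; apply: eq_bigr => e _; rewrite amulZr amulZl.
have H0s : star H0 = H0 by rewrite (average_star kk) starZ h0s scale1r.
have Y0s : star Y0 = (-1) ^+ s *: Y0.
  by rewrite /Y0 (average_star kk) starZ y0s !avgZ !scalerA mulrC.
have exoo : exact_pair s (g H0) (g Y0).
  by rewrite gH gY; apply: exact_pair_hom iota _; have [] := un.
have [n [fixd small]] := quot_almost_exact JS JE H0s Y0s exoo.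
have JnJ : J n `<=` Joo by exact: ideal_bigcup_sub.
pose kI := quat_cone_hom (quot_pi_hom (J n)) kk.
(* The average is formed in [B], before $n$ is known; its image is an average for the image cone,
   hence lies in the commutant there. *)
have lift x : exists W : subalg (commutant kI), subalg_val W = quot_pi (J n) (average k x).
  have := (average_commutant kI (quot_pi (J n) x)).1.
  rewrite -(average_hom _ _ (quot_pi_hom (J n))) => xC.
  by exists (@mk_subalg _ _ (commutant kI) _ xC).
have [W WE] := lift (d *: h0); have [V VE] := lift (d *: y0); rewrite -/H0 -/Y0 in WE VE.
have vh := subalg_val_hom (commutant kI).
rewrite -WE -VE in fixd small.
have WV : twisted_fixed ((W, V) : twisted_of (subalg (commutant kI)) s).
  by case: fixd => W1 V1; apply: injective_projections; exact: subalg_val_inj.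
(* The iteration runs inside the commutant, so its limit still commutes with the quaternions. The
   norm is that of $B/J_n$, so the bound on the defect carries over. *)
have [|psi [psih psiP]] := universal_perturb un WV.
  by rewrite defect_fixed // in small; rewrite defect_fixed // /twisted_norm !subalg_normE
    [(_, _).1]/= [(_, _).2]/= (homN vh) (homB vh) !(homD vh) (homZ vh) !(homM vh).
have psiE a : quot_map Joo (subalg_val (psi a)) = phi (t (quat1 R) a).
  apply: (psiP _ (quot_map Joo \o @subalg_val _ _ (commutant kI)) (phi \o t (quat1 R))) => //=.
  - exact: star_hom_comp vh (quot_map_hom JnJ).
  - by rewrite WE quot_map_pi.
  by rewrite VE quot_map_pi.
exists n, (extension psi); split; first exact: extension_hom.
exact: (quot_map_extension JnJ ph c_gt0 kE psih psiE).
Qed.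

End Divisible.
End Amplification.

(** * Roots of $1-\mathrm{Re}\,z$ and the quotients by $t^{12}$ *)

Section CircleRoots.
Context (R : realType).
Local Notation circ := (circle R).
Implicit Type z : circ.

Lemma continuous_lipschitz (T : topologicalType) (F G : realCstarType R) (L : F -> G) (M : R)
    (f : T -> F) : (forall x y, `|L x - L y| <= M * `|x - y|) -> continuous f ->
  continuous (fun t => L (f t)).
Proof.
move=> LM fc t; apply: (@cvg_bound R G _ _ t (fun s => M * `|f t - f s|)).
  rewrite -(mulr0 M); apply: cvgM; first exact: cvg_cst.
  by apply: dist_cvg0; exact: fc.
exact: nearW.
Qed.

Lemma continuous_exp (f : circ -> R) n : continuous f -> continuous (fun z => f z ^+ n).
Proof.
move=> fc; elim: n => [|n IH]; first exact: cst_continuous.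
by under eq_fun do rewrite exprS; exact: continuous_mul.
Qed.

(** The proof takes $t$ to be [gap_root 5], so $t^{32}=1-\mathrm{Re}\,z$ and
    $\mathrm{Im}\,z=O(t^{16})$. One square root fewer would give only $O(t^8)$, too little for
    division by $t^{12}$. *)
Definition gap_root n z : R := iter n Num.sqrt (1 - cre z).

Lemma gap_root_ge0 n z : 0 <= gap_root n z.
Proof.
case: n => [|n]; last exact: sqrtr_ge0.
by have := cre_itv z; rewrite /gap_root /=; lra.
Qed.

Lemma gap_root_sqr n z : gap_root n.+1 z ^+ 2 = gap_root n z.
Proof. by rewrite sqr_sqrtr // gap_root_ge0. Qed.

Lemma gap_root1 n : gap_root n (circle1 R) = 0.
Proof.
elim: n => [|n IH]; first by rewrite /gap_root /= cre1 subrr.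
by rewrite /gap_root iterS -/(gap_root n _) IH sqrtr0.
Qed.

Lemma gap_root_conj n z : gap_root n (circle_conj z) = gap_root n z.
Proof. by rewrite /gap_root cre_conj. Qed.

Lemma gap_root_continuous n : continuous (gap_root n).
Proof.
elim: n => [|n IH]; last exact: continuous_sqrt.
apply: continuous_add; first exact: cst_continuous.
by apply: continuous_opp; exact: cre_continuous.
Qed.

Lemma gap_root_exp z : gap_root 5 z ^+ 32 = 1 - cre z.
Proof. by rewrite (exprM _ 2 16) gap_root_sqr (exprM _ 2 8) gap_root_sqr (exprM _ 2 4)
  gap_root_sqr (exprM _ 2 2) !gap_root_sqr. Qed.

Definition even_factor z : R := - gap_root 5 z ^+ 20.
Definition odd_factor z : R := cim z / gap_root 5 z ^+ 12.

Lemma even_factorE z : gap_root 5 z ^+ 12 * even_factor z = cre z - 1.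
Proof. by rewrite mulrN -exprD gap_root_exp opprB. Qed.

Lemma cim_gap z : `|cim z| <= 2 * gap_root 5 z ^+ 16.
Proof.
rewrite -(@ler_sqr R) ?nnegrE ?mulr_ge0 ?exprn_ge0 ?gap_root_ge0 //.
rewrite real_normK ?num_real // exprMn -exprM gap_root_exp.
have := circle_eq z; have := cre_itv z => /andP[h1 h2] e.
have : 0 <= (1 - cre z) * (3 - cre z) by rewrite mulr_ge0; lra.
have -> : (1 - cre z) * (3 - cre z) = 3 - 4 * cre z + cre z ^+ 2 by ring.
lra.
Qed.

Lemma odd_factorE z : gap_root 5 z ^+ 12 * odd_factor z = cim z.
Proof.
have [g0|g0] := eqVneq (gap_root 5 z) 0; last by rewrite /odd_factor mulrC divfK // expf_neq0.
have := cim_gap z; rewrite g0 !expr0n /= mul0r mulr0 normr_le0 => /eqP ->.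
by [].
Qed.

Lemma odd_factor_le z : `|odd_factor z| <= 2 * gap_root 5 z ^+ 4.
Proof.
have [g0|g0] := eqVneq (gap_root 5 z) 0.
  by rewrite /odd_factor g0 !expr0n /= invr0 mulr0 normr0 mulr0.
have gp : 0 < gap_root 5 z by rewrite lt0r g0 gap_root_ge0.
rewrite normrM normfV (ger0_norm (exprn_ge0 _ (ltW gp))) ler_pdivrMr ?exprn_gt0 //.
by rewrite -mulrA -exprD; exact: cim_gap.
Qed.

(** Only $z=1$ is in doubt. The regularised quotients with denominator $t^{12}+d$ are continuous and
    converge uniformly, by [small_ratio] applied to the bound $2t^4$. *)
Lemma odd_factor_continuous : continuous odd_factor.
Proof.
have gc := @gap_root_continuous 5.
apply: (@continuous_uniform_limit R R^o) => e e0.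
have [||||d d0 dP] := @small_ratio R circ (fun z => 2 * gap_root 5 z ^+ 4)
    (fun z => gap_root 5 z ^+ 12) (circle1 R) e (@circle_compact R) _ _ _ _ e0.
- by apply: continuous_mul; [exact: cst_continuous|exact: continuous_exp].
- exact: continuous_exp.
- by move=> z; rewrite exprn_ge0 // gap_root_ge0.
- by move=> z /eqP; rewrite expf_eq0 /= => /eqP ->; rewrite expr0n mulr0.
have gd z : 0 < gap_root 5 z ^+ 12 + d by rewrite ltr_wpDl // exprn_ge0 // gap_root_ge0.
exists (fun z => cim z / (gap_root 5 z ^+ 12 + d)).
  apply: continuous_mul; first exact: cim_continuous.
  apply: continuous_inv => [|z]; last by rewrite lt0r_neq0.
  by apply: continuous_add; [exact: continuous_exp|exact: cst_continuous].
move=> z; apply: le_trans (dP z).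
have -> : odd_factor z - cim z / (gap_root 5 z ^+ 12 + d) =
    odd_factor z * (d / (gap_root 5 z ^+ 12 + d)).
  rewrite -[cim z in X in _ - X]odd_factorE; field.
  by rewrite lt0r_neq0.
rewrite normrM [`|d / _|]ger0_norm ?divr_ge0 ?(ltW (gd z)) ?(ltW d0) //.
rewrite ler_wpM2r ?divr_ge0 ?(ltW (gd z)) ?(ltW d0) //.
by rewrite [leRHS]ger0_norm ?mulr_ge0 ?exprn_ge0 ?gap_root_ge0 // odd_factor_le.
Qed.

Lemma odd_factor1 : odd_factor (circle1 R) = 0.
Proof. by rewrite /odd_factor cim1 mul0r. Qed.

Lemma odd_factor_conj z : odd_factor (circle_conj z) = - odd_factor z.
Proof. by rewrite /odd_factor cim_conj gap_root_conj mulNr. Qed.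

End CircleRoots.

(** * $A_3$ as $\mathbb H\otimes A_{-1}$ *)

Section QuaternionLoops.
Context (R : realType).
Local Notation H := (quaternion R).

Lemma quat_coord_linear (c : R) (p q : H) e :
  quat_coord (c *: p + q) e = c * quat_coord p e + quat_coord q e.
Proof. by case: e => -[|[|[|[|//]]]] ?. Qed.

Lemma quat_coord_le (q : H) e : `|quat_coord q e| <= `|q|.
Proof.
rewrite -sqrtr_sqr quat_normE ler_wsqrtr //.
have := sqr_ge0 (qre q); have := sqr_ge0 (qi q); have := sqr_ge0 (qj q).
have := sqr_ge0 (qk q).
by case: e => -[|[|[|[|//]]]] ?; rewrite /quat_coord /=; lra.
Qed.

Lemma A3_tensor_proof (q : H) (f : Am1 R) : A3_set (fun z => (fun_val f z : R) *: q).
Proof.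
have [fc f1] := fun_valP f; split; last by rewrite f1 scale0r.
apply: (@continuous_lipschitz R _ R^o H (fun r : R => r *: q) `|q|) => // x y.
by rewrite -scalerBl normrZ mulrC.
Qed.

Lemma A3_coord_proof e (f : A3 R) : Am1_set (fun z => (quat_coord (fun_val f z) e : R^o)).
Proof.
have [fc f1] := fun_valP f; split; last by rewrite f1; case: e => -[|[|[|[|//]]]] ?.
apply: (@continuous_lipschitz R _ H R^o (fun q : H => quat_coord q e) 1) => // x y.
have -> : quat_coord x e - quat_coord y e = quat_coord (x - y) e.
  by case: e => -[|[|[|[|//]]]] ?.
by rewrite mul1r; exact: quat_coord_le.
Qed.

Definition A3_tensor (q : H) (f : Am1 R) : A3 R :=
  FunAlg (A3_tensor_proof q f : fun_set (A3_algebra R) _).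
Definition A3_coord e (f : A3 R) : Am1 R :=
  FunAlg (A3_coord_proof e f : fun_set (Am1_algebra R) _).

Lemma A3_quat_tensor : quat_tensor A3_tensor A3_coord.
Proof.
split.
- by move=> c p q a; apply: fun_algP => z; apply: quatP => /=; ring.
- move=> q c a b; apply: fun_algP => z.
  transitivity ((c * fun_val a z + fun_val b z) *: q); first by [].
  by rewrite scalerDl -scalerA.
- move=> p q a b; apply: fun_algP => z.
  transitivity ((fun_val a z *: p) ** (fun_val b z *: q) : H); first by [].
  by rewrite amulZl amulZr scalerA.
- by move=> q a; apply: fun_algP => z; exact: starZ.
- move=> x; apply: fun_algP => z; by rewrite sum_ord4 [LHS]quat_expand sum_ord4.
- by move=> e c x y; apply: fun_algP => z; exact: quat_coord_linear.
move=> e q a; apply: fun_algP => z.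
by case: e => -[|[|[|[|//]]]] ?; exact: mulrC.
Qed.

Lemma Am1_even_proof : Am1_set (fun z => (even_factor z : R^o)).
Proof.
split; last by rewrite /even_factor gap_root1 expr0n oppr0.
by apply: continuous_opp; apply: continuous_exp; exact: gap_root_continuous.
Qed.

Lemma Am1_odd_proof : Am1_set (fun z => (odd_factor z : R^o)).
Proof. by split; [exact: odd_factor_continuous|exact: odd_factor1]. Qed.

Lemma Am1_root_proof n : Am1_set (fun z => (gap_root n z : R^o)).
Proof. by split; [exact: gap_root_continuous|exact: gap_root1]. Qed.

Definition Am1_even : Am1 R := FunAlg (Am1_even_proof : fun_set (Am1_algebra R) _).
Definition Am1_odd : Am1 R := FunAlg (Am1_odd_proof : fun_set (Am1_algebra R) _).
Definition Am1_root n : Am1 R := FunAlg (Am1_root_proof n : fun_set (Am1_algebra R) _).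

Lemma Am1_root_pow m n z : (rho_pow (Am1_root m) n) z = gap_root m z ^+ n.+1.
Proof.
elim: n => [|n IH]; first by rewrite expr1.
by rewrite exprS -IH.
Qed.

Theorem semiprojective_A3 : semiprojective (A3 R).
Proof.
(* [Am1_root 6] is a square root of [Am1_root 5] and exhibits it as positive. *)
apply: (quat_semiprojective A3_quat_tensor (rho := Am1_root 5) (c0 := Am1_root 6) _ _
  (eh := Am1_even) (ey := Am1_odd) (@Am1_universal R)).
- by apply: fun_algP => z; rewrite -[LHS]gap_root_sqr expr2.
- by move=> a; apply: fun_algP => z; exact: mulrC.
- by apply: fun_algP.
- by apply: fun_algP => z; rewrite expr0 scale1r.
- by apply: fun_algP => z; rewrite fun_valM Am1_root_pow; exact: (esym (even_factorE z)).
by apply: fun_algP => z; rewrite fun_valM Am1_root_pow; exact: (esym (odd_factorE z)).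
Qed.

End QuaternionLoops.

(** * $A_5$ as $\mathbb H\otimes A_1$ *)

Section MatrixLoops.
Context (R : realType).
Local Notation H := (quaternion R).
Local Notation C := (Rcomplex R).
Local Notation M := (M2C R).
Local Notation Re := complex.Re.
Local Notation Im := complex.Im.
Local Notation entry A i j := ((A : 'M[(R[i])%C]_2) i j).
Implicit Types (v w : C) (p q : H) (A B : M).

Lemma m2cP A B :
  [/\ Re (entry A 0 0) = Re (entry B 0 0), Re (entry A 0 1) = Re (entry B 0 1),
      Re (entry A 1 0) = Re (entry B 1 0) & Re (entry A 1 1) = Re (entry B 1 1)] ->
  [/\ Im (entry A 0 0) = Im (entry B 0 0), Im (entry A 0 1) = Im (entry B 0 1),
      Im (entry A 1 0) = Im (entry B 1 0) & Im (entry A 1 1) = Im (entry B 1 1)] ->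
  A = B.
Proof.
move=> [? ? ? ?] [? ? ? ?].
have o (i : 'I_2) : i = 0 \/ i = 1.
  by case: i => -[|[|//]] ?; [left|right]; apply: val_inj.
by apply/matrixP => i j; case: (o i) => ->; case: (o j) => ->; exact: complexP.
Qed.

(* [w] times the image of [q] under [i |-> diag(i, -i)], [j |-> (0 1; -1 0)]. *)
Definition m2_of w q : M := \matrix_(i < 2, j < 2)
  if i == 0 then
    if j == 0 then Complex (Re w * qre q - Im w * qi q) (Re w * qi q + Im w * qre q)
    else Complex (Re w * qj q - Im w * qk q) (Re w * qk q + Im w * qj q)
  else
    if j == 0 then Complex (- (Re w * qj q + Im w * qk q)) (Re w * qk q - Im w * qj q)
    else Complex (Re w * qre q + Im w * qi q) (Im w * qre q - Re w * qi q).

Definition m2_coord A (e : 'I_4) : C :=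
  let a := entry A 0 0 in let b := entry A 0 1 in
  let c := entry A 1 0 in let d := entry A 1 1 in
  nth 0 [:: Complex (2^-1 * (Re a + Re d)) (2^-1 * (Im a + Im d));
            Complex (2^-1 * (Im a - Im d)) (2^-1 * (Re d - Re a));
            Complex (2^-1 * (Re b - Re c)) (2^-1 * (Im b - Im c));
            Complex (2^-1 * (Im b + Im c)) (- (2^-1 * (Re b + Re c)))] e.

Lemma m2_of_linearl (c : R) v w q : m2_of (c *: v + w) q = c *: m2_of v q + m2_of w q.
Proof.
by case: v w => ? ? [? ?]; apply: m2cP; split; rewrite !mxE /=; ring.
Qed.

Lemma m2_of_linearr (c : R) w p q : m2_of w (c *: p + q) = c *: m2_of w p + m2_of w q.
Proof.
by case: w p q => ? ? [? ? ? ?] [? ? ? ?]; apply: m2cP; split; rewrite !mxE /=; ring.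
Qed.

Lemma m2_ofM v w p q : m2_of v p ** m2_of w q = m2_of (v ** w) (p ** q).
Proof.
by case: v w p q => ? ? [? ?] [? ? ? ?] [? ? ? ?]; apply: m2cP; split;
  rewrite !mxE !sum2E !mxE /=; ring.
Qed.

Lemma m2_of_star w q : star (m2_of w q) = m2_of (star w) (star q).
Proof.
by case: w q => ? ? [? ? ? ?]; apply: m2cP; split; rewrite !mxE /=; ring.
Qed.

(** Thus $\sharp$ is the complex-linear extension of quaternion conjugation, and the condition that
    defines $A_5$ becomes that of $A_1$ on every quaternion coordinate. *)
Lemma m2_sharp_of w q : m2_sharp (m2_of w q) = m2_of w (star q).
Proof.
by case: w q => ? ? [? ? ? ?]; apply: m2cP; split; rewrite !mxE /=; ring.
Qed.

Lemma m2_expand A : A = \sum_e m2_of (m2_coord A e) (quat_basis R e).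
Proof.
rewrite sum_ord4 /m2_coord /quat_basis !inordK //=.
by apply: m2cP; split; rewrite !mxE /=; lra.
Qed.

Lemma m2_coord_linear e (c : R) A B :
  m2_coord (c *: A + B) e = c *: m2_coord A e + m2_coord B e.
Proof.
rewrite /m2_coord !mxE.
case: (entry A 0 0) (entry A 0 1) (entry A 1 0) (entry A 1 1) => [? ?] [? ?] [? ?] [? ?].
case: (entry B 0 0) (entry B 0 1) (entry B 1 0) (entry B 1 1) => [? ?] [? ?] [? ?] [? ?].
by case: e => -[|[|[|[|//]]]] ?; apply: complexP => /=; ring.
Qed.

Lemma m2_coord_of e w q : m2_coord (m2_of w q) e = quat_coord q e *: w.
Proof.
case: w => ? ?.
by case: e => -[|[|[|[|//]]]] ?; apply: complexP; rewrite /m2_coord !mxE /quat_coord /=; field.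
Qed.

Lemma m2_coord_star e A B : m2_sharp A = star B -> m2_coord A e = conjc (m2_coord B e).
Proof.
move=> AB; have AE i j : entry (m2_sharp A) i j = conjc (entry B j i) by rewrite AB !mxE.
have := (AE 0 0, AE 0 1, AE 1 0, AE 1 1); rewrite /m2_coord !mxE /=.
case: (entry A 0 0) (entry A 0 1) (entry A 1 0) (entry A 1 1) => [? ?] [? ?] [? ?] [? ?].
case: (entry B 0 0) (entry B 0 1) (entry B 1 0) (entry B 1 1) => [? ?] [? ?] [? ?] [? ?].
case=> -[[[-> ->] [e1 e2]] [e3 e4]] [-> ->].
by case: e => -[|[|[|[|//]]]] ?; apply: complexP => /=; lra.
Qed.

Lemma m2_of_lipschitz q v w :
  `|m2_of v q - m2_of w q| <= 4 * `|m2_of (Complex 1 0) q| * `|v - w|.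
Proof.
(* The difference enters as the scalar matrix $v-w$; the factor 4 is that of [m2_norm_le_entry]. *)
have -> : m2_of v q - m2_of w q = m2_of (v - w) (quat1 R) ** m2_of (Complex 1 0) q.
  have m1 u : u ** (Complex 1 0 : C) = u by case: u => ? ?; apply: complexP => /=; ring.
  rewrite m2_ofM m1 quat_mul1l; have := m2_of_linearl (-1) w v q.
  by rewrite !scaleN1r ![- _ + _]addrC => <-.
apply: le_trans (normr_amul _ _) _; rewrite mulrC [4 * _]mulrC -mulrA ler_wpM2l //.
apply: m2_norm_le_entry => i j; move: (v - w) => u; rewrite mxE.
have n0 : 0 <= `|u| by [].
have nu v' : v' = u \/ v' = 0 -> Normc.normc v' <= `|u|.
  by case=> ->; [exact: lexx|rewrite /= expr0n addr0 sqrtr0].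
case: ifP => _; case: ifP => _; apply: nu; [left|right|right|left];
  by apply: complexP => /=; ring.
Qed.

Lemma m2_coord_lipschitz e A B : `|m2_coord A e - m2_coord B e| <= 2 * `|A - B|.
Proof.
have -> : m2_coord A e - m2_coord B e = m2_coord (A - B) e.
  by have := m2_coord_linear e (-1) B A; rewrite !scaleN1r ![- _ + _]addrC => ->.
have en i j : `|Re (entry (A - B) i j)| <= `|A - B| /\ `|Im (entry (A - B) i j)| <= `|A - B|.
  have h := normc_entry_le (A - B) i j.
  by split; apply: le_trans h; [exact: (@Re_le_norm R)|exact: (@Im_le_norm R)].
move: (en 0 0) (en 0 1) (en 1 0) (en 1 1); move: (A - B) (`|A - B|) => D m.
rewrite /m2_coord; case: (entry D 0 0) (entry D 0 1) (entry D 1 0) (entry D 1 1)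
  => [? ?] [? ?] [? ?] [? ?] /= [+ +] [+ +] [+ +] [+ +].
have half x y : `|x| <= m -> `|y| <= m -> `|2^-1 * (x + y)| <= m /\ `|2^-1 * (x - y)| <= m.
  by rewrite !ler_norml => /andP[? ?] /andP[? ?]; split; apply/andP; split; lra.
move=> ? ? ? ? ? ? ? ?.
apply: le_trans (norm_le_ReIm _) _; rewrite [2 * m]mulr_natl [m *+ 2]mulr2n.
by case: e => -[|[|[|[|//]]]] ? /=; apply: lerD;
  rewrite ?normrN; (apply: (half _ _ _ _).2 || apply: (half _ _ _ _).1).
Qed.

Lemma m2_coord0 e : m2_coord 0 e = 0.
Proof.
by case: e => -[|[|[|[|//]]]] ?; apply: complexP; rewrite /m2_coord !mxE /=; ring.
Qed.

Lemma m2_of0 q : m2_of 0 q = 0.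
Proof. by apply: m2cP; split; rewrite !mxE /=; ring. Qed.

Lemma A5_tensor_proof q (f : A1 R) : A5_set (fun z => m2_of (fun_val f z) q).
Proof.
have [fc f1 fs] := fun_valP f; split.
- apply: (@continuous_lipschitz R _ C M (m2_of^~ q) _ _ _ fc) => x y.
  exact: m2_of_lipschitz.
- by rewrite f1 m2_of0.
by move=> z; rewrite m2_sharp_of m2_of_star fs.
Qed.

Lemma A5_coord_proof e (f : A5 R) : A1_set (fun z => m2_coord (fun_val f z) e).
Proof.
have [fc f1 fs] := fun_valP f; split.
- apply: (@continuous_lipschitz R _ M C (fun A => m2_coord A e) 2 _ _ fc) => x y.
  exact: m2_coord_lipschitz.
- by rewrite f1 m2_coord0.
by move=> z; apply: m2_coord_star; exact: fs.
Qed.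

Definition A5_tensor q (f : A1 R) : A5 R :=
  FunAlg (A5_tensor_proof q f : fun_set (A5_algebra R) _).
Definition A5_coord e (f : A5 R) : A1 R :=
  FunAlg (A5_coord_proof e f : fun_set (A1_algebra R) _).

Lemma A5_quat_tensor : quat_tensor A5_tensor A5_coord.
Proof.
split.
- by move=> c p q a; apply: fun_algP => z; exact: m2_of_linearr.
- by move=> q c a b; apply: fun_algP => z; exact: m2_of_linearl.
- by move=> p q a b; apply: fun_algP => z; exact: m2_ofM.
- by move=> q a; apply: fun_algP => z; exact: m2_of_star.
- by move=> x; apply: fun_algP => z; rewrite sum_ord4 [LHS]m2_expand sum_ord4.
- by move=> e c x y; apply: fun_algP => z; exact: m2_coord_linear.
by move=> e q a; apply: fun_algP => z; exact: m2_coord_of.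
Qed.

Lemma A1_real_proof (f : circle R -> R) : continuous f -> f (circle1 R) = 0 ->
  (forall z, f (circle_conj z) = f z) -> A1_set (fun z => (Complex (f z) 0 : C)).
Proof.
move=> fc f1 fs; split=> [|| z]; last by rewrite fs; apply: complexP => //=; rewrite oppr0.
  by apply: continuous_Complex => //; exact: cst_continuous.
by rewrite f1.
Qed.

Lemma A1_even_proof : A1_set (fun z => (Complex (even_factor z) 0 : C)).
Proof.
apply: A1_real_proof => [||z]; last by rewrite /even_factor gap_root_conj.
  by apply: continuous_opp; apply: continuous_exp; exact: gap_root_continuous.
by rewrite /even_factor gap_root1 expr0n oppr0.
Qed.

Lemma A1_odd_proof : A1_set (fun z => (Complex 0 (odd_factor z) : C)).
Proof.
split=> [||z].
- by apply: continuous_Complex; [exact: cst_continuous|exact: odd_factor_continuous].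
- by rewrite odd_factor1.
by rewrite odd_factor_conj.
Qed.

Lemma A1_root_proof n : A1_set (fun z => (Complex (gap_root n z) 0 : C)).
Proof.
apply: A1_real_proof => [||z]; first exact: gap_root_continuous.
  exact: gap_root1.
exact: gap_root_conj.
Qed.

Definition A1_even : A1 R := FunAlg (A1_even_proof : fun_set (A1_algebra R) _).
Definition A1_odd : A1 R := FunAlg (A1_odd_proof : fun_set (A1_algebra R) _).
Definition A1_root n : A1 R := FunAlg (A1_root_proof n : fun_set (A1_algebra R) _).

Lemma A1_root_pow m n z :
  (rho_pow (A1_root m) n) z = Complex (gap_root m z ^+ n.+1) 0 :> C.
Proof.
elim: n => [|n IH]; first by rewrite expr1.
transitivity (Complex (gap_root m z) 0 * (rho_pow (A1_root m) n z) : C); first by [].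
rewrite IH [in RHS]exprS; move: (gap_root m z) (_ ^+ _) => g g'.
by apply: complexP => /=; ring.
Qed.

Theorem semiprojective_A5 : semiprojective (A5 R).
Proof.
apply: (quat_semiprojective A5_quat_tensor (rho := A1_root 5) (c0 := A1_root 6) _ _
  (eh := A1_even) (ey := A1_odd) (@A1_universal R)).
- apply: fun_algP => z; transitivity (Complex (gap_root 6 z ^+ 2) 0 : C).
    by rewrite gap_root_sqr.
  transitivity (star (Complex (gap_root 6 z) 0 : C) ** Complex (gap_root 6 z) 0); last by [].
  by move: (gap_root 6 z) => g; apply: complexP => /=; ring.
- by move=> a; apply: fun_algP => z; exact: mulrC.
- by apply: fun_algP => z; apply: complexP => //=; rewrite oppr0.
- by rewrite expr1 scaleN1r; apply: fun_algP => z; rewrite fun_valN;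
    apply: complexP => //=; rewrite oppr0.
- apply: fun_algP => z; rewrite fun_valM A1_root_pow.
  transitivity (Complex (gap_root 5 z ^+ 12 * even_factor z) 0 : C).
    by rewrite even_factorE.
  transitivity ((Complex (gap_root 5 z ^+ 12) 0 : C) ** Complex (even_factor z) 0); last by [].
  by move: (gap_root 5 z ^+ 12) (even_factor z) => g g'; apply: complexP => /=; ring.
apply: fun_algP => z; rewrite fun_valM A1_root_pow.
transitivity (Complex 0 (gap_root 5 z ^+ 12 * odd_factor z) : C).
  by rewrite odd_factorE.
transitivity ((Complex (gap_root 5 z ^+ 12) 0 : C) ** Complex 0 (odd_factor z)); last by [].
by move: (gap_root 5 z ^+ 12) (odd_factor z) => g g'; apply: complexP => /=; ring.
Qed.

End MatrixLoops.

Theorem proposition3p12 (R : realType) :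
  [/\ semiprojective (Am1 R), semiprojective (A1 R),
      semiprojective (A3 R) & semiprojective (A5 R)].
Proof.
split; [exact: semiprojective_Am1|exact: semiprojective_A1|exact: semiprojective_A3|].
exact: semiprojective_A5.
Qed.
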